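(* For every two non-trivial words $w_1, w_2$ there exists $N = N(w_1,w_2)$ such that if $G$ is a classical connected real compact Lie group of rank at least $N$, then $$w_1(G)\,w_2(G) = G,$$ i.e. every element of $G$ can be written as $g_1g_2$ with $g_1\in w_1(G)$ and $g_2\in w_2(G)$.
   Context: A word is an element $w=w(x_1,\dots,x_d)$ of a free group $F_d$ on $x_1,\dots,x_d$ (for some $d\ge 1$, which may differ for different words); it is non-trivial if $w\neq 1$ in $F_d$. For a group $G$, substitution gives the word map $w:G^d\to G$, $(g_1,\dots,g_d)\mapsto w(g_1,\dots,g_d)$, and $w(G)\subseteq G$ denotes its image. For subsets $A,B\subseteq G$, $AB=\{ab: a\in A, b\in B\}$. A classical connected real compact Lie group is a connected compact Lie group whose simply connected cover is one of $\mathrm{SU}(n)$, $\mathrm{Sp}(n)=\mathrm{U}(2n)\cap\mathrm{Sp}(2n,\mathbb{C})$, or $\mathrm{Spin}(n)$; equivalently, a quotient of one of these groups by a central subgroup. The rank is the dimension of a maximal torus. *)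

(* Defs.v *)
From HB Require Import structures.
From mathcomp Require Import all_boot all_order all_algebra.
From mathcomp Require Import spectral complex.
From mathcomp Require Import all_classical all_reals all_analysis.
Import numFieldNormedType.Exports.

Set Implicit Arguments.
Unset Strict Implicit.
Unset Printing Implicit Defensive.

Import Order.TTheory GRing.Theory Num.Theory.
Local Open Scope classical_set_scope.

(* [(i, false)] stands for the generator x_i and [(i, true)] for its inverse. *)
Definition letter (d : nat) : Type := ('I_d * bool)%type.

HB.instance Definition _ d := Finite.on (letter d).

Definition linv d (a : letter d) : letter d := (a.1, ~~ a.2).

Definition reduced d (s : seq (letter d)) : bool :=
  sorted (fun a b => b != linv a) s.

(* Elements of the free group F_d are represented by their reduced words. *)
Record free_group (d : nat) := FreeGroup {
  fword : seq (letter d);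
  _ : reduced fword }.

HB.instance Definition _ d := [isSub for @fword d].
HB.instance Definition _ d := [Choice of free_group d by <:].

Section FreeGroup.
Variable d : nat.
Implicit Types (a b : letter d) (s t u : seq (letter d)).

Lemma linvK : involutive (@linv d).
Proof. by case=> i e; rewrite /linv /= negbK. Qed.

Definition push a s : seq (letter d) :=
  if s is b :: s' then (if b == linv a then s' else a :: s) else [:: a].

Definition wmul s t := foldr push t s.

Definition winv s := rev (map (@linv d) s).

Lemma reduced_behead a s : reduced (a :: s) -> reduced s.
Proof. exact: path_sorted. Qed.

Lemma push_reduced a s : reduced s -> reduced (push a s).
Proof.
case: s => [//|b s] /= bs; case: ifPn => [_|ba]; first exact: path_sorted bs.
by rewrite /reduced /= ba.
Qed.

Lemma push_cons a s : reduced (a :: s) -> push a s = a :: s.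
Proof. by case: s => [//|b s] /= /andP[/negPf ->]. Qed.

Lemma pushK a s : reduced s -> push a (push (linv a) s) = s.
Proof.
case: s => [_ /=|b s bs /=]; first by rewrite eqxx.
rewrite linvK; case: eqP => [ba|ba] /=; last by rewrite eqxx.
by rewrite -ba push_cons.
Qed.

Lemma wmul_reduced s t : reduced t -> reduced (wmul s t).
Proof. by move=> rt; elim: s => [//|a s IH] /=; exact: push_reduced. Qed.

Lemma wmul_push a s t :
  reduced t -> wmul (push a s) t = push a (wmul s t).
Proof.
move=> rt; case: s => [//|b s] /=; case: eqP => [->|//].
by rewrite pushK //; exact: wmul_reduced.
Qed.

Lemma wmulA s t u : reduced u -> wmul s (wmul t u) = wmul (wmul s t) u.
Proof. by move=> ru; elim: s => [//|a s IH] /=; rewrite wmul_push // IH. Qed.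

Lemma wmuls0 s : reduced s -> wmul s [::] = s.
Proof.
elim: s => [//|a s IH] rs /=.
by rewrite IH; [exact: push_cons|exact: reduced_behead rs].
Qed.

Lemma winv_reduced s : reduced s -> reduced (winv s).
Proof.
rewrite /reduced /winv rev_sorted sorted_map.
apply: sub_sorted => a b; apply: contraNN => /eqP /= h.
by rewrite -(linvK b) -h.
Qed.

Lemma winvK : involutive winv.
Proof.
by move=> s; rewrite /winv map_rev revK -map_comp map_id_in // => a _; exact: linvK.
Qed.

Lemma wmulVs s : reduced s -> wmul (winv s) s = [::].
Proof.
elim: s => [//|a s IH] rs.
rewrite /winv map_cons rev_cons /wmul foldr_rcons /= linvK eqxx.
by apply: IH; exact: reduced_behead rs.
Qed.

Lemma fwordP (u : free_group d) : reduced (fword u). Proof. exact: valP. Qed.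

Definition free_one : free_group d := @FreeGroup d [::] isT.
Definition free_mul (u v : free_group d) : free_group d :=
  FreeGroup (wmul_reduced (fword u) (fwordP v)).
Definition free_inv (u : free_group d) : free_group d :=
  FreeGroup (winv_reduced (fwordP u)).

Lemma free_mulA : associative free_mul.
Proof. by move=> u v w; apply: val_inj; rewrite /= wmulA // fwordP. Qed.

Lemma free_mul1g : left_id free_one free_mul.
Proof. by move=> u; exact: val_inj. Qed.

Lemma free_mulg1 : right_id free_one free_mul.
Proof. by move=> u; apply: val_inj; rewrite /= wmuls0 // fwordP. Qed.

Lemma free_mulVg : left_inverse free_one free_inv free_mul.
Proof. by move=> u; apply: val_inj; rewrite /= wmulVs // fwordP. Qed.

Lemma free_mulgV : right_inverse free_one free_inv free_mul.
Proof.
move=> u; apply: val_inj; rewrite /= -{1}(winvK (fword u)) wmulVs //.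
exact: winv_reduced (fwordP u).
Qed.

End FreeGroup.

HB.instance Definition _ d := isGroup.Build (free_group d)
  (@free_mulA d) (@free_mul1g d) (@free_mulg1 d) (@free_mulVg d) (@free_mulgV d).

Section WordMaps.
Local Open Scope group_scope.
Variables (d : nat) (G : groupType).

Definition leval (g : 'I_d -> G) (a : letter d) : G :=
  if a.2 then (g a.1)^-1 else g a.1.

Definition word_map (w : free_group d) (g : 'I_d -> G) : G :=
  \prod_(a <- fword w) leval g a.

Definition word_image (w : free_group d) : set G := range (word_map w).

Lemma word_map1 g : word_map 1 g = 1.
Proof. by rewrite /word_map big_nil. Qed.

Lemma word_mapM u v g : word_map (u * v) g = word_map u g * word_map v g.
Proof.
rewrite /word_map /=; elim: (fword u) => [|a s IH] /=.
  by rewrite big_nil mul1g.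
rewrite big_cons -mulgA -IH; case: (wmul s _) => [|b t] /=.
  by rewrite big_cons.
case: eqP => [->|_]; last by rewrite big_cons.
rewrite big_cons mulgA /leval /=; case: a.2 => /=.
  by rewrite mulVg mul1g.
by rewrite mulgV mul1g.
Qed.

End WordMaps.

Arguments word_image {d} G w.

HB.mixin Record isTopologicalGroup G & Group G & Topological G := {
  mulg_continuous : continuous (fun z : G * G => z.1 * z.2)%g;
  invg_continuous : continuous (fun x : G => x^-1)%g }.

#[short(type="topologicalGroupType")]
HB.structure Definition TopologicalGroup :=
  {G of Group G & Topological G & isTopologicalGroup G}.

Local Open Scope ring_scope.

(* An r-dimensional torus is a copy of R^r / Z^r; in a Hausdorff group the
   induced continuous bijection from the compact space R^r / Z^r onto [T] is a
   homeomorphism. *)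
Definition is_torus (R : realType) (G : topologicalGroupType) (r : nat)
    (T : set G) : Prop :=
  exists phi : 'rV[R]_r -> G,
    [/\ continuous phi,
        {morph phi : x y / x + y >-> (x * y)%g},
        forall x, phi x = 1%g <-> forall i, x 0 i \is a Num.int
      & range phi = T].

Definition is_maximal_torus (R : realType) (G : topologicalGroupType) (r : nat)
    (T : set G) : Prop :=
  is_torus R r T /\
  forall (s : nat) (S : set G), is_torus R s S -> T `<=` S -> S = T.

Definition has_rank (R : realType) (G : topologicalGroupType) (r : nat) : Prop :=
  exists T : set G, is_maximal_torus R r T.

(* The usual topology of the complex numbers, given by the norm. *)
HB.instance Definition _ (R : realType) :=
  PseudoPointedMetric.copy R[i] (R[i])^o.

Section UnitaryGroups.
Variables (R : realType) (n : nat).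

Definition SU : set 'M[R[i]]_n :=
  [set A | A \is unitarymx /\ \det A = 1].

Definition symplectic_form : 'M[R[i]]_(n + n) :=
  block_mx 0 1%:M (- 1%:M) 0.

Definition Sp : set 'M[R[i]]_(n + n) :=
  [set A | A \is unitarymx /\ A^T *m symplectic_form *m A = symplectic_form].

End UnitaryGroups.

Section Clifford.
Variables (R : realType) (n : nat).

(* The Clifford algebra of R^n for v^2 = - |v|^2, as the real vector space with
   basis (e_A), A ranging over the subsets {a_1 < ... < a_k} of {0, ..., n-1},
   where e_A = e_{a_1} ... e_{a_k}. *)
Definition clifford : Type := 'rV[R]_#|{set 'I_n}|.

HB.instance Definition _ := GRing.Lmodule.on clifford.
HB.instance Definition _ := PointedTopological.on clifford.

Definition blade (A : {set 'I_n}) : clifford := delta_mx 0 (enum_rank A).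

Definition coef (x : clifford) (A : {set 'I_n}) : R := x 0 (enum_rank A).

Definition symdiff (A B : {set 'I_n}) : {set 'I_n} := (A :\: B) :|: (B :\: A).

(* e_A e_B = +/- e_(A symdiff B): a factor -1 for each a in A, b in B with
   a > b, as e_a e_b = - e_b e_a, and for each a = b, as e_a^2 = -1. *)
Definition blade_sign (A B : {set 'I_n}) : R :=
  (-1) ^+ #|[set p : 'I_n * 'I_n | [&& p.1 \in A, p.2 \in B & (p.2 <= p.1)%N]]%SET|.

Definition clifford_mul (x y : clifford) : clifford :=
  \sum_(A : {set 'I_n}) \sum_(B : {set 'I_n})
    (coef x A * coef y B * blade_sign A B) *: blade (symdiff A B).

Definition clifford_one : clifford := blade finset.set0.

Definition clifford_vec (v : 'rV[R]_n) : clifford :=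
  \sum_(i < n) v 0 i *: blade [set i]%SET.

Definition unit_vector (v : 'rV[R]_n) : Prop := \sum_(i < n) v 0 i ^+ 2 = 1.

Definition Spin : set clifford :=
  [set x | exists s : seq 'rV[R]_n,
     [/\ ~~ odd (size s),
         forall v, v \in s -> unit_vector v
       & x = foldr (fun v y => clifford_mul (clifford_vec v) y)
               clifford_one s]].

End Clifford.

(* [G] is isomorphic, as a topological group, to the quotient by a central
   subgroup of the group with underlying space [K] and product [mulK]. *)
Definition central_quotient (A : topologicalType) (K : set A)
    (mulK : A -> A -> A) (G : topologicalGroupType) : Prop :=
  exists pi : A -> G,
    [/\ forall x y, K x -> K y -> pi (mulK x y) = (pi x * pi y)%g,
        pi @` K = setT,
        forall z x, K z -> K x -> pi z = 1%g -> mulK z x = mulK x z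
      & forall U : set G, open U <-> open (pi @^-1` U : set (subspace K))].

(* The bound on n for Spin(n) is the one making it simply connected with finite
   center; all central subgroups below are thus finite, so that the quotients
   are indeed compact (Hausdorff) Lie groups covered by SU(n), Sp(n), Spin(n). *)
Definition classical_compact_group (R : realType) (G : topologicalGroupType) :
    Prop :=
  [\/ exists2 n, (1 <= n)%N & central_quotient (@SU R n) mulmx G,
      exists2 n, (1 <= n)%N & central_quotient (@Sp R n) mulmx G
    | exists2 n, (3 <= n)%N &
        central_quotient (@Spin R n) (@clifford_mul R n) G].

(* Main.v *)
(** Goto's argument.  If c is a Coxeter element of the compact group K, then
  1 - c is onto on the maximal torus, so every element of K is conjugate to a
  commutator c s c^-1 s^-1 and K is the product of the classes of c and c^-1.
  It remains to see that both classes meet w(K) for every nontrivial w once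
  the rank is large.  The spectrum of c consists of the weights of a symmetric
  power of the SU(2) element with eigenvalues e^(+-i pi/h), where h tends to
  infinity with the rank, so c is conjugate to the image of that element
  under a representation of SU(2), and it suffices that w takes on SU(2) all
  traces in some [2 - eps, 2].  Substitute rotations by the angle 2 arctan x
  about pairwise distinct coplanar axes for the variables: the result is
  rational in x, trivial at x = 0, and non-constant because after clearing
  denominators it becomes at x = -i a nonzero product of rank one matrices.
  The traces then follow from the intermediate value theorem.

  All these conjugacies are found in {U unitary | F U = conj(U) F} with F a
  real unitary matrix of square +-1, where equal characteristic polynomials suffice.
  For the spin groups the computation in SO(n) lifts up to a sign; c negates
  a unit vector v, so conjugating one of the two factors by v changes this
  sign.

  In a central quotient of rank r, the elements of order p of the maximal
  torus, for a large prime p, lift to r independent commuting matrices of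
  order p; hence r is bounded by the size of the matrices. *)

Require Import Defs.
From HB Require Import structures.
From mathcomp Require Import all_boot all_order all_algebra.
From mathcomp Require Import all_fingroup sesquilinear spectral polyXY complex zify ring lra.
From mathcomp Require Import all_classical all_reals all_analysis.
Import numFieldNormedType.Exports.

Set Implicit Arguments.
Unset Strict Implicit.
Unset Printing Implicit Defensive.

Import Order.TTheory GRing.Theory Num.Theory Num.Def.
Local Open Scope ring_scope.
Local Open Scope sesquilinear_scope.
Local Notation "M ^bar" := (map_mx conjC M) (at level 30) : ring_scope.

(** * Conjugacy in unitary groups with a real structure *)

Section UnitaryConjugacy.
Variable C : numClosedFieldType.

(** Conjugating elements may come from any group normalizing K, so the full unitary or orthogonal
    group is used where it helps: in O(n), unlike SO(n), the characteristic polynomial determines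
    the class. Surjectivity of 1 - c on the torus is made explicit: c permutes coordinates
    cyclically up to signs, and s consists of partial products of the prescribed torus element. As c
    is real, its inverse has the same spectrum, so one trace serves both words. The symmetric power
    of degree k preserves a structure of sign (-1)^k: odd k gives the symplectic groups, even k the
    odd orthogonal ones, and an added trivial summand the even orthogonal ones. The axes are
    coplanar so that the rank one matrices at x = -i come from real vectors, whose pairings are 1 +
    n_i n_j or a difference of slopes n_i, n_j; reducedness of the word keeps these pairings
    nonzero. For the rank, lifts of torus elements to the cover need not be known to commute; but
    the center has finite exponent m, and m-th powers of lifts do commute. *)

Lemma unitarymxPV n (U : 'M[C]_n) : U \is unitarymx -> U^t* *m U = 1%:M.
Proof. by move=> /unitarymxP /mulmx1C. Qed.

Lemma adjmxM m n p (A : 'M[C]_(m, n)) (B : 'M[C]_(n, p)) :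
  (A *m B)^t* = B^t* *m A^t*.
Proof. by rewrite trmx_mul map_mxM. Qed.

Lemma conjmxM m n p (A : 'M[C]_(m, n)) (B : 'M[C]_(n, p)) :
  (A *m B) ^bar = A ^bar *m B ^bar.
Proof. exact: map_mxM. Qed.

Lemma conjmxK m n (A : 'M[C]_(m, n)) : (A ^bar) ^bar = A.
Proof. by apply/matrixP=> i j; rewrite !mxE conjCK. Qed.

Lemma adjmx_conj m n (A : 'M[C]_(m, n)) : (A ^bar)^t* = (A^t*) ^bar.
Proof. by rewrite map_trmx. Qed.

(** Functional calculus: entry (i, j) of M vanishes unless a_i = b_j, so any function may be applied
    to both spectra. *)
Lemma diag_mx_intertwine n (M : 'M[C]_n) (a b : 'rV[C]_n) (f : C -> C) :
  diag_mx a *m M = M *m diag_mx b ->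
  diag_mx (map_mx f a) *m M = M *m diag_mx (map_mx f b).
Proof.
rewrite !mul_diag_mx !mul_mx_diag => /matrixP e; apply/matrixP => i j.
move: (e i j); rewrite !mxE => /eqP; rewrite mulrC -subr_eq0 -mulrBr mulf_eq0.
by rewrite subr_eq0 => /orP[/eqP->|/eqP->]; rewrite ?mul0r ?mulr0 1?mulrC.
Qed.

Lemma unitary_intertwine n (P Q M : 'M[C]_n) (a b : 'rV[C]_n) (f : C -> C) :
  P \is unitarymx -> Q \is unitarymx ->
  P^t* *m diag_mx a *m P *m M = M *m (Q^t* *m diag_mx b *m Q) ->
  P^t* *m diag_mx (map_mx f a) *m P *m M =
  M *m (Q^t* *m diag_mx (map_mx f b) *m Q).
Proof.
move=> Pu Qu h.
have : diag_mx a *m (P *m M *m Q^t*) = P *m M *m Q^t* *m diag_mx b.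
  have /(congr1 (fun X => P *m X *m Q^t*)) := h.
  by rewrite !mulmxA (unitarymxP Pu) mul1mx mulmxtVK.
move=> /(diag_mx_intertwine f) /(congr1 (fun X => P^t* *m X *m Q)).
by rewrite -!mulmxA (unitarymxPV Qu) mulmx1 !mulmxA (unitarymxPV Pu) mul1mx.
Qed.

Lemma unitary_normal n (X : 'M[C]_n) : X \is unitarymx -> X \is normalmx.
Proof. by move=> Xu; apply/normalmxP; rewrite (unitarymxP Xu) unitarymxPV. Qed.

Lemma diag_unitary n (d : 'rV[C]_n) :
  (forall i, `|d 0 i| = 1) -> diag_mx d \is unitarymx.
Proof.
move=> dP; apply/unitarymxP.
rewrite tr_diag_mx map_diag_mx mulmx_diag -diag_const_mx; congr diag_mx.
by apply/rowP => i; rewrite !mxE -normCK dP expr1n.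
Qed.

Lemma unitary_diag n (X : 'M[C]_n) : X \is unitarymx ->
  exists P : 'M[C]_n, exists d : 'rV[C]_n,
    [/\ P \is unitarymx, X = P^t* *m diag_mx d *m P & forall i, `|d 0 i| = 1].
Proof.
move=> Xu; have /orthomx_spectralP := unitary_normal Xu.
move: (spectralmx X) (spectral_diag X) (spectral_unitarymx X) => P d Pu.
rewrite invmx_unitary // => XE; exists P, d; split=> // i.
have : diag_mx d \is unitarymx.
  have -> : diag_mx d = P *m X *m P^t*.
    by rewrite XE !mulmxA (unitarymxP Pu) mul1mx mulmxtVK.
  by rewrite !mul_unitarymx // trmxC_unitary.
move=> /unitarymxP; rewrite tr_diag_mx map_diag_mx mulmx_diag => /matrixP/(_ i i).
rewrite !mxE eqxx mulr1n -normCK => /eqP.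
by rewrite sqrp_eq1 // => /eqP.
Qed.

Lemma norm_sqrtC (x : C) : `|x| = 1 -> `|sqrtC x| = 1.
Proof.
move=> x1; apply/eqP; rewrite -(@sqrp_eq1 _ `|sqrtC x|) //.
by rewrite -normrX sqrtCK x1.
Qed.

(* The last two clauses hold because Y is a function of X. *)
Lemma unitary_sqrt n (X : 'M[C]_n) : X \is unitarymx ->
  exists Y : 'M[C]_n, [/\ Y \is unitarymx, Y *m Y = X,
    forall M, X *m M = M *m X -> Y *m M = M *m Y
  & forall M, X ^bar *m M = M *m X^t* -> Y ^bar *m M = M *m Y^t*].
Proof.
move=> /unitary_diag[P [d [Pu -> d1]]].
have PPt := unitarymxP Pu; have PtP := unitarymxPV Pu.
pose e := map_mx sqrtC d.
have eu : diag_mx e \is unitarymx.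
  by apply: diag_unitary => i; rewrite mxE norm_sqrtC.
exists (P^t* *m diag_mx e *m P); split.
- by rewrite !mul_unitarymx // trmxC_unitary.
- rewrite !mulmxA mulmxtVK // -[P^t* *m _ *m _]mulmxA mulmx_diag.
  by congr (_ *m diag_mx _ *m _); apply/rowP => i; rewrite !mxE -expr2 sqrtCK.
- by move=> M; exact: unitary_intertwine.
- move=> M; rewrite !adjmxM !conjmxM !trmxCK !tr_diag_mx !map_diag_mx !mulmxA.
  rewrite -(adjmx_conj P) -!(mulmxA M).
  (* [X ^bar] and [X^t*] both have spectrum conj(d), and the function z -> conj(sqrt(conj z)) turns
     them into [Y ^bar] and [Y^t*]. *)
  have h := @unitary_intertwine _ (P ^bar) P M (d ^bar) (d ^bar)
    (conjC \o sqrtC \o conjC); move: h.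
  have -> : map_mx (conjC \o sqrtC \o conjC) (d ^bar) = e ^bar.
    by apply/rowP => i; rewrite !mxE /= conjCK.
  rewrite !mulmxA -!(mulmxA M) conjC_unitary => h k; exact: h.
Qed.

(* For F = 1 these are the real orthogonal matrices, for F = symplectic_form
   the compact symplectic group. *)
Definition form_unitary n (F U : 'M[C]_n) : Prop :=
  U \is unitarymx /\ F *m U = U ^bar *m F.

(** The antilinear map v -> F conj(v) squares to e: a real structure for e = 1, a quaternionic one
    for e = -1. The orthogonal and symplectic groups are thus treated together. *)
Definition real_structure n (F : 'M[C]_n) : Prop :=
  [/\ F \is unitarymx, F ^bar = F
    & exists2 e : C, e ^+ 2 = 1 & F *m F = e%:M].

Section Form.
Variables (n : nat) (F : 'M[C]_n).

Lemma form_unitary1 : form_unitary F 1%:M.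
Proof.
by split; [apply/unitarymxP; rewrite trmx1 map_mx1 mulmx1|rewrite map_mx1 mul1mx mulmx1].
Qed.

Lemma form_unitaryM U V :
  form_unitary F U -> form_unitary F V -> form_unitary F (U *m V).
Proof.
move=> [Uu FU] [Vu FV]; split; first exact: mul_unitarymx.
by rewrite conjmxM mulmxA FU -mulmxA FV mulmxA.
Qed.

Lemma form_unitaryV U : form_unitary F U -> form_unitary F (U^t*).
Proof.
move=> [Uu FU]; split; first by rewrite trmxC_unitary.
have /(congr1 (fun X => (U^t*) ^bar *m X *m U^t*)) := FU.
rewrite !mulmxA mulmxtVK // => ->.
rewrite -[_ *m U ^bar]conjmxM.
by rewrite unitarymxPV // map_mx1 mul1mx.
Qed.

(** The map sigma(U) = F^-1 conj(U) F is an involutive automorphism whose fixed points are the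
    elements preserving F. Both U and S = sigma(U) intertwine A with B, so X = [S^t* U] commutes
    with A, and sigma(X) = X^-1. A square root Y that is a function of X inherits both properties,
    and V = U Y^-1, the midpoint between U and S, is fixed by sigma. *)
Lemma form_unitary_conj A B U : real_structure F ->
  form_unitary F A -> form_unitary F B -> U \is unitarymx ->
  B = U *m A *m U^t* ->
  exists2 V, form_unitary F V & B = V *m A *m V^t*.
Proof.
move=> [Fu Fr [e e1 FF]] [Au FA] [Bu FB] Uu BE.
have Ft : F^t* = e *: F.
  have FeF : F *m (e *: F) = 1%:M by rewrite -scalemxAr FF scale_scalar_mx -expr2 e1.
  by rewrite -[F^t*]mulmx1 -FeF mulmxA unitarymxPV // mul1mx.
pose S := F^t* *m U ^bar *m F.
have Sc : S ^bar = F^t* *m U *m F.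
  by rewrite /S !conjmxM -(adjmx_conj F) Fr conjmxK.
have Uc : U ^bar \is unitarymx by rewrite conjC_unitary.
have Su : S \is unitarymx by rewrite /S !mul_unitarymx // trmxC_unitary.
have UA : U *m A = B *m U by rewrite BE mulmxKtV.
have FtB : F^t* *m B ^bar = B *m F^t*.
  have /(congr1 (fun X => F^t* *m X *m F^t*)) := FB.
  by rewrite !mulmxA unitarymxPV // mul1mx mulmxtVK.
have SA : S *m A = B *m S.
  by rewrite /S -!mulmxA FA !mulmxA -FtB -!mulmxA (mulmxA (U ^bar)) (mulmxA (B ^bar))
    -!conjmxM UA.
have SAt : B^t* *m S = S *m A^t*.
  have /(congr1 (fun X => B^t* *m X *m A^t*)) := SA.
  by rewrite !mulmxA mulmxtVK // unitarymxPV // mul1mx.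
have Xu : S^t* *m U \is unitarymx by rewrite mul_unitarymx // trmxC_unitary.
have [Y [Yu YY Ycom Ysg]] := unitary_sqrt Xu.
have YA : Y *m A = A *m Y.
  apply: Ycom; rewrite -mulmxA UA mulmxA.
  by have /(congr1 (fun X => X^t*)) := SAt; rewrite !adjmxM !trmxCK => ->; rewrite -mulmxA.
have YF : Y ^bar *m F = F *m Y^t*.
  have XtE : (S^t* *m U)^t* = U^t* *m S by rewrite adjmxM trmxCK.
  have XcE : (S^t* *m U) ^bar = F^t* *m U^t* *m F *m U ^bar.
    by rewrite conjmxM -(adjmx_conj S) Sc !adjmxM trmxCK !mulmxA.
  apply: Ysg; rewrite XtE XcE.
  by rewrite /S Ft -!mulmxA -!(scalemxAl, scalemxAr) !mulmxA.
exists (U *m Y^t*); last first.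
  rewrite adjmxM trmxCK !mulmxA -(mulmxA U) -(mulmxA U) -(mulmxA (Y^t*)) -YA.
  by rewrite (mulmxA (Y^t*)) unitarymxPV // mul1mx BE.
split; first by rewrite mul_unitarymx // trmxC_unitary.
have YF' : (Y^t*) ^bar *m F = F *m Y.
  have /(congr1 (fun X => (Y^t*) ^bar *m X *m Y)) := YF.
  rewrite !mulmxA -conjmxM unitarymxPV // map_mx1 mul1mx => ->.
  by rewrite -!mulmxA unitarymxPV // mulmx1.
rewrite conjmxM -mulmxA YF' mulmxA.
have -> : F *m U = U ^bar *m F *m Y *m Y.
  rewrite -(mulmxA _ Y) YY /S !adjmxM trmxCK !mulmxA (mulmxtVK _ Fu).
  by rewrite (unitarymxP Uc) mul1mx.
by rewrite mulmxtVK // mulmxA.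
Qed.

End Form.

End UnitaryConjugacy.

(** * Conjugacy from equal characteristic polynomials *)

Section CharPoly.
Variable C : numClosedFieldType.

Lemma char_poly_similar (F : fieldType) n (P A : 'M[F]_n) : P \in unitmx ->
  char_poly (invmx P *m A *m P) = char_poly A.
Proof.
move=> Pu; pose Q := map_mx polyC P.
have Qu : map_mx polyC (invmx P) *m Q = 1%:M by rewrite -map_mxM mulVmx // map_mx1.
have -> : char_poly (invmx P *m A *m P) =
    \det (map_mx polyC (invmx P) *m char_poly_mx A *m Q).
  rewrite /char_poly /char_poly_mx; congr (\det _).
  rewrite !map_mxM mulmxBr mulmxBl; congr (_ - _).
  by rewrite scalar_mxC -mulmxA Qu mulmx1.
rewrite !det_mulmx mulrAC -det_mulmx Qu det1 mul1r; exact: erefl.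
Qed.

Lemma char_poly_unitary_conj n (P A : 'M[C]_n) : P \is unitarymx ->
  char_poly (P *m A *m P^t*) = char_poly A.
Proof.
move=> Pu; rewrite -{1}[P]trmxCK -[in LHS](@invmx_unitary C n (P^t*)) ?trmxC_unitary //.
by rewrite char_poly_similar // unitarymx_unit // trmxC_unitary.
Qed.

Lemma char_poly_diag (R : comNzRingType) n (d : 'rV[R]_n) :
  char_poly (diag_mx d) = \prod_i ('X - (d 0 i)%:P).
Proof.
rewrite char_poly_trig ?diag_mx_is_trig //.
by apply: eq_bigr => i _; rewrite !mxE eqxx mulr1n.
Qed.

Lemma char_poly_tr (R : comNzRingType) n (A : 'M[R]_n) : char_poly A^T = char_poly A.
Proof.
rewrite /char_poly -[in RHS]det_tr /char_poly_mx; congr (\det _).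
by rewrite linearB /= tr_scalar_mx map_trmx.
Qed.

Lemma char_poly_block (R : comNzRingType) m n (A : 'M[R]_m) (B : 'M[R]_n) :
  char_poly (block_mx A 0 0 B) = char_poly A * char_poly B.
Proof. by rewrite /char_poly char_block_diag_mx det_ublock. Qed.

Lemma unitary_conj_char_poly n (A B : 'M[C]_n) :
  A \is unitarymx -> B \is unitarymx -> char_poly A = char_poly B ->
  exists2 U, U \is unitarymx & B = U *m A *m U^t*.
Proof.
move=> /unitary_diag[P [d [Pu -> _]]] /unitary_diag[Q [e [Qu -> _]]].
have Ptu : P^t* \is unitarymx by rewrite trmxC_unitary.
have Qtu : Q^t* \is unitarymx by rewrite trmxC_unitary.
rewrite -[X in _ *m _ *m X](trmxCK P) -[X in _ = char_poly (_ *m X)](trmxCK Q).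
rewrite !char_poly_unitary_conj // !char_poly_diag.
have seqE (f : 'rV[C]_n) : \prod_i ('X - (f 0 i)%:P) =
    \prod_(x <- [tuple f 0 i | i < n]) ('X - x%:P).
  by rewrite /= big_map big_enum.
rewrite !seqE => /esym/prod_XsubC_eq/tuple_permP[s sE].
have eE i : e 0 i = d 0 (s i).
  have /(congr1 (fun t => nth 0 t i)) := sE.
  by rewrite -!tnth_nth !tnth_mktuple.
pose S : 'M[C]_n := perm_mx s.
have Su : S \is unitarymx.
  by apply/unitarymxP; rewrite tr_perm_mx map_perm_mx -perm_mxM mulgV perm_mx1.
exists (Q^t* *m S *m P); first by rewrite !mul_unitarymx.
rewrite !adjmxM !trmxCK !mulmxA !(mulmxtVK _ Pu) tr_perm_mx map_perm_mx.
congr (_ *m _); rewrite -!mulmxA; congr (_ *m _).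
apply/matrixP => i j; rewrite mulmxA -col_permE -row_permE !mxE eE.
by rewrite (inj_eq perm_inj).
Qed.

Lemma form_unitary_conj_char_poly n (F A B : 'M[C]_n) : real_structure F ->
  form_unitary F A -> form_unitary F B -> char_poly A = char_poly B ->
  exists2 V, form_unitary F V & B = V *m A *m V^t*.
Proof.
move=> FP AP BP /unitary_conj_char_poly[||U Uu BE]; [by case: AP|by case: BP|].
exact: (form_unitary_conj FP AP BP Uu BE).
Qed.

End CharPoly.

(** * Coxeter elements *)

Section Monomial.
Variable R : comNzRingType.

Definition mono n (f : 'I_n -> 'I_n) (a : 'I_n -> R) : 'M[R]_n :=
  \matrix_(i, j) (a i *+ (j == f i)).

Lemma mono_mul n f g (a b : 'I_n -> R) :
  mono f a *m mono g b = mono (fun i => g (f i)) (fun i => a i * b (f i)).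
Proof.
apply/matrixP => i j; rewrite !mxE (bigD1 (f i)) //= !mxE eqxx mulr1n mulrnAr.
by rewrite big1 ?addr0 // => k /negPf kf; rewrite !mxE kf mulr0n mul0r.
Qed.

Lemma eq_mono n f g (a b : 'I_n -> R) :
  (forall i, f i = g i) -> (forall i, a i = b i) -> mono f a = mono g b.
Proof. by move=> fg ab; apply/matrixP => i j; rewrite !mxE fg ab. Qed.

Lemma mono_diag n (d : 'rV[R]_n) : diag_mx d = mono id (fun i => d 0 i).
Proof. by apply/matrixP => i j; rewrite !mxE eq_sym. Qed.

Lemma map_mono (S : comNzRingType) (h : {rmorphism R -> S}) n f (a : 'I_n -> R) :
  map_mx h (mono f a) = \matrix_(i, j) (h (a i) *+ (j == f i)).
Proof. by apply/matrixP => i j; rewrite !mxE rmorphMn. Qed.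

End Monomial.

Section Coxeter.
Variable C : numClosedFieldType.

Lemma conj_mono n f (a : 'I_n -> C) : (mono f a) ^bar = mono f (fun i => conjC (a i)).
Proof. by rewrite map_mono. Qed.

Lemma mono_unitary n f (a : 'I_n -> C) : injective f ->
  (forall i, `|a i| = 1) -> mono f a \is unitarymx.
Proof.
move=> fI a1; apply/unitarymxP/matrixP => i j; rewrite !mxE (bigD1 (f i)) //=.
rewrite !mxE eqxx mulr1n big1 ?addr0 => [|k /negPf kf]; last first.
  by rewrite !mxE kf mulr0n mul0r.
rewrite rmorphMn /= (inj_eq fI) mulrnAr; have [->|] := eqVneq i j; last by rewrite mulr0n.
by rewrite -normCK a1 expr1n.
Qed.

Definition sgnl (n : nat) (e : C) (i : nat) : C := if i.+1 == n then e else 1.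

(* For e = 1 and e = -1 these are, up to a scalar block, the Coxeter elements of
   the orthogonal, respectively symplectic, groups. *)
Definition cyc (n : nat) (e : C) : 'M[C]_n := mono (@ordS n) (fun i => sgnl n e i).

Lemma ordS_inj n : injective (@ordS n).
Proof. exact: (can_inj (@ordSK n)). Qed.

Lemma cyc_unitary n e : `|e| = 1 -> cyc n e \is unitarymx.
Proof.
move=> e1; apply: mono_unitary; first exact: ordS_inj.
by move=> i; rewrite /sgnl; case: ifP; rewrite ?normr1.
Qed.

Lemma cyc_real n e : conjC e = e -> (cyc n e) ^bar = cyc n e.
Proof.
move=> ee; rewrite conj_mono; apply: eq_mono => // i; rewrite /sgnl.
by case: ifP; rewrite ?conjC1.
Qed.

Lemma char_poly_cyc n e : (0 < n)%N -> char_poly (cyc n e) = 'X^n - e%:P.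
Proof.
move=> n0; have sz : size ('X^n - e%:P) = n.+1 by rewrite size_XnsubC.
have mon : 'X^n - e%:P \is monic by rewrite monicXnsubC.
rewrite -[RHS](companionmxK mon) /companionmx; move: (mon) => _.
(* The dimension of the companion matrix equals n only propositionally, so both matrices are
   compared through entries indexed by natural numbers. *)
pose g (i j : nat) : C := if i == n.-1 then - ('X^n - e%:P)`_j else (i.+1 == j)%:R.
suff H m (A : 'M[C]_n) (B : 'M[C]_m) : n = m ->
    (forall i j, A i j = g i j) -> (forall i j, B i j = g i j) ->
    char_poly A = char_poly B.
  apply: H; first by rewrite sz.
    move=> i j; rewrite !mxE /g /= coefB coefXn coefC /sgnl.
    have -> : (j == ordS i) = (j == i.+1 %% n :> nat)%N by rewrite -val_eqE.
    have jn := ltn_ord j; have iltn := ltn_ord i.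
    have -> : (j == n :> nat) = false by lia.
    have -> : (i == n.-1 :> nat) = (i.+1 == n) by lia.
    case: (eqVneq i.+1 n) => [->|ne]; last first.
      by rewrite modn_small 1?[_ == j :> nat]eq_sym //; lia.
    by rewrite modnn sub0r opprK; case: eqP; rewrite ?mulr1n ?mulr0n.
  move=> i j; rewrite mxE /g.
  by have -> : (size ('X^n - e%:P)).-2 = n.-1 by rewrite sz.
move=> e'; case: m / e' B => B AE BE; congr (char_poly _).
by apply/matrixP => i j; rewrite AE BE.
Qed.

(** Conjugation by the monomial matrix shifts the diagonal entries of s, so the commutator has
    entries s_(i+1) / s_i, the indices being cyclic. *)
Lemma torus_commutator n e (t s : 'rV[C]_n) :
  `|e| = 1 -> (forall i, `|s 0 i| = 1) ->
  (forall i, s 0 (ordS i) = t 0 i * s 0 i) ->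
  diag_mx t = cyc n e *m diag_mx s *m (cyc n e)^t* *m (diag_mx s)^t*.
Proof.
move=> e1 s1 ts; have su := diag_unitary s1; have cu := cyc_unitary n e1.
suff -> : cyc n e *m diag_mx s = diag_mx t *m diag_mx s *m cyc n e by rewrite !mulmxtVK.
rewrite !mono_diag !mono_mul; apply: eq_mono => // i.
by rewrite ts mulrC.
Qed.

Definition conj_ext (n : nat) (a : nat -> C) (i : nat) : C :=
  if (i < n)%N then a i else conjC (a (i - n)%N).

(** Diagonal of the general element of the standard maximal torus of the group preserving
    [half_shift]. *)
Definition half_row n (a : nat -> C) : 'rV[C]_(n + n) := \row_i conj_ext n a i.

Definition half_shift n (e : C) : 'M[C]_(n + n) :=
  block_mx 0 1%:M (e%:M) 0.

Definition hshift n (i : 'I_(n + n)) : 'I_(n + n) :=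
  match fintype.split i with inl j => rshift n j | inr j => lshift n j end.

Lemma hshift_val n i : @hshift n i = (if (i < n)%N then i + n else i - n)%N :> nat.
Proof.
rewrite /hshift; case: splitP => j ij; first by rewrite /= addnC ij.
by rewrite /= ij addKn.
Qed.

Lemma half_shiftE n e : half_shift n e =
  mono (@hshift n) (fun i => if (i < n)%N then 1 else e).
Proof.
apply/matrixP => i j; rewrite /half_shift.
rewrite -[i in LHS]splitK -[j in LHS]splitK /unsplit [RHS]mxE -val_eqE /= hshift_val.
case: splitP => i' ->; case: splitP => j' ->; rewrite /= ?block_mxEul ?block_mxEur
  ?block_mxEdl ?block_mxEdr !mxE ?ltn_ord.
- by have -> : (j' == i' + n :> nat)%N = false by have := ltn_ord j'; lia.
- by rewrite [in RHS]addnC eqn_add2r eq_sym.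
- by rewrite addKn eq_sym.
- rewrite addKn.
  by have -> : (n + j' == i' :> nat)%N = false by have := ltn_ord i'; lia.
Qed.

Lemma half_shift_real n e : conjC e = e -> (half_shift n e) ^bar = half_shift n e.
Proof.
move=> ee; rewrite !half_shiftE conj_mono; apply: eq_mono => // i.
by case: ifP; rewrite ?conjC1.
Qed.

Lemma real_structure_half n e : conjC e = e -> e ^+ 2 = 1 ->
  real_structure (half_shift n e).
Proof.
move=> ee e2; have e1 : `|e| = 1.
  by apply/eqP; rewrite -(@sqrp_eq1 _ `|e|) // normCK ee -expr2 e2.
split; [|exact: half_shift_real|exists e => //].
  rewrite half_shiftE; apply: mono_unitary => [i j /(congr1 val)|i]; last first.
    by case: ifP; rewrite ?normr1.
  rewrite /= !hshift_val => h; apply: val_inj => /=.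
  have := ltn_ord i; have := ltn_ord j; move: h.
  by case: (ltnP i n) => ?; case: (ltnP j n) => ?; lia.
rewrite mulmx_block !mulmx0 !mul0mx !mul1mx !mulmx1 !addr0 !add0r.
by rewrite -scalar_mx_block.
Qed.

(** [half_shift n e] is the n-th power of [cyc (n + n) e], which is why the two commute; the proof
    checks this on indices and signs. *)
Lemma cyc_half n e : conjC e = e -> e ^+ 2 = 1 ->
  form_unitary (half_shift n e) (cyc (n + n) e).
Proof.
move=> ee e2; have e1 : `|e| = 1.
  by apply/eqP; rewrite -(@sqrp_eq1 _ `|e|) // normCK ee -expr2 e2.
split; first exact: cyc_unitary.
rewrite cyc_real // half_shiftE !mono_mul; apply: eq_mono => i; have iltn := ltn_ord i.
  apply: val_inj; rewrite /= !hshift_val /=.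
  case: (eqVneq i.+1 (n + n)%N) => [ii|ni].
    have -> : (i < n)%N = false by lia.
    rewrite ii modnn.
    have -> : (0 < n)%N by lia.
    by rewrite modn_small; lia.
  rewrite (@modn_small i.+1); last by lia.
  case: ltnP => h; last first.
    have -> : (i.+1 < n)%N = false by lia.
    by rewrite modn_small; lia.
  case: ltnP => h'; first by rewrite modn_small; lia.
  have -> : (i + n).+1 = (n + n)%N by lia.
  by rewrite modnn; lia.
rewrite /sgnl /= hshift_val /ordS /=.
case: (eqVneq i.+1 (n + n)%N) => [ii|ni].
  have -> : (i < n)%N = false by lia.
  rewrite ii modnn.
  have -> : (0 < n)%N by lia.
  have -> : ((i - n).+1 == n + n)%N = false by lia.
  by rewrite !mulr1.
rewrite modn_small ?mul1r; last by lia.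
case: ifP => h; rewrite ?mul1r.
  case: (eqVneq (i + n).+1 (n + n)%N) => [iE|ne].
    by have -> : (i.+1 < n)%N = false by lia.
  by have -> : (i.+1 < n)%N by lia.
have -> : ((i - n).+1 == n + n)%N = false by lia.
have -> : (i.+1 < n)%N = false by lia.
by rewrite mulr1.
Qed.

Lemma norm_conj_ext n a i : (forall i, `|a i| = 1) -> `|conj_ext n a i| = 1.
Proof. by rewrite /conj_ext => a1; case: ifP; rewrite ?norm_conjC. Qed.

Lemma diag_half n e a : (forall i, `|a i| = 1) ->
  form_unitary (half_shift n e) (diag_mx (half_row n a)).
Proof.
move=> a1; split; first by apply: diag_unitary => i; rewrite mxE norm_conj_ext.
rewrite map_diag_mx half_shiftE !mono_diag !mono_mul; apply: eq_mono => // i.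
rewrite !mxE mulrC; congr (_ * _); rewrite hshift_val /conj_ext.
have iltn := ltn_ord i.
case: (ltnP i n) => h; last by rewrite /= conjCK ifT //; lia.
by rewrite /= ifF ?addnK //; lia.
Qed.

Lemma half_torus_commutator n e a : conjC e = e -> e ^+ 2 = 1 ->
  (forall i, `|a i| = 1) ->
  exists2 s, form_unitary (half_shift n e) s &
  diag_mx (half_row n a) = cyc (n + n) e *m s *m (cyc (n + n) e)^t* *m s^t*.
Proof.
move=> ee e2 a1; have e1 : `|e| = 1.
  by apply/eqP; rewrite -(@sqrp_eq1 _ `|e|) // normCK ee -expr2 e2.
pose p i := \prod_(j < i) a j.
have p1 i : `|p i| = 1 by rewrite normr_prod big1.
(* The entries from n on are the conjugates of the first n, so the recurrence s_(i+1) = a_i s_i must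
   reach s_n = conj(s_0), that is m p_n = conj(m). This is solved by conj(m)^2 = p_n. *)
pose m := conjC (sqrtC (p n)).
have m1 : `|m| = 1 by rewrite norm_conjC norm_sqrtC.
have mm : conjC m ^+ 2 = p n by rewrite conjCK sqrtCK.
pose s i := m * p i.
have s1 i : `|s i| = 1 by rewrite normrM m1 p1 mulr1.
exists (diag_mx (half_row n s)); first exact: diag_half.
have ss i : s i.+1 = a i * s i by rewrite /s /p big_ord_recr /= mulrA mulrC.
have mV : conjC m * m = 1 by rewrite mulrC -normCK m1 expr1n.
have pV i : conjC (p i) * p i = 1 by rewrite mulrC -normCK p1 expr1n.
have sn : s n = conjC m.
  have -> : s n = conjC m * (conjC m * m) by rewrite /s -mm expr2 mulrC mulrA.
  by rewrite mV mulr1.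
have s0 : s 0%N = m by rewrite /s /p big_ord0 mulr1.
apply: torus_commutator => // i; first by rewrite mxE norm_conj_ext.
rewrite !mxE /ordS /= /conj_ext; have iltn := ltn_ord i.
case: (eqVneq i.+1 (n + n)%N) => [ii|ni].
  have -> : (i < n)%N = false by lia.
    rewrite ii modnn.
  have -> : (0 < n)%N by lia.
  rewrite -rmorphM -ss; have -> : (i - n).+1 = n by lia.
  by rewrite sn conjCK s0.
rewrite modn_small; last by lia.
case: ltnP => h1; first by rewrite (ltn_trans _ h1) // ss.
case: ltnP => h2.
  have -> : i.+1 = n by lia.
  by rewrite subnn s0 -ss; have -> : i.+1 = n by lia; rewrite sn.
by rewrite -rmorphM -ss; congr (conjC (s _)); lia.
Qed.

(** The partial products of t solve the cyclic recurrence, which closes up because the full product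
    is 1. *)
Lemma torus_commutator_det1 n e (t : 'rV[C]_n) : `|e| = 1 ->
  (forall i, `|t 0 i| = 1) -> \prod_i t 0 i = 1 ->
  exists2 s, s \is unitarymx &
  diag_mx t = cyc n e *m s *m (cyc n e)^t* *m s^t*.
Proof.
case: n t => [|n] t e1 t1 tp.
  exists 1%:M; first by apply/unitarymxP/matrixP => -[].
  by apply/matrixP => -[].
pose a i := t 0 (inord i); pose p i := \prod_(j < i) a j.
have p1 i : `|p i| = 1 by rewrite normr_prod big1 // => j _; exact: t1.
exists (diag_mx (\row_i p i)); first by apply: diag_unitary => i; rewrite mxE.
apply: torus_commutator => // i; first by rewrite mxE.
rewrite !mxE /ordS /=; have iltn := ltn_ord i.
have pS : p i.+1 = t 0 i * p i by rewrite /p big_ord_recr /= /a inord_val mulrC.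
rewrite -pS; case: (eqVneq i.+1 n.+1) => [ii|ni]; last by rewrite modn_small //; lia.
rewrite ii modnn /p big_ord0 -[LHS]tp; apply: eq_bigr => j _.
by rewrite /a inord_val.
Qed.

End Coxeter.

(** * Spectra of unitary matrices preserving a real structure *)

Section Spectra.
Variable C : numClosedFieldType.
Implicit Types (L l : seq C).

Lemma norm1_conjV (x : C) : `|x| = 1 -> x * conjC x = 1.
Proof. by move=> x1; rewrite -normCK x1 expr1n. Qed.

(** Non-real numbers are paired with their conjugates, and equal real ones with each other; [b1] and
    [b2] tell whether a single 1 or -1 is left over. *)
Lemma conj_symmetric_seq L :
  {in L, forall x, `|x| = 1} -> perm_eq L (map conjC L) ->
  exists l (b1 b2 : bool),
    perm_eq L (l ++ map conjC l ++ nseq b1 1 ++ nseq b2 (-1)).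
Proof.
have [m] := ubnP (size L); elim: m L => // m IH [|x L] /= szL L1 Ls.
  by exists [::], false, false.
have L1' : {in L, forall x, `|x| = 1} by move=> y yL; apply: L1; rewrite inE yL orbT.
have x1 : `|x| = 1 by apply: L1; rewrite mem_head.
have [xL|xL] := boolP (conjC x \in L).
  have PL := perm_to_rem xL; set L' := rem _ L in PL.
  have szL' : (size L' < m)%N by have := perm_size PL; rewrite /= in szL *; lia.
  have [||l [b1 [b2 Pl]]] := IH L' szL'.
    by move=> y yL; apply: L1'; apply: mem_rem yL.
    move: Ls; have -> : perm_eq (x :: L) (conjC x :: map conjC L) =
        perm_eq [:: x, conjC x & L'] [:: conjC x, x & map conjC L'].
      rewrite (permPl (_ : perm_eq (x :: L) (x :: conjC x :: L'))) ?perm_cons //.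
      apply: permPr; rewrite perm_cons -[X in X :: _](conjCK x).
      by rewrite -(map_cons conjC) perm_map.
    have pc : perm_eq [:: conjC x, x & map conjC L'] [:: x, conjC x & map conjC L'].
      by rewrite -cat1s -(cat1s x) perm_catCA.
    by rewrite (permPr pc) !perm_cons.
  exists (x :: l), b1, b2 => /=; rewrite perm_cons (permPl PL) perm_sym.
  by rewrite -cat1s perm_catCA /= perm_cons perm_sym.
have xx : conjC x = x.
  have : conjC x \in x :: L by rewrite (perm_mem Ls) mem_head.
  by rewrite inE (negPf xL) orbF => /eqP.
have Ls' : perm_eq L (map conjC L) by move: Ls; rewrite xx perm_cons.
have [l [b1 [b2 Pl]]] := IH L szL L1' Ls'; rewrite xx in xL.
have : (x == 1) || (x == -1).
  by rewrite -sqrf_eq1 expr2 -{2}xx norm1_conjV.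
have := perm_mem Pl x; rewrite (negPf xL) !mem_cat => /esym/negbT.
rewrite !negb_or => /and4P[_ _ xb1 xb2] /orP[/eqP xE|/eqP xE].
  exists l, true, b2; rewrite xE.
  case: b1 xb1 Pl => [|_ /= Pl]; first by rewrite /= xE mem_head.
  rewrite catA -(cat1s 1 (nseq b2 (-1))) perm_sym perm_catCA /= perm_cons.
  by rewrite perm_sym (permPl Pl) catA.
exists l, b1, true; rewrite xE.
case: b2 xb2 Pl => [|_ /= Pl]; first by rewrite /= xE mem_head.
rewrite !catA cats0 in Pl; rewrite !catA perm_sym perm_catC /= perm_cons perm_sym.
by rewrite (permPl Pl).
Qed.

Lemma count_reflect_even (L l : seq C) (b1 b2 : bool) :
  perm_eq L (l ++ map conjC l ++ nseq b1 1 ++ nseq b2 (-1)) ->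
  odd (count_mem (-1) L) = b2.
Proof.
move=> /seq.permP/(_ (pred1 (-1))) ->; rewrite !count_cat count_map !count_nseq /=.
have -> : count (preim conjC (pred1 (-1))) l = count_mem (-1) l.
  apply: eq_count => y /=.
  by rewrite -[X in _ == X](rmorphN1 conjC) (inj_eq (can_inj conjCK)).
have -> : (1 == -1 :> C) = false.
  by rewrite -subr_eq0 opprK -[1 + 1]/(2%:R) pnatr_eq0.
by rewrite eqxx mul0n mul1n add0n addnA oddD addnn odd_double; case: b2.
Qed.

Lemma prod_reflect (L l : seq C) (b1 b2 : bool) : {in L, forall x, `|x| = 1} ->
  perm_eq L (l ++ map conjC l ++ nseq b1 1 ++ nseq b2 (-1)) ->
  \prod_(x <- L) x = (-1) ^+ b2.
Proof.
move=> L1 PL; rewrite (perm_big _ PL) /= !big_cat big_map /=.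
rewrite mulrA -big_split /= big_seq big1 => [|x xl]; last first.
  by apply/norm1_conjV/L1; rewrite (perm_mem PL) mem_cat xl.
rewrite mul1r; case: b1 b2 {PL} => -[]; rewrite /= ?big_cons ?big_nil ?mulr1 ?mul1r //.
Qed.

Section FormSpectrum.
Variables (N : nat) (F x : 'M[C]_N).
Hypotheses (FP : real_structure F) (xF : form_unitary F x).

(** F conjugates x into [x ^bar], so the spectrum is stable under complex conjugation. *)
Lemma form_unitary_spectrum : exists (d : 'rV[C]_N) (P : 'M[C]_N),
  let L := [seq d 0 i | i <- enum 'I_N] in
  [/\ P \is unitarymx, x = P^t* *m diag_mx d *m P, {in L, forall y, `|y| = 1},
   perm_eq L (map conjC L) & char_poly x = \prod_(y <- L) ('X - y%:P)].
Proof.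
have [P [d [Pu xE d1]]] := unitary_diag (proj1 xF).
exists d, P => L.
have cp : char_poly x = \prod_(y <- L) ('X - y%:P).
  rewrite xE -[X in _ *m X]trmxCK char_poly_unitary_conj ?trmxC_unitary //.
  by rewrite char_poly_diag big_map big_enum.
split=> //; first by move=> y /mapP[i _ ->].
apply: prod_XsubC_eq; rewrite -cp.
have [Fu Fr _] := FP; have [_ Fx] := xF.
have -> : char_poly x = char_poly (x ^bar).
  have -> : x ^bar = F *m x *m F^t* by rewrite Fx mulmxtVK.
  by rewrite char_poly_unitary_conj.
rewrite -map_char_poly cp rmorph_prod [RHS]big_map; apply: eq_bigr => y _ /=.
by rewrite map_polyXsubC.
Qed.

(* A skew F induces a symplectic form on the eigenspace of -1. *)
Lemma form_unitary_even_eigenvalue (d : 'rV[C]_N) (P : 'M[C]_N) : F^T = - F ->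
  P \is unitarymx -> x = P^t* *m diag_mx d *m P ->
  ~~ odd (count_mem (-1) [seq d 0 i | i <- enum 'I_N]).
Proof.
move=> Fa Pu xE; have [Fu Fr _] := FP; have [_ Fx] := xF.
pose Q := P ^bar *m F *m P^t*.
have Qu : Q \is unitarymx.
  by rewrite !mul_unitarymx ?trmxC_unitary ?conjC_unitary.
have Qa : Q^T = - Q.
  rewrite /Q !trmx_mul Fa mulmxA mulmxN mulNmx; congr (- (_ *m _ *m _)).
    by apply/matrixP => i j; rewrite !mxE.
  by rewrite map_trmx.
have QD : Q *m diag_mx d = diag_mx (d ^bar) *m Q.
  have Pcu : P ^bar \is unitarymx by rewrite conjC_unitary.
  have xcE : x ^bar = (P ^bar)^t* *m diag_mx (d ^bar) *m P ^bar.
    by rewrite xE !conjmxM map_diag_mx adjmx_conj.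
  have : F *m (P^t* *m diag_mx d *m P) = x ^bar *m F by rewrite -xE.
  rewrite xcE => /(congr1 (fun X => P ^bar *m X *m P^t*)).
  by rewrite !mulmxA mulmxtVK // (unitarymxP Pcu) mul1mx.
have Q0 i j : d 0 i = -1 -> d 0 j != -1 -> Q i j = 0.
  move=> di dj; have /matrixP/(_ i j) := QD.
  rewrite mul_mx_diag mul_diag_mx !mxE di rmorphN1 mulN1r => /eqP.
  rewrite -addr_eq0 -[X in _ + X]mulr1 -mulrDr mulf_eq0 => /orP[/eqP //|].
  by rewrite addr_eq0 (negPf dj).
pose S := [set i | d 0 i == -1].
have -> : count_mem (-1) [seq d 0 i | i <- enum 'I_N] = #|S|.
  have -> : #|S| = count (mem S) (enum (fintype.ordinal N)) by rewrite cardE -size_filter enumT.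
  rewrite count_map.
  by apply: eq_count => i; apply/esym; exact: (finset.in_set (fun i => d 0 i == -1) i).
(* Q is F in an eigenbasis of x and, by [Q0], does not pair the eigenvalue -1 with the others. Its
   restriction M is therefore unitary, and skew, so det M = (-1)^|S| det M with det M nonzero. *)
pose M : 'M[C]_#|S| := mxsub enum_val enum_val Q.
have Sd (k : 'I_#|S|) : d 0 (enum_val k) = -1.
  by have := enum_valP k; rewrite inE => /eqP.
have Mu : M \is unitarymx.
  apply/unitarymxP/matrixP => i j; have /matrixP/(_ (enum_val i) (enum_val j)) := unitarymxP Qu.
  rewrite !mxE (inj_eq enum_val_inj) => <-.
  rewrite [RHS](bigID (mem S)) /= [X in _ + X]big1 ?addr0; last first.
    by move=> m; rewrite inE => dm; rewrite (Q0 _ _ (Sd i) dm) mul0r.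
  by rewrite [RHS]big_enum_val; apply: eq_bigr => k _; rewrite !mxE.
have Ma : M^T = - M.
  by apply/matrixP => i j; have /matrixP/(_ (enum_val i) (enum_val j)) := Qa; rewrite !mxE.
have := unitarymx_unit Mu; rewrite unitmxE unitfE => Mdet.
have := det_tr M; rewrite Ma -scaleN1r detZ => /eqP.
rewrite -subr_eq0 -[X in _ - X]mul1r -mulrBl mulf_eq0 (negPf Mdet) orbF.
rewrite -signr_odd; case: odd => //; rewrite expr1 -opprD oppr_eq0.
by rewrite -[1 + 1]/(2%:R) pnatr_eq0.
Qed.

End FormSpectrum.
End Spectra.

(** * Symmetric powers of SU(2) *)

Section HomogeneousSubstitution.
Variable R : comNzRingType.
Implicit Types p l m : {poly R}.

(** This is l0^k p(l1 / l0): p is read as a binary form of degree k, and l1, l0 are substituted for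
    its two variables. *)
Definition hsub l1 l0 k p : {poly R} :=
  \sum_(i < k.+1) p`_i *: (l1 ^+ i * l0 ^+ (k - i)).

Lemma hsubD l1 l0 k p q : hsub l1 l0 k (p + q) = hsub l1 l0 k p + hsub l1 l0 k q.
Proof. by rewrite -big_split; apply: eq_bigr => i _; rewrite coefD scalerDl. Qed.

Lemma hsubZ l1 l0 k a p : hsub l1 l0 k (a *: p) = a *: hsub l1 l0 k p.
Proof. by rewrite scaler_sumr; apply: eq_bigr => i _; rewrite coefZ scalerA. Qed.

Lemma hsub_mulX l1 l0 k p : hsub l1 l0 k.+1 (p * 'X) = hsub l1 l0 k p * l1.
Proof.
rewrite /hsub big_ord_recl coefMX eqxx scale0r add0r big_distrl /=.
apply: eq_bigr => i _; rewrite coefMX /= -scalerAl subSS exprS.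
by rewrite -mulrA mulrC.
Qed.

Lemma hsub_mul1 l1 l0 k p : (size p <= k.+1)%N ->
  hsub l1 l0 k.+1 p = hsub l1 l0 k p * l0.
Proof.
move=> sp; rewrite /hsub big_ord_recr /= nth_default // scale0r addr0 big_distrl /=.
apply: eq_bigr => i _; rewrite -scalerAl -mulrA subSn -?exprSr //.
by have := ltn_ord i.
Qed.

Lemma hsub_linear l1 l0 k p u v : (size p <= k.+1)%N ->
  hsub l1 l0 k.+1 (p * (u *: 'X + v%:P)) = hsub l1 l0 k p * (u *: l1 + v *: l0).
Proof.
move=> sp; rewrite mulrDr -scalerAr [p * v%:P]mulrC mul_polyC hsubD !hsubZ.
by rewrite hsub_mulX hsub_mul1 // mulrDr !scalerAr.
Qed.

Lemma size_linear (u v : R) : (size (u *: 'X + v%:P)%R <= 2)%N.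
Proof.
rewrite (leq_trans (size_polyD _ _)) // geq_max (leq_trans (size_scale_leq _ _)) ?size_polyX //.
by rewrite (leq_trans (size_polyC_leq1 _)).
Qed.

Lemma size_linear_exp (u v : R) i : (size ((u *: 'X + v%:P) ^+ i)%R <= i.+1)%N.
Proof.
elim: i => [|i IH]; first by rewrite expr0 size_poly1.
rewrite exprSr (leq_trans (size_polyMleq _ _)) //.
by have := size_linear u v; lia.
Qed.

Lemma hsub_prod l1 l0 (u v u' v' : R) i j :
  hsub l1 l0 (i + j) ((u *: 'X + v%:P) ^+ i * (u' *: 'X + v'%:P) ^+ j) =
  (u *: l1 + v *: l0) ^+ i * (u' *: l1 + v' *: l0) ^+ j.
Proof.
elim: j => [|j IH].
  rewrite addn0 !expr0 !mulr1; elim: i => [|i IH].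
    by rewrite /hsub big_ord_recl big_ord0 !expr0 coef1 scale1r mulr1 addr0.
  by rewrite exprSr hsub_linear ?IH -?exprSr // size_linear_exp.
rewrite addnS exprSr mulrA hsub_linear; first by rewrite IH -mulrA -exprSr.
rewrite (leq_trans (size_polyMleq _ _)) //.
by have := size_linear_exp u v i; have := size_linear_exp u' v' j; lia.
Qed.

Lemma hsub_sym_row l1 l0 (u v u' v' : R) k i : (i <= k)%N ->
  hsub l1 l0 k ((u *: 'X + v%:P) ^+ i * (u' *: 'X + v'%:P) ^+ (k - i)) =
  (u *: l1 + v *: l0) ^+ i * (u' *: l1 + v' *: l0) ^+ (k - i).
Proof. by move=> ik; rewrite -{1}(subnKC ik) hsub_prod. Qed.

Lemma coef_exp_linear (a b : R) k i : (i <= k)%N ->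
  ((a%:P * 'X + b%:P) ^+ k)`_i = a ^+ i * b ^+ (k - i) *+ 'C(k, i).
Proof.
move=> ik; rewrite exprDn coef_sum.
have ki : (k - i < k.+1)%N by lia.
rewrite (bigD1 (Ordinal ki)) //= big1 ?addr0.
  rewrite coefMn exprMn -!polyC_exp mulrAC -polyCM coefCM coefXn.
  have -> : (k - (k - i) = i)%N by lia.
  by rewrite eqxx mulr1 bin_sub.
move=> j /negP jn; rewrite coefMn exprMn -!polyC_exp mulrAC -polyCM coefCM coefXn.
case: eqP => [e|]; last by rewrite mulr0 mul0rn.
by case: jn; apply/eqP/val_inj => /=; have := ltn_ord j; lia.
Qed.

End HomogeneousSubstitution.

Lemma big_ord2E (V : nmodType) (f : 'I_2 -> V) : \sum_i f i = f 0 + f 1.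
Proof. by rewrite !big_ord_recl big_ord0 addr0; congr (_ + f _); apply: val_inj. Qed.

Section SymmetricPower.
Variable R : comNzRingType.

(** Image of the monomial x^i y^(k-i) under the substitution given by the rows of g, dehomogenized
    at y = 1. Images are stored as rows of [sym], which makes [sym] multiplicative in the order of
    [symM]. *)
Definition sym_row k (g : 'M[R]_2) (i : nat) : {poly R} :=
  (g 0 0 *: 'X + (g 0 1)%:P) ^+ i * (g 1 0 *: 'X + (g 1 1)%:P) ^+ (k - i).

Definition sym k (g : 'M[R]_2) : 'M[R]_k.+1 := \matrix_(i, j) (sym_row k g i)`_j.

Lemma symM k (g h : 'M[R]_2) : sym k (g *m h) = sym k g *m sym k h.
Proof.
apply/matrixP => i j; rewrite !mxE.
have ik : (i <= k)%N by have := ltn_ord i.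
have -> : \sum_l sym k g i l * sym k h l j =
    (hsub (h 0 0 *: 'X + (h 0 1)%:P) (h 1 0 *: 'X + (h 1 1)%:P) k (sym_row k g i))`_j.
  rewrite coef_sum; apply: eq_bigr => l _.
  by rewrite !mxE coefZ.
rewrite hsub_sym_row // /sym_row; congr (_ `_ j).
have E (x y : R) : (x * h 0 0 + y * h 1 0) *: 'X + (x * h 0 1 + y * h 1 1)%:P =
    x *: (h 0 0 *: 'X + (h 0 1)%:P) + y *: (h 1 0 *: 'X + (h 1 1)%:P).
  by rewrite -!mul_polyC !polyCD !polyCM; ring.
by rewrite !mxE !big_ord2E !E.
Qed.

Lemma sym1 k : sym k 1%:M = 1%:M.
Proof.
apply/matrixP => i j; rewrite !mxE /sym_row !mxE /= scale1r scale0r addr0 add0r.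
by rewrite expr1n mulr1 coefXn eq_sym.
Qed.

Lemma sym_diag k (d : 'rV[R]_2) :
  sym k (diag_mx d) = diag_mx (\row_i (d 0 0 ^+ i * d 0 1 ^+ (k - i))).
Proof.
apply/matrixP => i j; rewrite !mxE /sym_row !mxE /= !mulr1n !mulr0n scale0r addr0 add0r.
rewrite exprZn -polyC_exp -scalerAl coefZ coefMC coefXn eq_sym.
by rewrite -[i == j]val_eqE /=; case: eqP => _; rewrite ?mul1r ?mul0r ?mulr0.
Qed.

Lemma map_sym (S : comNzRingType) (f : {rmorphism R -> S}) k (g : 'M[R]_2) :
  map_mx f (sym k g) = \matrix_(i, j)
    ((f (g 0 0) *: 'X + (f (g 0 1))%:P) ^+ i * (f (g 1 0) *: 'X + (f (g 1 1))%:P) ^+ (k - i))`_j.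
Proof.
apply/matrixP => i j; rewrite !mxE -coef_map /sym_row rmorphM !rmorphXn !rmorphD /=.
by rewrite !map_polyZ map_polyX !map_polyC.
Qed.

(* Both sides are the coefficient of X^j Y^i in
   ((g00 X + g01) Y + (g10 X + g11))^k. *)
Lemma sym_tr k (g : 'M[R]_2) (i j : 'I_k.+1) :
  'C(k, i)%:R * sym k g i j = 'C(k, j)%:R * sym k (g^T) j i.
Proof.
have ik : (i <= k)%N by have := ltn_ord i.
have jk : (j <= k)%N by have := ltn_ord j.
pose Q : {poly {poly R}} := ((g 0 0 *: 'X + (g 0 1)%:P)%:P * 'X + (g 1 0 *: 'X + (g 1 1)%:P)%:P) ^+ k.
have -> : 'C(k, i)%:R * sym k g i j = Q`_i`_j.
  by rewrite coef_exp_linear // coefMn !mxE mulr_natl.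
have -> : Q`_i`_j = (swapXY Q)`_j`_i by rewrite coef_swapXY.
have -> : swapXY Q = ((g 0 0 *: 'X + (g 1 0)%:P)%:P * 'X + (g 0 1 *: 'X + (g 1 1)%:P)%:P) ^+ k.
  rewrite rmorphXn rmorphD rmorphM /= swapXY_X !swapXY_polyC; congr (_ ^+ _).
  rewrite !rmorphD /= !map_polyZ /= !map_polyX !map_polyC /= -!mul_polyC !polyCM; ring.
by rewrite coef_exp_linear // coefMn mulr_natl mxE /sym_row !mxE.
Qed.

End SymmetricPower.

Section UnitarySymmetricPower.
Variable C : numClosedFieldType.

Definition sbin (k i : nat) : C := sqrtC 'C(k, i)%:R.

Lemma sbin_neq0 k (i : 'I_k.+1) : sbin k i != 0.
Proof. by rewrite sqrtC_eq0 pnatr_eq0 -lt0n bin_gt0 -ltnS. Qed.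

Lemma conj_sbin k i : conjC (sbin k i) = sbin k i.
Proof. by apply: geC0_conj; rewrite sqrtC_ge0 ler0n. Qed.

(* Rescaling by the square roots of the binomial coefficients makes the
   monomials orthonormal for the invariant Hermitian form. *)
Definition symU k (g : 'M[C]_2) : 'M[C]_k.+1 :=
  \matrix_(i, j) (sbin k i * sym k g i j / sbin k j).

Lemma symUM k g h : symU k (g *m h) = symU k g *m symU k h.
Proof.
apply/matrixP => i j; rewrite [LHS]mxE symM mxE [RHS]mxE mulr_sumr mulr_suml.
apply: eq_bigr => l _; rewrite !mxE.
by field; rewrite !sbin_neq0.
Qed.

Lemma symU1 k : symU k 1%:M = 1%:M.
Proof.
apply/matrixP => i j; rewrite mxE sym1 !mxE; case: eqP => [->|_].
  by rewrite mulr1 divff // sbin_neq0.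
by rewrite mulr0 mul0r.
Qed.

Lemma symU_conj k g : symU k (g ^bar) = (symU k g) ^bar.
Proof.
apply/matrixP => i j; rewrite !mxE !rmorphM /= fmorphV /= !conj_sbin.
congr (_ * _ / _); have /matrixP/(_ i j) := map_sym conjC k g.
by rewrite !mxE => ->; rewrite /sym_row !mxE.
Qed.

Lemma symU_tr k g : symU k (g^T) = (symU k g)^T.
Proof.
apply/matrixP => i j; rewrite [LHS]mxE [RHS]mxE [RHS]mxE.
have i0 := sbin_neq0 i; have j0 := sbin_neq0 j.
apply: (mulfI (mulf_neq0 i0 j0)).
have -> : sbin k i * sbin k j * (sbin k i * sym k (g^T) i j / sbin k j) =
  sbin k i ^+ 2 * sym k (g^T) i j by field; rewrite ?i0 ?j0.
have -> : sbin k i * sbin k j * (sbin k j * sym k g j i / sbin k i) =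
  sbin k j ^+ 2 * sym k g j i by field; rewrite ?i0 ?j0.
by rewrite !sqrtCK sym_tr trmxK.
Qed.

Lemma symU_adj k g : symU k (g^t*) = (symU k g)^t*.
Proof. by rewrite symU_conj symU_tr. Qed.

Lemma symU_unitary k g : g \is unitarymx -> symU k g \is unitarymx.
Proof.
by move=> gu; apply/unitarymxP; rewrite -symU_adj -symUM (unitarymxP gu) symU1.
Qed.

Lemma symU_diag k (d : 'rV[C]_2) :
  symU k (diag_mx d) = diag_mx (\row_i (d 0 0 ^+ i * d 0 1 ^+ (k - i))).
Proof.
apply/matrixP => i j; rewrite mxE sym_diag !mxE.
case: eqP => [->|_]; last by rewrite mulr0n mulr0 mul0r.
by rewrite mulr1n mulrAC divff ?mul1r // sbin_neq0.
Qed.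

Definition is_SU2 (g : 'M[C]_2) : Prop := g \is unitarymx /\ \det g = 1.


Lemma det_symU k g : is_SU2 g -> \det (symU k g) = 1.
Proof.
move=> [gu g1]; have [P [d [Pu gE d1]]] := unitary_diag gu.
have : d 0 0 * d 0 1 = 1.
  rewrite -g1 gE !det_mulmx mulrAC -det_mulmx unitarymxPV // det1 mul1r.
  by rewrite det_diag !big_ord_recl big_ord0 mulr1; congr (_ * d _ _); apply: val_inj.
rewrite gE !symUM !det_mulmx mulrAC -det_mulmx -symUM unitarymxPV // symU1 det1.
rewrite symU_diag det_diag mul1r => dd.
rewrite (eq_bigr (fun i : 'I_k.+1 => d 0 0 ^+ i * d 0 1 ^+ (k - i))) => [|i _]; last by rewrite mxE.
rewrite big_split /= [X in _ * X](reindex_inj rev_ord_inj) /= -big_split big1 //= => i _.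
have -> : (k - (k.+1 - i.+1) = i)%N by have := ltn_ord i; lia.
by rewrite -exprMn dd expr1n.
Qed.

Lemma char_poly_symU k g (a : C) : is_SU2 g -> \tr g = a + conjC a -> `|a| = 1 ->
  char_poly (symU k g) = \prod_(i < k.+1) ('X - (a ^+ i * conjC a ^+ (k - i))%:P).
Proof.
move=> [gu g1] tg a1.
pose d : 'rV[C]_2 := \row_(i < 2) if i == 0 then a else conjC a.
have d0 : d 0 0 = a by rewrite mxE.
have d1 : d 0 1 = conjC a by rewrite mxE.
have du : diag_mx d \is unitarymx.
  by apply: diag_unitary => i; rewrite mxE; case: ifP; rewrite ?norm_conjC.
have cp : char_poly (diag_mx d) = char_poly g.
  have cp2 (m : 'M[C]_2) : char_poly m = 'X^2 - (\tr m) *: 'X + (\det m)%:P.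
    apply/polyP => i; rewrite !coefD coefN coefZ coefXn coefX coefC.
    have sz := size_char_poly m; have mon := char_poly_monic m.
    case: i => [|[|[|i]]] /=.
    - by rewrite -horner_coef0 horner_coef0 char_poly_det sqrrN expr1n mul1r mulr0 subr0 add0r.
    - by rewrite (char_poly_trace m (isT : 0 < 2)%N) mulr1 add0r addr0.
    - by move: mon; rewrite monicE /lead_coef sz /= => /eqP ->; rewrite mulr0 subr0 addr0.
    - by rewrite nth_default ?sz // mulr0 subr0 addr0.
  rewrite !cp2 g1 tg mxtrace_diag det_diag !big_ord2E d0 d1.
  rewrite !big_ord_recl big_ord0 mulr1.
  have -> : d 0 (lift ord0 ord0) = d 0 1 by congr (d _ _); apply: val_inj.
  by rewrite d1 d0 norm1_conjV.
have [U Uu ->] := unitary_conj_char_poly du gu cp.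
rewrite !symUM symU_adj char_poly_unitary_conj ?symU_unitary // symU_diag char_poly_diag.
by apply: eq_bigr => i _; rewrite mxE d0 d1.
Qed.

Definition sympl2 : 'M[C]_2 := \matrix_(i, j) if i == j then 0 else if i == 0 then 1 else -1.

(** Elements of SU(2) satisfy the relation of [SU2_form] with [sympl2]; applying the representation
    to that relation yields the structure preserved by the symmetric power. *)
Definition sym_form k : 'M[C]_k.+1 := symU k sympl2.

Lemma ord2P (P : 'I_2 -> Prop) : P 0 -> P 1 -> forall i, P i.
Proof.
move=> P0 P1 [[|[|//]] lt].
  by have -> : Ordinal lt = 0 by exact: val_inj.
by have -> : Ordinal lt = 1 by exact: val_inj.
Qed.

Lemma sympl2_unitary : sympl2 \is unitarymx.
Proof.
apply/unitarymxP/matrixP; elim/ord2P; elim/ord2P; rewrite !mxE big_ord2E !mxE /=;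
  by rewrite ?conjC0 ?conjC1 ?rmorphN1; ring.
Qed.

Lemma sympl2_sq : sympl2 *m sympl2 = (-1)%:M.
Proof.
apply/matrixP; elim/ord2P; elim/ord2P; rewrite !mxE big_ord2E !mxE /=; ring.
Qed.

Lemma sympl2_real : sympl2 ^bar = sympl2.
Proof.
by apply/matrixP; elim/ord2P; elim/ord2P; rewrite !mxE /= ?conjC0 ?conjC1 ?rmorphN1.
Qed.

Lemma sym_form_sq k : sym_form k *m sym_form k = ((-1) ^+ k)%:M.
Proof.
rewrite /sym_form -symUM sympl2_sq -diag_const_mx symU_diag -diag_const_mx.
congr diag_mx; apply/rowP => i; rewrite !mxE -exprD subnKC //.
by have := ltn_ord i.
Qed.

Lemma real_structure_sym k : real_structure (sym_form k).
Proof.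
split; first by rewrite symU_unitary ?sympl2_unitary.
  by rewrite /sym_form -symU_conj sympl2_real.
by exists ((-1) ^+ k); rewrite ?sym_form_sq // sqrr_sign.
Qed.

Lemma SU2_form (g : 'M[C]_2) : is_SU2 g -> sympl2 *m g = g ^bar *m sympl2.
Proof.
move=> [gu g1].
have gtE : g^t* = \adj g.
  by rewrite -[RHS]mul1mx -(unitarymxPV gu) -mulmxA mul_mx_adj g1 mulmx1.
have gcE : g ^bar = (\adj g)^T by rewrite -gtE -map_trmx trmxK.
have lE (i : 'I_2) : lift i ord0 = (if i == 0 then 1 else 0).
  by move: i; elim/ord2P; apply: val_inj.
have adjE (i j : 'I_2) : (\adj g) i j = cofactor g j i by rewrite mxE.
have cofE (i j : 'I_2) : cofactor g i j =
    (-1) ^+ (i + j) * g (if i == 0 then 1 else 0) (if j == 0 then 1 else 0).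
  by rewrite /cofactor det_mx11 !mxE !lE.
rewrite gcE; apply/matrixP; elim/ord2P; elim/ord2P;
  by rewrite !mxE !big_ord2E !mxE !cofE /= ; ring.
Qed.

Lemma symU_form k (g : 'M[C]_2) : is_SU2 g -> form_unitary (sym_form k) (symU k g).
Proof.
move=> gS; split; first by rewrite symU_unitary //; case: gS.
by rewrite /sym_form -symU_conj -!symUM SU2_form.
Qed.

End UnitarySymmetricPower.

(** Only bare operations are assumed, because words are also evaluated on carriers that are not
    groups: all square matrices with the adjoint as inverse, and lists of vectors with concatenation
    and reversal. *)
Definition weval (T : Type) (mul : T -> T -> T) (one : T) (inv : T -> T)
    (d : nat) (g : 'I_d -> T) (s : seq ('I_d * bool)) : T :=
  foldr (fun a y => mul (if a.2 then inv (g a.1) else g a.1) y) one s.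

Section WordEvaluation.
Variables (T T' : Type) (mul : T -> T -> T) (one : T) (inv : T -> T).
Variables (mul' : T' -> T' -> T') (one' : T') (inv' : T' -> T').

Lemma weval_closed (P : T -> Prop) d (g : 'I_d -> T) s :
  P one -> (forall x, P x -> P (inv x)) ->
  (forall x y, P x -> P y -> P (mul x y)) ->
  (forall i, P (g i)) -> P (weval mul one inv g s).
Proof.
move=> P1 PV PM Pg; elim: s => [//|[i b] s IH] /=; apply: PM => //.
by case: b => /=; [apply: PV|].
Qed.

Lemma weval_morph (P : T -> Prop) (f : T -> T') d (g : 'I_d -> T) s :
  P one -> (forall x, P x -> P (inv x)) ->
  (forall x y, P x -> P y -> P (mul x y)) ->
  f one = one' -> (forall x, P x -> f (inv x) = inv' (f x)) ->
  (forall x y, P x -> P y -> f (mul x y) = mul' (f x) (f y)) ->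
  (forall i, P (g i)) ->
  f (weval mul one inv g s) = weval mul' one' inv' (fun i => f (g i)) s.
Proof.
move=> P1 PV PM f1 fV fM Pg; elim: s => [//|[i b] s IH] /=.
rewrite fM; last exact: weval_closed; last by case: b => /=; [apply: PV|].
by rewrite IH; congr (mul' _ _); case: b => //=; rewrite fV.
Qed.

End WordEvaluation.

(** * Word values and commutator covers in matrix groups *)

Section MatrixWords.
Variable C : numClosedFieldType.

Definition mxw n d (g : 'I_d -> 'M[C]_n) s : 'M[C]_n :=
  weval (@mulmx _ n n n) 1%:M (fun X => X^t*) g s.

Lemma unitarymx1 n : 1%:M \is @unitarymx C n n.
Proof. by apply/unitarymxP; rewrite trmx1 map_mx1 mulmx1. Qed.

Lemma unitary_conjM n (q x y : 'M[C]_n) : q \is unitarymx ->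
  q *m (x *m y) *m q^t* = q *m x *m q^t* *m (q *m y *m q^t*).
Proof.
by move=> qu; rewrite !mulmxA mulmxKtV.
Qed.

Lemma unitary_conjV n (q x : 'M[C]_n) : (q *m x *m q^t*)^t* = q *m x^t* *m q^t*.
Proof. by rewrite !adjmxM trmxCK mulmxA. Qed.

Lemma unitary_conj_comp n (q p x : 'M[C]_n) : p \is unitarymx ->
  q *m p^t* *m (p *m x *m p^t*) *m (q *m p^t*)^t* = q *m x *m q^t*.
Proof. by move=> pu; rewrite adjmxM trmxCK !mulmxA !(mulmxKtV _ pu). Qed.

Lemma unitary_conj_commutator n (q c t : 'M[C]_n) : q \is unitarymx ->
  q *m (c *m t *m c^t* *m t^t*) *m q^t* =
  q *m c *m q^t* *m (q *m t *m c^t* *m (q *m t)^t*).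
Proof. by move=> qu; rewrite adjmxM !mulmxA (mulmxKtV _ qu). Qed.

Lemma mxw_conj n d (q : 'M[C]_n) (g : 'I_d -> 'M[C]_n) s : q \is unitarymx ->
  mxw (fun i => q *m g i *m q^t*) s = q *m mxw g s *m q^t*.
Proof.
move=> qu; apply/esym.
apply: (@weval_morph _ _ _ _ _ _ _ _ (fun=> True) (fun x => q *m x *m q^t*)) => //.
- by rewrite mulmx1 (unitarymxP qu).
- by move=> x _; rewrite unitary_conjV.
- by move=> x y _ _; rewrite unitary_conjM.
Qed.


Lemma is_SU2_mxw d (g : 'I_d -> 'M[C]_2) s :
  (forall i, is_SU2 (g i)) -> is_SU2 (mxw g s).
Proof.
apply: weval_closed; first by split; rewrite ?unitarymx1 ?det1.
  by move=> x [xu x1]; split; rewrite ?trmxC_unitary // det_map_mx det_tr x1 rmorph1.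
by move=> x y [xu x1] [yu y1]; split; rewrite ?mul_unitarymx // det_mulmx x1 y1 mulr1.
Qed.

Definition SU2_trace d (s : seq ('I_d * bool)) (a : C) : Prop :=
  exists2 g : 'I_d -> 'M[C]_2, forall i, is_SU2 (g i) & \tr (mxw g s) = a + conjC a.

Section Group.
Variables (N : nat) (K Q : 'M[C]_N -> Prop).

(** The letters are evaluated in K, while the conjugating element lies in a possibly larger group Q:
    O(n) for SO(n), U(n) for SU(n). *)
Definition attains d (s : seq ('I_d * bool)) (c : 'M[C]_N) : Prop :=
  exists (g : 'I_d -> 'M[C]_N) (q : 'M[C]_N),
    [/\ forall i, K (g i), Q q & mxw g s = q *m c *m q^t*].

Definition commutator_cover (c : 'M[C]_N) : Prop :=
  forall x, K x -> exists q s, [/\ Q q, Q s &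
    x = q *m (c *m s *m c^t* *m s^t*) *m q^t*].

Lemma word_product_cover d1 d2 (s1 : seq ('I_d1 * bool)) (s2 : seq ('I_d2 * bool)) c :
  (forall x, Q x -> x \is unitarymx) ->
  (forall x, Q x -> Q (x^t*)) -> (forall x y, Q x -> Q y -> Q (x *m y)) ->
  (forall q x, Q q -> K x -> K (q *m x *m q^t*)) ->
  commutator_cover c -> attains s1 c -> attains s2 (c^t*) ->
  forall x, K x -> exists g1 g2, [/\ forall i, K (g1 i), forall i, K (g2 i)
    & x = mxw g1 s1 *m mxw g2 s2].
Proof.
move=> Qu QV QM QK cov [g1 [q1 [g1K q1Q e1]]] [g2 [q2 [g2K q2Q e2]]] x.
move=> /cov[q [s [qQ sQ ->]]].
have u1 := Qu _ q1Q; have u2 := Qu _ q2Q; have qu := Qu _ qQ; have su := Qu _ sQ.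
(* The commutator splits as the conjugate of c by q times the conjugate of [c^t*] by q s.
   Conjugation by [p1] and [p2] moves the two given word values to these factors. *)
pose p1 := q *m q1^t*; pose p2 := q *m s *m q2^t*.
have p1Q : Q p1 by apply: (QM) => //; exact: QV.
have p2Q : Q p2 by apply: (QM); [exact: QM|exact: QV].
exists (fun i => p1 *m g1 i *m p1^t*), (fun i => p2 *m g2 i *m p2^t*).
split; [by move=> i; exact: QK|by move=> i; exact: QK|].
rewrite !mxw_conj; try exact: Qu; rewrite e1 e2 /p1 /p2 !adjmxM !trmxCK !mulmxA.
rewrite !(mulmxKtV _ u1) // !(mulmxKtV _ u2) // !(mulmxKtV _ qu) //.
Qed.

End Group.

Lemma intertwineV N (F A V : 'M[C]_N) : V \is unitarymx -> F *m V = V ^bar *m A ->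
  A *m V^t* = (V^t*) ^bar *m F.
Proof.
move=> Vu FV; have Vcu : V ^bar \is unitarymx by rewrite conjC_unitary.
have /(congr1 (fun X => (V ^bar)^t* *m X *m V^t*)) := FV.
by rewrite !mulmxA unitarymxPV // mul1mx mulmxtVK // adjmx_conj => ->.
Qed.

Lemma form_unitary_transport N (F A V W : 'M[C]_N) : V \is unitarymx ->
  F *m V = V ^bar *m A -> form_unitary A W -> form_unitary F (V *m W *m V^t*).
Proof.
move=> Vu FV [Wu AW]; split; first by rewrite !mul_unitarymx // trmxC_unitary.
rewrite !mulmxA FV -(mulmxA _ A) AW !conjmxM -!mulmxA; congr (_ *m (_ *m _)).
exact: intertwineV.
Qed.

(** A representation r into the group of A, moved by V into the group of F, sends a value of the
    word on SU(2) to a value with the characteristic polynomial of c, hence to a conjugate of c. *)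
Lemma attains_morph N (F A : 'M[C]_N) (r : 'M[C]_2 -> 'M[C]_N) (V c : 'M[C]_N)
    d (s : seq ('I_d * bool)) (a : C) :
  real_structure F -> V \is unitarymx -> F *m V = V ^bar *m A ->
  (forall g h, r (g *m h) = r g *m r h) -> r 1%:M = 1%:M ->
  (forall g, r (g^t*) = (r g)^t*) ->
  (forall g, is_SU2 g -> form_unitary A (r g)) ->
  (forall g, is_SU2 g -> \det (r g) = 1) ->
  (forall g, is_SU2 g -> \tr g = a + conjC a -> char_poly (r g) = char_poly c) ->
  form_unitary F c -> SU2_trace s a ->
  attains (fun x => form_unitary F x /\ \det x = 1) (form_unitary F) s c.
Proof.
move=> FP Vu FV rM r1 rV rA rd rc cF [g gS tg].
pose r' h := V *m r h *m V^t*.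
have r'F h : is_SU2 h -> form_unitary F (r' h).
  by move=> /rA; exact: form_unitary_transport.
have hS := is_SU2_mxw s gS.
have cp : char_poly c = char_poly (r' (mxw g s)).
  by rewrite char_poly_unitary_conj // rc.
have [q qF qE] := form_unitary_conj_char_poly FP cF (r'F _ hS) cp.
exists (fun i => r' (g i)), q; split=> // [i|].
  split; first exact: r'F.
  by rewrite /r' !det_mulmx mulrAC -det_mulmx (unitarymxP Vu) det1 mul1r rd.
rewrite -qE mxw_conj //; congr (_ *m _ *m _); apply/esym.
exact: (@weval_morph _ _ _ _ _ _ _ _ (fun=> True)).
Qed.

(* Moves the form preserved by a symmetric power of SU(2) to the one for which
   the Coxeter element is a signed permutation. *)
Lemma intertwine_real_structures N (F A : 'M[C]_N) (e : C) :
  real_structure F -> real_structure A -> e ^+ 2 = 1 ->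
  F *m F = e%:M -> A *m A = e%:M ->
  exists2 V : 'M[C]_N, V \is unitarymx & F *m V = V ^bar *m A.
Proof.
move=> FP AP e2 Fe Ae.
have : (e == 1) || (e == -1) by rewrite -sqrf_eq1 e2.
move=> /orP[] /eqP eE.
  (* For e = 1 the matrix B is symmetric and unitary. A square root Y that is a function of B is
     symmetric too, so Y conjugates the structure B to the standard one; composing two such Y
     relates F and A. *)
  have key (B : 'M[C]_N) : real_structure B -> B *m B = 1%:M ->
      exists2 Y : 'M[C]_N, Y \is unitarymx & Y = Y ^bar *m B.
    move=> [Bu Br _] B2; have [Y [Yu YY _ Yc]] := unitary_sqrt Bu; exists Y => //.
    have Bt : B^t* = B.
      by rewrite -[B^t*]mulmx1 -B2 mulmxA unitarymxPV // mul1mx.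
    have /Yc : B ^bar *m 1%:M = 1%:M *m B^t* by rewrite mulmx1 mul1mx Br Bt.
    by rewrite mulmx1 mul1mx => ->; rewrite -YY mulmxA unitarymxPV // mul1mx.
  rewrite eE in Fe Ae; have [Y1 Y1u Y1E] := key F FP Fe.
  have [Y2 Y2u Y2E] := key A AP Ae.
  exists (Y1^t* *m Y2); first by rewrite mul_unitarymx // trmxC_unitary.
  have Y1cu : Y1 ^bar \is unitarymx by rewrite conjC_unitary.
  have -> : F = (Y1 ^bar)^t* *m Y1 by rewrite [X in _ *m X]Y1E mulmxA unitarymxPV // mul1mx.
  by rewrite !mulmxA mulmxtVK // conjmxM {1}Y2E adjmx_conj mulmxA.
(* For e = -1 the real matrix B has eigenvalues ['i] and [- 'i] equally often, so F and A have equal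
   characteristic polynomials and are conjugate by a real orthogonal V. Squaring spares the count of
   each eigenvalue; monicity then fixes the sign of the root. *)
have key (B : 'M[C]_N) : real_structure B -> B *m B = (-1)%:M ->
    char_poly B ^+ 2 = ('X^2 + 1) ^+ N.
  move=> [Bu Br _] B2.
  have I1 : real_structure (1%:M : 'M[C]_N).
    split; rewrite ?unitarymx1 ?map_mx1 //; exists 1; rewrite ?expr1n ?mulmx1 //.
  have BF : form_unitary 1%:M B by split=> //; rewrite mul1mx mulmx1 Br.
  have [d [P [Pu BE L1 Ls cp]]] := form_unitary_spectrum I1 BF.
  set L := [seq _ | _ <- _] in L1 Ls cp.
  have sq y : y \in L -> y ^+ 2 = -1.
    move=> /mapP[i _ ->]; have : diag_mx d *m diag_mx d = (-1)%:M.
      have -> : diag_mx d = P *m B *m P^t*.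
        by rewrite BE !mulmxA (unitarymxP Pu) mul1mx mulmxtVK.
      by rewrite -unitary_conjM // B2 mul_mx_scalar -scalemxAl (unitarymxP Pu) scalemx1.
    rewrite mulmx_diag => /matrixP/(_ i i).
    by rewrite !mxE eqxx !mulr1n expr2.
  have cpL : char_poly B = \prod_(y <- map conjC L) ('X - y%:P).
    by rewrite cp; apply: perm_big.
  rewrite expr2 {1}cp cpL big_map -big_split /= big_seq.
  rewrite (eq_bigr (fun=> 'X^2 + 1)) => [|y yL]; last first.
    have yy := norm1_conjV (L1 y yL).
    have yc : conjC y = - y.
      have y0 : y != 0 by rewrite -normr_eq0 L1 // oner_neq0.
      by apply: (mulfI y0); rewrite yy mulrN -expr2 sq // opprK.
    rewrite yc; have -> : (-y)%:P = - y%:P by rewrite polyCN.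
    have : (y ^+ 2)%:P = -1 :> {poly C} by rewrite sq // polyCN.
    rewrite polyC_exp => h.
    by rewrite opprK -subr_sqr h opprK.
  by rewrite -big_seq big_const_seq count_predT size_map size_enum_ord iter_mulr_1.
have I1 : real_structure (1%:M : 'M[C]_N).
  split; rewrite ?unitarymx1 ?map_mx1 //; exists 1; rewrite ?expr1n ?mulmx1 //.
have rf (B : 'M[C]_N) : real_structure B -> form_unitary 1%:M B.
  by move=> [Bu Br _]; split=> //; rewrite mul1mx mulmx1 Br.
have cpE : char_poly A = char_poly F.
  have : char_poly A ^+ 2 = char_poly F ^+ 2.
    by rewrite !key // ?Fe ?Ae ?eE.
  move=> /eqP; rewrite eqf_sqr => /orP[/eqP //|/eqP h].
  have := char_poly_monic A; rewrite h monicE lead_coefN.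
  have /eqP -> : lead_coef (char_poly F) == 1 by rewrite -monicE char_poly_monic.
  by rewrite eq_sym -addr_eq0 -[1 + 1]/(2%:R) pnatr_eq0.
have [V [Vu Vr] ->] := form_unitary_conj_char_poly I1 (rf A AP) (rf F FP) cpE.
exists V => //; rewrite mulmxKtV //.
by move: Vr; rewrite mul1mx mulmx1 => <-.
Qed.

End MatrixWords.

(** * Covering by commutators with a Coxeter element *)

Section CoxeterPolynomials.
Variable C : numClosedFieldType.

Lemma prod_scaled_roots n (z c : C) : n.-primitive_root z -> c != 0 ->
  \prod_(i < n) ('X - (c * z ^+ i)%:P) = 'X^n - (c ^+ n)%:P.
Proof.
move=> zp c0; have n0 := prim_order_gt0 zp.
pose q : {poly C} := c^-1 *: 'X.
have : ('X^n - 1) \Po q = \prod_(i < n) (c^-1 *: ('X - (c * z ^+ i)%:P)).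
  rewrite -(factor_Xn_sub_1 zp) big_mkord rmorph_prod; apply: eq_bigr => i _ /=.
  rewrite comp_polyB comp_polyX comp_polyC scalerBr; congr (_ - _).
  by rewrite -mul_polyC -polyCM mulKf.
rewrite scaler_prod prodr_const card_ord comp_polyB comp_Xn_poly comp_polyC exprZn.
move=> /(congr1 (fun p => c ^+ n *: p)).
rewrite scalerBr !scalerA exprVn divff ?expf_neq0 // !scale1r => <-.
by rewrite -mul_polyC mulr1.
Qed.

Lemma prim_double_root n (a : C) : (2 * n).-primitive_root a -> (0 < n)%N ->
  [/\ `|a| = 1, conjC a = a^-1, a ^+ n = -1 & n.-primitive_root (a ^+ 2)].
Proof.
move=> ap n0.
have a1 : `|a| = 1.
  apply/eqP; rewrite -(@pexpr_eq1 _ _ (2 * n)) ?muln_gt0 //.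
  by rewrite -normrX prim_expr_order // normr1.
have a0 : a != 0 by rewrite -normr_eq0 a1 oner_neq0.
split=> //.
- by apply: (mulfI a0); rewrite norm1_conjV // divff.
- have : (a ^+ n) ^+ 2 == 1 by rewrite -exprM mulnC prim_expr_order.
  rewrite sqrf_eq1 => /orP[|/eqP //].
  by rewrite -(prim_order_dvd ap) => /dvdn_leq; rewrite n0 => /(_ isT); lia.
- by have := dvdn_prim_root ap (dvdn_mull 2 (dvdnn n)); rewrite mulnK.
Qed.

(** The weights a^(2i - n + 1) are a^-(n-1) times the n-th roots of unity, and a^n = -1. *)
Lemma prod_sym_weights n (a : C) : (2 * n).-primitive_root a -> (0 < n)%N ->
  \prod_(i < n) ('X - (a ^+ i * conjC a ^+ (n.-1 - i))%:P) = 'X^n - ((-1) ^+ n.-1)%:P.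
Proof.
move=> ap n0; have [a1 -> an ap2] := prim_double_root ap n0.
have a0 : a != 0 by rewrite -normr_eq0 a1 oner_neq0.
rewrite (eq_bigr (fun i : 'I_n => 'X - (a^-1 ^+ n.-1 * (a ^+ 2) ^+ i)%:P)) => [|i _].
  rewrite prod_scaled_roots ?expf_neq0 ?invr_eq0 // -exprM mulnC exprM exprVn an.
  by rewrite invrN invr1.
have ii : (n.-1 = (n.-1 - i) + i)%N by have := ltn_ord i; lia.
congr ('X - _%:P); rewrite [in RHS]ii exprD mulrC -mulrA; congr (_ * _).
by rewrite -exprMn expr2 mulKf.
Qed.

(** As n is even, the first n of the weights a^(2i - n) are the n-th roots of unity, and the top
    weight a^n = -1 repeats the lowest one. This extra -1 becomes the one-dimensional block of the
    odd orthogonal Coxeter element. *)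
Lemma prod_odd_weights n (a : C) : ~~ odd n -> (2 * n).-primitive_root a -> (0 < n)%N ->
  \prod_(i < n.+1) ('X - (a ^+ i * conjC a ^+ (n - i))%:P) = ('X + 1) * ('X^n - 1).
Proof.
move=> n2 ap n0; have [a1 -> an ap2] := prim_double_root ap n0.
have a0 : a != 0 by rewrite -normr_eq0 a1 oner_neq0.
rewrite big_ord_recr /= subnn expr0 mulr1 an polyCN opprK mulrC; congr (_ * _).
rewrite (eq_bigr (fun i : 'I_n => 'X - (a^-1 ^+ n * (a ^+ 2) ^+ i)%:P)) => [|i _].
  rewrite prod_scaled_roots ?expf_neq0 ?invr_eq0 // !exprVn an.
  by rewrite -signr_odd (negPf n2) expr0 invr1.
have ii : n = (n - i + i)%N by have := ltn_ord i; lia.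
congr ('X - _%:P); rewrite [in X in _ = _ ^+ X * _]ii exprD mulrC -mulrA; congr (_ * _).
by rewrite -exprMn expr2 mulKf.
Qed.

End CoxeterPolynomials.

Section Covers.
Variable C : numClosedFieldType.

Lemma char_poly_half n (a : nat -> C) :
  char_poly (diag_mx (half_row n a)) =
  \prod_(i < n) (('X - (a i)%:P) * ('X - (conjC (a i))%:P)).
Proof.
rewrite char_poly_diag big_split_ord big_split /=; congr (_ * _);
  apply: eq_bigr => i _; rewrite mxE /conj_ext /= ?ltn_ord //.
by rewrite ltnNge leq_addr /= addKn.
Qed.

Lemma form_spectrum N (F x : 'M[C]_N) : real_structure F -> form_unitary F x ->
  exists l (b1 b2 : bool), [/\ {in l, forall y, `|y| = 1},
   (N = size l + size l + b1 + b2)%N, \det x = (-1) ^+ b2, F^T = - F -> b2 = false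
  & char_poly x = \prod_(y <- l) (('X - y%:P) * ('X - (conjC y)%:P))
      * ('X - 1) ^+ b1 * ('X + 1) ^+ b2].
Proof.
move=> FP xF; have [d [P [Pu xE L1 Ls cp]]] := form_unitary_spectrum FP xF.
set L := [seq _ | _ <- _] in L1 Ls cp.
have [l [b1 [b2 Pl]]] := conj_symmetric_seq L1 Ls.
exists l, b1, b2; split.
- by move=> y yl; apply: L1; rewrite (perm_mem Pl) mem_cat yl.
- have := perm_size Pl; rewrite !size_cat !size_nseq size_map size_enum_ord size_map.
  by move=> ->; rewrite !addnA.
- rewrite -(prod_reflect L1 Pl) xE !det_mulmx mulrAC -det_mulmx unitarymxPV // det1 mul1r.
  by rewrite det_diag big_map big_enum.
- move=> Fa; have := form_unitary_even_eigenvalue FP xF Fa Pu xE.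
  by rewrite (count_reflect_even Pl) => /negPf.
rewrite cp (perm_big _ Pl) /= !big_cat big_map big_split /= !mulrA; congr (_ * _ * _).
  by case: b1 {Pl}; rewrite /= ?big_cons ?big_nil ?mulr1.
by case: b2 {Pl}; rewrite /= ?big_cons ?big_nil ?mulr1 // polyCN opprK.
Qed.

Lemma unitary_cover n (e : C) : `|e| = 1 ->
  commutator_cover (fun x : 'M[C]_n => x \is unitarymx /\ \det x = 1)
    (fun x => x \is unitarymx) (cyc n e).
Proof.
move=> e1 x [xu x1]; have [P [d [Pu xE d1]]] := unitary_diag xu.
have dp : \prod_i d 0 i = 1.
  rewrite -det_diag -x1 xE !det_mulmx [RHS]mulrAC -det_mulmx unitarymxPV // det1 mul1r.
  by [].
have [s su dE] := torus_commutator_det1 e1 d1 dp.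
by exists (P^t*), s; rewrite trmxC_unitary trmxCK -dE.
Qed.

Lemma half_char_poly_seq n (l : seq C) : size l = n ->
  char_poly (diag_mx (half_row n (nth 1 l))) =
  \prod_(y <- l) (('X - y%:P) * ('X - (conjC y)%:P)).
Proof. by move=> <-; rewrite char_poly_half (big_nth 1) big_mkord. Qed.

Lemma nth_norm1 (l : seq C) i : {in l, forall y, `|y| = 1} -> `|nth 1 l i| = 1.
Proof.
move=> l1; case: (ltnP i (size l)) => il; first by apply: l1; exact: mem_nth.
by rewrite nth_default ?normr1.
Qed.

Lemma conjCN1 : conjC (-1 : C) = -1. Proof. exact: rmorphN1. Qed.

Lemma N1sq : (-1 : C) ^+ 2 = 1. Proof. by rewrite sqrrN expr1n. Qed.

Lemma cover_of_torus N (F c x t s : 'M[C]_N) : real_structure F ->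
  form_unitary F x -> form_unitary F t -> char_poly t = char_poly x ->
  form_unitary F s -> t = c *m s *m c^t* *m s^t* ->
  exists q s, [/\ form_unitary F q, form_unitary F s &
    x = q *m (c *m s *m c^t* *m s^t*) *m q^t*].
Proof.
move=> FP xF tF cp sF tE; have [q qF xE] := form_unitary_conj_char_poly FP tF xF cp.
by exists q, s; split=> //; rewrite -tE.
Qed.

Lemma symplectic_cover n :
  commutator_cover (form_unitary (half_shift n (-1 : C)))
    (form_unitary (half_shift n (-1 : C))) (cyc (n + n) (-1)).
Proof.
have FP := real_structure_half n conjCN1 N1sq.
move=> x xF; have [l [b1 [b2 [l1 sz xd Fa cp]]]] := form_spectrum FP xF.
have b20 : b2 = false.
  apply: Fa; rewrite /half_shift tr_block_mx !trmx0 trmx1 tr_scalar_mx opp_block_mx.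
  by rewrite !oppr0 -scaleN1r -scalemx1 scaleN1r scalemx1 rmorphN opprK.
have b10 : b1 = false by rewrite b20 in sz; case: b1 sz {cp} => //; lia.
have szl : size l = n by rewrite b10 b20 in sz; lia.
have [s sF tE] := half_torus_commutator n conjCN1 N1sq (fun i => nth_norm1 i l1).
apply: (cover_of_torus FP xF (diag_half _ _ _) _ sF tE).
  by move=> i; exact: nth_norm1.
by rewrite half_char_poly_seq // cp b10 b20 !expr0 !mulr1.
Qed.

Lemma adjmx_block m n (A : 'M[C]_m) (B : 'M[C]_n) :
  (block_mx A 0 0 B)^t* = block_mx (A^t*) 0 0 (B^t*).
Proof. by rewrite tr_block_mx map_block_mx !trmx0 !map_mx0. Qed.

Lemma mulmx_diag_block (R : comNzRingType) m n (A A' : 'M[R]_m) (B B' : 'M[R]_n) :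
  block_mx A 0 0 B *m block_mx A' 0 0 B' = block_mx (A *m A') 0 0 (B *m B').
Proof. by rewrite mulmx_block !mulmx0 !mul0mx !addr0 !add0r. Qed.

Lemma block_unitary m n (A : 'M[C]_m) (B : 'M[C]_n) :
  A \is unitarymx -> B \is unitarymx -> block_mx A 0 0 B \is unitarymx.
Proof.
move=> /unitarymxP Au /unitarymxP Bu; apply/unitarymxP.
by rewrite adjmx_block mulmx_diag_block Au Bu -scalar_mx_block.
Qed.

Lemma form_unitary_block m n (F A : 'M[C]_m) (G B : 'M[C]_n) :
  form_unitary F A -> form_unitary G B ->
  form_unitary (block_mx F 0 0 G) (block_mx A 0 0 B).
Proof.
move=> [Au FA] [Bu GB]; split; first exact: block_unitary.
by rewrite map_block_mx !map_mx0 !mulmx_diag_block FA GB.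
Qed.

Lemma real_structure_block m n (F : 'M[C]_m) (G : 'M[C]_n) :
  real_structure F -> F *m F = 1%:M -> real_structure G -> G *m G = 1%:M ->
  real_structure (block_mx F 0 0 G).
Proof.
move=> [Fu Fr _] F1 [Gu Gr _] G1; split; first exact: block_unitary.
  by rewrite map_block_mx !map_mx0 Fr Gr.
by exists 1; rewrite ?expr1n // mulmx_diag_block F1 G1 -scalar_mx_block.
Qed.

Lemma commutator_block m n (t c s : 'M[C]_m) (t' c' s' : 'M[C]_n) :
  t = c *m s *m c^t* *m s^t* -> t' = c' *m s' *m c'^t* *m s'^t* ->
  block_mx t 0 0 t' = block_mx c 0 0 c' *m block_mx s 0 0 s' *m
    (block_mx c 0 0 c')^t* *m (block_mx s 0 0 s')^t*.
Proof. by move=> -> ->; rewrite !adjmx_block !mulmx_diag_block. Qed.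

Lemma real_structure1 n : real_structure (1%:M : 'M[C]_n).
Proof.
split; rewrite ?unitarymx1 ?map_mx1 //; exists 1; rewrite ?expr1n ?mul1mx //.
Qed.

Lemma half_shift_sq n : half_shift n (1 : C) *m half_shift n 1 = 1%:M.
Proof.
rewrite mulmx_block !mulmx0 !mul0mx !mul1mx !addr0 !add0r.
by rewrite -scalar_mx_block.
Qed.

(** In odd dimension, determinant 1 leaves one unpaired eigenvalue 1, placed in the first block. The
    block -1 of c compensates the determinant -1 of [cyc (m + m) 1]. *)
Lemma odd_orthogonal_cover m :
  let F := block_mx 1%:M 0 0 (half_shift m 1) : 'M[C]_(1 + (m + m)) in
  commutator_cover (fun x => form_unitary F x /\ \det x = 1) (form_unitary F)
    (block_mx (-1)%:M 0 0 (cyc (m + m) 1)).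
Proof.
move=> F.
have FP : real_structure F.
  apply: real_structure_block; rewrite ?mulmx1 ?half_shift_sq //.
    exact: real_structure1.
  by apply: real_structure_half; rewrite ?conjC1 ?expr1n.
move=> x [xF x1]; have [l [b1 [b2 [l1 sz xd _ cp]]]] := form_spectrum FP xF.
have b20 : b2 = false.
  move: xd; rewrite x1; case: (b2) => //= /eqP.
  by rewrite expr1 -addr_eq0 -[1 + 1]/(2%:R) pnatr_eq0.
have b11 : b1 = true by rewrite b20 in sz; case: b1 sz {cp} => //; lia.
have szl : size l = m by rewrite b11 b20 in sz; lia.
have [s sF tE] := half_torus_commutator m (conjC1 C) (expr1n _ 2) (fun i => nth_norm1 i l1).
have t1 : (1%:M : 'M[C]_1) = (-1)%:M *m 1%:M *m (-1)%:M^t* *m 1%:M^t*.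
  rewrite !tr_scalar_mx !map_scalar_mx /= conjCN1 conjC1 !mulmx1 -scalar_mxM.
  by rewrite mulrNN mulr1.
apply: (cover_of_torus FP xF _ _ (form_unitary_block (form_unitary1 _) sF) (commutator_block t1 tE)).
  apply: form_unitary_block; first exact: form_unitary1.
  by apply: diag_half => i; exact: nth_norm1.
rewrite char_poly_block half_char_poly_seq // cp b11 b20 expr0 mulr1 mulrC; congr (_ * _).
by rewrite -diag_const_mx char_poly_diag big_ord1 mxE.
Qed.

(** One conjugate pair of eigenvalues goes to the block of size 2, the others to the large block.
    Each cyclic block has determinant -1, so a single one of full size would lie outside SO. *)
Lemma even_orthogonal_cover m :
  let F := block_mx (half_shift 1 1) 0 0 (half_shift m 1) : 'M[C]_((1 + 1) + (m + m)) in
  commutator_cover (fun x => form_unitary F x /\ \det x = 1) (form_unitary F)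
    (block_mx (cyc (1 + 1) 1) 0 0 (cyc (m + m) 1)).
Proof.
move=> F.
have FP : real_structure F.
  apply: real_structure_block; rewrite ?mulmx1 ?half_shift_sq //;
    by apply: real_structure_half; rewrite ?conjC1 ?expr1n.
move=> x [xF x1]; have [l [b1 [b2 [l1 sz xd _ cp]]]] := form_spectrum FP xF.
have b20 : b2 = false.
  move: xd; rewrite x1; case: (b2) => //= /eqP.
  by rewrite expr1 -addr_eq0 -[1 + 1]/(2%:R) pnatr_eq0.
have b10 : b1 = false by rewrite b20 in sz; case: b1 sz {cp} => //; lia.
case: l l1 sz cp => [|y l] l1 sz cp; first by rewrite b20 b10 in sz; move: sz => /=; lia.
have szl : size l = m by move: sz; rewrite b10 b20 /=; lia.
have l1' : {in l, forall z, `|z| = 1} by move=> z zl; apply: l1; rewrite inE zl orbT.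
have y1 : {in [:: y], forall z, `|z| = 1}.
  by move=> z; rewrite inE => /eqP ->; apply: l1; rewrite mem_head.
have [s sF tE] := half_torus_commutator m (conjC1 C) (expr1n _ 2) (fun i => nth_norm1 i l1').
have [s' sF' tE'] := half_torus_commutator 1 (conjC1 C) (expr1n _ 2) (fun i => nth_norm1 i y1).
apply: (cover_of_torus FP xF _ _ (form_unitary_block sF' sF) (commutator_block tE' tE)).
  by apply: form_unitary_block; apply: diag_half => i; exact: nth_norm1.
rewrite char_poly_block !half_char_poly_seq // cp b10 b20 !expr0 !mulr1.
by rewrite big_cons big_seq1.
Qed.

Lemma commutator_cover_transport N (F A V c : 'M[C]_N) :
  V \is unitarymx -> F *m V = V ^bar *m A ->
  commutator_cover (fun x => form_unitary A x /\ \det x = 1) (form_unitary A) c ->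
  commutator_cover (fun x => form_unitary F x /\ \det x = 1) (form_unitary F)
    (V *m c *m V^t*).
Proof.
move=> Vu FV cov x [xF x1].
have Vtu : V^t* \is unitarymx by rewrite trmxC_unitary.
have [|q [s [qA sA xE]]] := cov (V^t* *m x *m V).
  split; last by rewrite !det_mulmx mulrAC -det_mulmx unitarymxPV // det1 mul1r.
  rewrite -[X in _ *m X](trmxCK V).
  by apply: form_unitary_transport xF => //; exact: intertwineV.
exists (V *m q *m V^t*), (V *m s *m V^t*).
split; [exact: form_unitary_transport qA|exact: form_unitary_transport sA|].
have -> : x = V *m (V^t* *m x *m V) *m V^t*.
  by rewrite !mulmxA (unitarymxP Vu) mul1mx mulmxtVK.
by rewrite xE !unitary_conjV -!unitary_conjM.
Qed.

End Covers.

(** * Products of two word values in SU, Sp and SO *)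

Section Words.
Variables (C : numClosedFieldType) (d1 d2 : nat).
Variables (s1 : seq ('I_d1 * bool)) (s2 : seq ('I_d2 * bool)) (a : C).

(** Used to attain the inverse of a Coxeter element with the same SU(2) trace as the element
    itself. *)
Lemma char_poly_adj_real n (c : 'M[C]_n) : c ^bar = c -> char_poly (c^t*) = char_poly c.
Proof. by move=> cr; rewrite -map_trmx cr char_poly_tr. Qed.

Lemma conjC_sign k : conjC ((-1) ^+ k : C) = (-1) ^+ k.
Proof. by rewrite rmorphXn rmorphN1. Qed.

Lemma norm_sign k : `|(-1) ^+ k : C| = 1.
Proof. by rewrite normrX normrN1 expr1n. Qed.

Lemma char_poly_symU_cyc k (g : 'M[C]_2) : (2 * k.+1).-primitive_root a ->
  is_SU2 g -> \tr g = a + conjC a ->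
  char_poly (symU k g) = char_poly (cyc k.+1 ((-1) ^+ k : C)).
Proof.
move=> ap gS tg; have [a1 _ _ _] := prim_double_root ap isT.
by rewrite (char_poly_symU k gS tg a1) char_poly_cyc // (prod_sym_weights ap).
Qed.

Lemma SU_words k : (2 * k.+1).-primitive_root a ->
  SU2_trace s1 a -> SU2_trace s2 a ->
  forall x : 'M[C]_k.+1, x \is unitarymx /\ \det x = 1 ->
  exists g1 g2, [/\ forall i, g1 i \is unitarymx /\ \det (g1 i) = 1,
    forall i, g2 i \is unitarymx /\ \det (g2 i) = 1 & x = mxw g1 s1 *m mxw g2 s2].
Proof.
move=> ap t1 t2.
have att (d : nat) (s : seq ('I_d * bool)) (c : 'M[C]_k.+1) : SU2_trace s a -> c \is unitarymx ->
    char_poly c = char_poly (cyc k.+1 ((-1) ^+ k : C)) ->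
    attains (fun x : 'M[C]_k.+1 => x \is unitarymx /\ \det x = 1)
      (fun x => x \is unitarymx) s c.
  move=> [g gS tg] cu cp; have hS := is_SU2_mxw s gS.
  have [|q qu qE] := unitary_conj_char_poly cu (symU_unitary k (proj1 hS)).
    by rewrite cp (char_poly_symU_cyc ap hS tg).
  exists (fun i => symU k (g i)), q; split=> // [i|].
    by have gi := gS i; rewrite det_symU // symU_unitary //; case: gi.
  rewrite -qE; apply/esym; apply: (@weval_morph _ _ _ _ _ _ _ _ (fun=> True)) => //.
  - exact: symU1.
  - by move=> x _; exact: symU_adj.
  - by move=> x y _ _; exact: symUM.
have cu : cyc k.+1 ((-1) ^+ k : C) \is unitarymx by apply: cyc_unitary; exact: norm_sign.
apply: (word_product_cover _ _ _ _ (unitary_cover (norm_sign k))) => //.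
- by move=> x xu; rewrite trmxC_unitary.
- by move=> x y; exact: mul_unitarymx.
- move=> q x qu [xu x1]; rewrite !mul_unitarymx ?trmxC_unitary //; split=> //.
  by rewrite !det_mulmx mulrAC -det_mulmx (unitarymxP qu) det1 mul1r.
- exact: att.
- apply: att; rewrite ?trmxC_unitary // char_poly_adj_real //.
  by apply: cyc_real; exact: conjC_sign.
Qed.

Lemma Sp_words m (n := m.+1) (F := half_shift n (-1 : C)) :
  (2 * (n + n)).-primitive_root a -> SU2_trace s1 a -> SU2_trace s2 a ->
  forall x : 'M[C]_(n + n), form_unitary F x ->
  exists g1 g2, [/\ forall i, form_unitary F (g1 i),
    forall i, form_unitary F (g2 i) & x = mxw g1 s1 *m mxw g2 s2].
Proof.
(* [k.+1] is convertible to [n + n], and k is odd, so the symmetric power of degree k is of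
   quaternionic type. *)
move=> ap t1 t2; pose k := (m + n)%N.
have ko : odd k by rewrite /k /n; lia.
have kE : (-1) ^+ k = -1 :> C by rewrite -signr_odd ko expr1.
have FP : real_structure F := real_structure_half n (conjCN1 C) (N1sq C).
have FF : F *m F = (-1)%:M.
  rewrite /F /half_shift mulmx_block !mulmx0 !mul0mx mul1mx mulmx1 !addr0 !add0r.
  by rewrite -scalar_mx_block.
have AA : sym_form C k *m sym_form C k = (-1)%:M by rewrite sym_form_sq kE.
have [V Vu FV] := intertwine_real_structures FP (real_structure_sym C k) (N1sq C) FF AA.
have cF : form_unitary F (cyc (n + n) (-1)) := cyc_half n (conjCN1 C) (N1sq C).
have att (d : nat) (s : seq ('I_d * bool)) c : SU2_trace s a -> form_unitary F c ->
    char_poly c = char_poly (cyc (n + n) (-1 : C)) ->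
    attains (form_unitary F) (form_unitary F) s c.
  move=> ts cF' cp.
  have [g [q [gF qF E]]] :
      attains (fun x => form_unitary F x /\ \det x = 1) (form_unitary F) s c.
    apply: (attains_morph (r := symU k) FP Vu FV (@symUM C k) (symU1 C k)
      (@symU_adj C k) (@symU_form C k) (@det_symU C k) _ cF' ts).
    by move=> g gS tg; rewrite cp -kE; exact: (char_poly_symU_cyc (k := k) ap gS tg).
  by exists g, q; split=> // i; case: (gF i).
apply: (word_product_cover _ _ _ _ (@symplectic_cover C n)).
- by move=> x [].
- by move=> x; exact: form_unitaryV.
- by move=> x y; exact: form_unitaryM.
- by move=> q x qF xF; apply: form_unitaryM; [exact: form_unitaryM|exact: form_unitaryV].
- exact: att.
- apply: att => //; first exact: form_unitaryV.
  by apply: char_poly_adj_real; apply: cyc_real; exact: conjCN1.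
Qed.

(** Stated for the standard form, whose elements are real matrices and can be lifted to products of
    unit vectors; the eigenvalue -1 is recorded for the sign correction in the spin group. *)
Definition orthogonal_coxeter N : Prop := exists c : 'M[C]_N,
  [/\ form_unitary 1%:M c, root (char_poly c) (-1),
   commutator_cover (fun x => form_unitary 1%:M x /\ \det x = 1) (form_unitary 1%:M) c,
   attains (fun x => form_unitary 1%:M x /\ \det x = 1) (form_unitary 1%:M) s1 c
 & attains (fun x => form_unitary 1%:M x /\ \det x = 1) (form_unitary 1%:M) s2 (c^t*)].

Lemma orthogonal_coxeter_of_form N (F A c : 'M[C]_N) (r : 'M[C]_2 -> 'M[C]_N) :
  SU2_trace s1 a -> SU2_trace s2 a ->
  real_structure F -> F *m F = 1%:M -> real_structure A -> A *m A = 1%:M ->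
  form_unitary F c -> c ^bar = c ->
  commutator_cover (fun x => form_unitary F x /\ \det x = 1) (form_unitary F) c ->
  (forall g h, r (g *m h) = r g *m r h) -> r 1%:M = 1%:M ->
  (forall g, r (g^t*) = (r g)^t*) ->
  (forall g, is_SU2 g -> form_unitary A (r g)) ->
  (forall g, is_SU2 g -> \det (r g) = 1) ->
  (forall g, is_SU2 g -> \tr g = a + conjC a -> char_poly (r g) = char_poly c) ->
  root (char_poly c) (-1) -> orthogonal_coxeter N.
Proof.
move=> t1 t2 FP FF AP AA cF cr cov rM r1 rV rA rd rc c1.
have I1 := @real_structure1 C N; have II : 1%:M *m 1%:M = 1%:M :> 'M[C]_N by rewrite mulmx1.
have [V Vu FV] := intertwine_real_structures I1 FP (expr1n _ 2) II FF.
have [W Wu AW] := intertwine_real_structures I1 AP (expr1n _ 2) II AA.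
have cF' := form_unitary_transport Vu FV cF.
have cp : char_poly (V *m c *m V^t*) = char_poly c by rewrite char_poly_unitary_conj.
exists (V *m c *m V^t*); split=> //; first by rewrite cp.
- exact: commutator_cover_transport cov.
- by apply: (attains_morph I1 Wu AW rM r1 rV rA rd _ cF' t1) => g gS tg; rewrite cp rc.
apply: (attains_morph I1 Wu AW rM r1 rV rA rd _ (form_unitaryV cF') t2) => g gS tg.
by rewrite unitary_conjV char_poly_unitary_conj // char_poly_adj_real // rc.
Qed.

Lemma even_sign m : (-1) ^+ (m + m) = 1 :> C.
Proof. by rewrite -signr_odd addnn odd_double. Qed.

Lemma sym_form_even_sq m : sym_form C (m + m) *m sym_form C (m + m) = 1%:M.
Proof. by rewrite sym_form_sq even_sign. Qed.

Lemma char_poly_symU_even m (g : 'M[C]_2) : (0 < m)%N -> (2 * (m + m)).-primitive_root a ->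
  is_SU2 g -> \tr g = a + conjC a ->
  char_poly (symU (m + m) g) = ('X + 1) * char_poly (cyc (m + m) (1 : C)).
Proof.
move=> m0 ap gS tg; have mm : (0 < m + m)%N by rewrite addn_gt0 m0.
have [a1 _ _ _] := prim_double_root ap mm.
rewrite (char_poly_symU _ gS tg a1) char_poly_cyc // prod_odd_weights //.
by rewrite addnn odd_double.
Qed.

Lemma odd_orthogonal_coxeter m : (0 < m)%N -> (2 * (m + m)).-primitive_root a ->
  SU2_trace s1 a -> SU2_trace s2 a -> orthogonal_coxeter (m + m).+1.
Proof.
move=> m0 ap t1 t2.
pose F := block_mx 1%:M 0 0 (half_shift m 1) : 'M[C]_(1 + (m + m)).
pose c := block_mx (-1)%:M 0 0 (cyc (m + m) 1) : 'M[C]_(1 + (m + m)).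
have HP : real_structure (half_shift m (1 : C)).
  by apply: real_structure_half; rewrite ?conjC1 ?expr1n.
have cp : char_poly c = ('X + 1) * char_poly (cyc (m + m) (1 : C)).
  rewrite char_poly_block; congr (_ * _).
  by rewrite -diag_const_mx char_poly_diag big_ord1 mxE polyCN opprK.
apply: (@orthogonal_coxeter_of_form _ F (sym_form C (m + m)) c (symU (m + m)) t1 t2).
- by apply: real_structure_block; rewrite ?mulmx1 ?half_shift_sq //; exact: real_structure1.
- by rewrite mulmx_diag_block mulmx1 half_shift_sq -scalar_mx_block.
- exact: real_structure_sym.
- exact: sym_form_even_sq.
- apply: form_unitary_block; last by apply: cyc_half; rewrite ?conjC1 ?expr1n.
  split; last by rewrite mul1mx mulmx1 map_scalar_mx /= conjCN1.
  rewrite -diag_const_mx; apply: diag_unitary => i.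
  by rewrite mxE normrN1.
- rewrite map_block_mx !map_mx0 map_scalar_mx /= conjCN1 cyc_real ?conjC1 //.
- exact: odd_orthogonal_cover.
- exact: symUM.
- exact: symU1.
- exact: symU_adj.
- exact: symU_form.
- exact: det_symU.
- by move=> g gS tg; rewrite cp; exact: char_poly_symU_even.
- by rewrite cp rootM rootE !hornerE addNr eqxx.
Qed.

(** The trivial summand contributes X - 1 and the repeated weight X + 1; together they match the
    cyclic block of size 2. *)
Lemma even_orthogonal_coxeter m : (0 < m)%N -> (2 * (m + m)).-primitive_root a ->
  SU2_trace s1 a -> SU2_trace s2 a -> orthogonal_coxeter (m + m).+2.
Proof.
move=> m0 ap t1 t2.
pose F := block_mx (half_shift 1 1) 0 0 (half_shift m 1) : 'M[C]_((1 + 1) + (m + m)).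
pose A := block_mx 1%:M 0 0 (sym_form C (m + m)) : 'M[C]_(1 + (m + m).+1).
pose c := block_mx (cyc (1 + 1) 1) 0 0 (cyc (m + m) 1) : 'M[C]_((1 + 1) + (m + m)).
pose r g := block_mx 1%:M 0 0 (symU (m + m) g) : 'M[C]_(1 + (m + m).+1).
have HP n : real_structure (half_shift n (1 : C)).
  by apply: real_structure_half; rewrite ?conjC1 ?expr1n.
have cp : char_poly c = ('X^2 - 1) * char_poly (cyc (m + m) (1 : C)).
  by rewrite char_poly_block (@char_poly_cyc C (1 + 1)%N) // polyC1.
have I1 := @real_structure1 C 1.
have FP : real_structure F by apply: real_structure_block; rewrite ?half_shift_sq.
have FF : F *m F = 1%:M by rewrite mulmx_diag_block !half_shift_sq -scalar_mx_block.
have AP : real_structure A.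
  by apply: real_structure_block; rewrite ?mulmx1 ?sym_form_even_sq //; exact: real_structure_sym.
have AA : A *m A = 1%:M by rewrite mulmx_diag_block mulmx1 sym_form_even_sq -scalar_mx_block.
have cF : form_unitary F c.
  by apply: form_unitary_block; apply: cyc_half; rewrite ?conjC1 ?expr1n.
have cr : c ^bar = c by rewrite map_block_mx !map_mx0 !cyc_real ?conjC1.
have rM g h : r (g *m h) = r g *m r h by rewrite /r mulmx_diag_block mulmx1 symUM.
have r1 : r 1%:M = 1%:M by rewrite /r symU1 -scalar_mx_block.
have rV g : r (g^t*) = (r g)^t* by rewrite /r adjmx_block trmx1 map_mx1 symU_adj.
have rA g : is_SU2 g -> form_unitary A (r g).
  by move=> gS; apply: form_unitary_block; [exact: form_unitary1|exact: symU_form].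
have rd g : is_SU2 g -> \det (r g) = 1.
  by move=> gS; rewrite /r det_ublock det1 mul1r det_symU.
have rc g : is_SU2 g -> \tr g = a + conjC a -> char_poly (r g) = char_poly c.
  move=> gS tg; rewrite cp /r char_poly_block (char_poly_symU_even m0 ap gS tg) mulrA.
  by congr (_ * _); rewrite -diag_const_mx char_poly_diag big_ord1 mxE; ring.
apply: (@orthogonal_coxeter_of_form _ F A c r t1 t2 FP FF AP AA cF cr _ rM r1 rV rA rd rc).
  exact: even_orthogonal_cover.
by rewrite cp rootM rootE !hornerE sqrrN expr1n subrr eqxx.
Qed.

End Words.

(** * Word values on SU(2) *)

Section FreeWords.
Variables (R : rcfType) (d : nat).
Local Notation C := (R[i]).
Local Notation toC := (real_complex R).
Local Notation letter := ('I_d * bool)%type.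
Implicit Types (a b : letter) (s : seq letter).

Definition slope (i : 'I_d) : C := i.+1%:R.
Definition axis_scale (i : 'I_d) : C := 1 + slope i ^+ 2.

(** With n = [slope i], this is 1 + n^2 times the reflection fixing (1, n). Being real symmetric of
    trace 0, all axes lie in one plane. Distinct positive slopes make eigenvectors of different axes
    neither parallel nor orthogonal. *)
Definition axis (i : 'I_d) : 'M[C]_2 := \matrix_(j, k)
  if j == k then (if j == 0 then 1 - slope i ^+ 2 else slope i ^+ 2 - 1)
  else 2 * slope i.

(* The rotation of SU(2) about [axis i] by the angle 2 arctan x, or its inverse,
   times the denominator [axis_scale i * (1 + x^2)]. *)
Definition rot_num a (x : C) : 'M[C]_2 :=
  (axis_scale a.1 * (1 - x ^+ 2))%:M + ((-1) ^+ a.2 * (2 * 'i * x)) *: axis a.1.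

Definition rot_den (i : 'I_d) (x : C) : C := axis_scale i * (1 + x ^+ 2).

Definition rot (i : 'I_d) (x : C) : 'M[C]_2 := (rot_den i x)^-1 *: rot_num (i, false) x.

Lemma slope_conj i : conjC (slope i) = slope i.
Proof. exact: rmorph_nat. Qed.

Lemma axis_scale_gt0 i : 0 < axis_scale i.
Proof. by rewrite ltr_wpDr ?exprn_ge0 ?ler0n. Qed.

Lemma axis_sq i : axis i *m axis i = (axis_scale i ^+ 2)%:M.
Proof.
apply/matrixP; elim/ord2P; elim/ord2P; rewrite !mxE big_ord2E !mxE /= /axis_scale;
  by rewrite ?mulr1n ?mulr0n; ring.
Qed.

Lemma axis_adj i : (axis i)^t* = axis i.
Proof.
apply/matrixP; elim/ord2P; elim/ord2P; rewrite !mxE /=;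
  by rewrite !(rmorphB, rmorphM, rmorphXn, rmorph1, rmorph_nat) /= ?slope_conj.
Qed.

Lemma rot_den_neq0 i (x : R) : rot_den i (toC x) != 0.
Proof.
rewrite mulf_neq0 ?gt_eqF ?axis_scale_gt0 // ltr_wpDr //.
by rewrite -rmorphXn ler0c sqr_ge0.
Qed.

Lemma toC_real (x : R) : toC x \is Num.real.
Proof. by rewrite complex_real. Qed.

Lemma rot_den_conj i (x : R) : conjC (rot_den i (toC x)) = rot_den i (toC x).
Proof.
apply/CrealP; rewrite rpredM ?rpredD ?rpred1 ?rpredX ?toC_real //.
by rewrite gtr0_real // axis_scale_gt0.
Qed.

Lemma rot_num_adj i (b : bool) (x : R) :
  (rot_num (i, b) (toC x))^t* = rot_num (i, ~~ b) (toC x).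
Proof.
rewrite /rot_num /= linearD /= linearZ /= tr_scalar_mx map_mxD map_mxZ map_scalar_mx.
congr (_%:M + _ *: _); last exact: axis_adj.
  apply/CrealP; rewrite rpredM ?rpredB ?rpred1 ?rpredX ?toC_real //.
  by rewrite gtr0_real // axis_scale_gt0.
rewrite !rmorphM /= conjCi (CrealP (toC_real x)) rmorph_nat conjC_sign.
by case: b; rewrite /= ?expr1 ?expr0; ring.
Qed.

Lemma rot_num_mul i x : rot_num (i, false) x *m rot_num (i, true) x = (rot_den i x ^+ 2)%:M.
Proof.
have i2 : 'i ^+ 2 = -1 :> C by exact: sqrCi.
rewrite /rot_num /rot_den /= expr0 expr1 !mul1r mulmxDl !mulmxDr -scalar_mxM.
rewrite -!scalemxAl -!scalemxAr axis_sq mul_mx_scalar mul_scalar_mx !scalerA.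
set A := axis_scale i; rewrite scale_scalar_mx addrACA -addrA (addrA (_ *: axis i)) -scalerDl.
set k := _ + _ * (A * _); have -> : k = 0 by rewrite /k; ring.
rewrite scale0r add0r -(raddfD (@scalar_mx C 2)); congr (_%:M).
have -> : A * (1 - x ^+ 2) * (A * (1 - x ^+ 2)) + 2 * 'i * x * (-1 * (2 * 'i * x)) * A ^+ 2
  = A ^+ 2 * ((1 - x ^+ 2) ^+ 2 - 4 * x ^+ 2 * 'i ^+ 2) by ring.
by rewrite i2; ring.
Qed.

Lemma det_mx2 (T : comNzRingType) (M : 'M[T]_2) : \det M = M 0 0 * M 1 1 - M 0 1 * M 1 0.
Proof.
rewrite (expand_det_row _ 0) big_ord2E /cofactor !det_mx11 !mxE /= expr0 expr1.
have -> : lift 0 0 = 1 :> 'I_2 by exact: val_inj.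
have -> : lift 1 0 = 0 :> 'I_2 by exact: val_inj.
by ring.
Qed.

Lemma det_rot_num i x : \det (rot_num (i, false) x) = rot_den i x ^+ 2.
Proof.
have i2 : 'i ^+ 2 = -1 :> C by exact: sqrCi.
rewrite det_mx2 /rot_num /rot_den /axis_scale !mxE /= !mulr1n !mulr0n; set n := slope i.
transitivity ((1 + n ^+ 2) ^+ 2 * ((1 - x ^+ 2) ^+ 2 - 4 * x ^+ 2 * 'i ^+ 2)); first by ring.
by rewrite i2; ring.
Qed.

Lemma rot_adj i (x : R) : (rot i (toC x))^t* = (rot_den i (toC x))^-1 *: rot_num (i, true) (toC x).
Proof.
by rewrite /rot linearZ /= map_mxZ rot_num_adj /= fmorphV /= rot_den_conj.
Qed.

Lemma rot_SU2 i (x : R) : is_SU2 (rot i (toC x)).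
Proof.
have D0 := rot_den_neq0 i x; split.
  apply/unitarymxP; rewrite rot_adj /rot -scalemxAl -scalemxAr rot_num_mul scalerA.
  rewrite scale_scalar_mx -expr2 -exprMn mulVf // expr1n //.
by rewrite /rot detZ det_rot_num -exprMn mulVf // expr1n.
Qed.

Definition num_prod s (x : C) : 'M[C]_2 := foldr (fun a M => rot_num a x *m M) 1%:M s.
Definition den_prod s (x : C) : C := foldr (fun a y => rot_den a.1 x * y) 1 s.

Lemma mxw_rot s (x : R) :
  mxw (fun i => rot i (toC x)) s = (den_prod s (toC x))^-1 *: num_prod s (toC x).
Proof.
elim: s => [|[i b] s IH]; first by rewrite /= invr1 scale1r.
rewrite /mxw /= in IH *; rewrite IH.
have -> : (if b then (rot i (toC x))^t* else rot i (toC x)) =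
    (rot_den i (toC x))^-1 *: rot_num (i, b) (toC x).
  by case: b; rewrite ?rot_adj.
by rewrite -scalemxAl -scalemxAr scalerA -(invfM (rot_den _ _)).
Qed.

Lemma num_prod_poly s : exists P : 'M[{poly C}]_2,
  forall x, num_prod s x = map_mx (horner_eval x) P.
Proof.
elim: s => [|a s [P PE]]; first by exists 1%:M => x; rewrite map_mx1.
pose N : 'M[{poly C}]_2 := ((axis_scale a.1)%:P * (1 - 'X ^+ 2))%:M +
  (((-1) ^+ a.2 * (2 * 'i))%:P * 'X) *: map_mx polyC (axis a.1).
exists (N *m P) => x; rewrite map_mxM -PE /=; congr (_ *m _).
apply/matrixP => i j; rewrite !mxE /horner_eval !(hornerE, hornerMn) /=.
by [].
Qed.

Lemma den_prod_poly s : exists p : {poly C}, forall x, den_prod s x = p.[x].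
Proof.
elim: s => [|a s [p pE]]; first by exists 1 => x; rewrite hornerE.
exists ((axis_scale a.1)%:P * (1 + 'X ^+ 2) * p) => x /=.
by rewrite pE !hornerE.
Qed.

(** Eigenvector of [axis a.1], for the positive eigenvalue if a is a generator and for the negative
    one if a is an inverse. *)
Definition eig a : 'cV[C]_2 := \col_(j < 2)
  if a.2 then (if j == 0 then - slope a.1 else 1) else (if j == 0 then 1 else slope a.1).

(* At the pole x = -i the numerators of the rotations have rank one. *)
Lemma rot_num_degenerate a : rot_num a (- 'i) = 4 *: (eig a *m (eig a)^T).
Proof.
have i2 : 'i * 'i = -1 :> C by rewrite -expr2 sqrCi.
case: a => i b; rewrite /rot_num sqrrN expr2 mulrN -mulrA i2 /axis_scale /=.
apply/matrixP; elim/ord2P; elim/ord2P; case: b;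
  rewrite !mxE big_ord_recl big_ord0 !mxE /= ?mulr1n ?mulr0n ?expr0 ?expr1; ring.
Qed.

(** The pairing is 1 + n_i n_j > 0 for letters of equal sign, and a difference of slopes for letters
    of opposite sign, which vanishes only when the letters are mutually inverse. *)
Lemma eig_pairing a b : b != linv a -> exists2 k : C, k != 0 &
  (eig a)^T *m eig b = k%:M.
Proof.
move=> ab; exists (((eig a)^T *m eig b) 0 0); last exact: mx11_scalar.
rewrite !mxE big_ord2E !mxE /=; case: a b ab => [i b] [j c] /=.
have pos : 1 + slope i * slope j != 0.
  by rewrite gt_eqF // ltr_wpDr ?mulr_ge0 ?ler0n.
have sl : slope i = slope j -> i = j.
  by move/eqP; rewrite eqr_nat => /eqP[h]; apply: val_inj.
rewrite /linv /= xpair_eqE; case: b c => -[] /=; rewrite ?andbT ?andbF => ij.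
- by rewrite mulrNN mulr1 addrC.
- rewrite mulr1 mul1r addrC subr_eq0; apply: contra ij => /eqP/esym/sl ->; exact: eqxx.
- rewrite mul1r mulr1 addrC subr_eq0; apply: contra ij => /eqP/sl ->; exact: eqxx.
- by rewrite mul1r.
Qed.

(** The rank one factors telescope: the inner pairings are nonzero scalars, leaving the first
    eigenvector times a multiple of the transposed last one. *)
Lemma num_prod_degenerate a s : path (fun a b => b != linv a) a s ->
  exists2 r : 'rV[C]_2, r != 0 & num_prod (a :: s) (- 'i) = eig a *m r.
Proof.
have self (c : letter) : c != linv c by case: c => i [] /=; rewrite xpair_eqE /= andbF.
elim: s a => [|b s IH] a /=.
  move=> _; exists (4 *: (eig a)^T); last first.
    by rewrite mulmx1 rot_num_degenerate -scalemxAr.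
  rewrite scaler_eq0 negb_or pnatr_eq0 /=; apply: contraTneq isT => a0.
  have [k k0] := eig_pairing (self a).
  by rewrite a0 mul0mx => /matrixP/(_ 0 0)/eqP; rewrite !mxE mulr1n eq_sym (negPf k0).
case/andP=> ab /IH[r r0 E]; have [k k0 kE] := eig_pairing ab.
exists ((4 * k) *: r); first by rewrite scaler_eq0 mulf_eq0 pnatr_eq0 /= (negPf k0).
have -> : rot_num b (- 'i) *m num_prod s (- 'i) = eig b *m r := E.
rewrite rot_num_degenerate -scalemxAl -!mulmxA (mulmxA _ (eig b)) kE mul_scalar_mx.
by rewrite -!scalemxAr scalerA.
Qed.

Lemma den_prod_gt0 s (x : R) : 0 < den_prod s (toC x).
Proof.
elim: s => [|a s IH] /=; first by rewrite ltr01.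
rewrite !mulr_gt0 ?axis_scale_gt0 // ltr_wpDr //.
by rewrite -rmorphXn ler0c sqr_ge0.
Qed.

Lemma exists_nontrivial_rotation a s : path (fun a b => b != linv a) a s ->
  exists x : R, mxw (fun i => rot i (toC x)) (a :: s) != 1%:M.
Proof.
move=> ps; have [r r0 E] := num_prod_degenerate ps.
have [P PE] := num_prod_poly (a :: s); have [p pE] := den_prod_poly (a :: s).
have [i [j Eij]] : exists i j, num_prod (a :: s) (- 'i) i j != 0.
  apply/'exists_existsP; apply: contraNT r0; rewrite negb_exists => /forallP h.
  have M0 : eig a *m r = 0.
    rewrite -E; apply/matrixP => i j; rewrite [RHS]mxE; apply/eqP.
    by have := h i; rewrite negb_exists => /forallP/(_ j); rewrite negbK.
  have self : a != linv a by case: (a) => i []; rewrite /linv xpair_eqE /= andbF.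
  have [k k0 kE] := eig_pairing self.
  have /(congr1 (mulmx (eig a)^T)) := M0.
  rewrite mulmx0 mulmxA kE mul_scalar_mx => /eqP; rewrite scaler_eq0 (negPf k0).
  by [].
(* q vanishes wherever the word is trivial. At -i the denominator p vanishes while the numerator
   entry does not, so q is a nonzero polynomial, and one of the first [size q] natural numbers is
   not a root. *)
pose q := P i j - (i == j)%:R *: p.
have q0 : q != 0.
  apply: contraNneq Eij => q0; have : q.[- 'i] = 0 by rewrite q0 horner0.
  have p0 : p.[- 'i] = 0.
    by rewrite -pE /= /rot_den sqrrN sqrCi subrr mulr0 mul0r.
  by rewrite /q !hornerE p0 mulr0 subr0 => h; rewrite PE mxE /horner_eval h.
pose L : seq C := [seq k%:R | k <- iota 0 (size q)].
have /allPn[_ /mapP[k _ ->] qk] : ~~ all (root q) L.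
  apply/negP => Lr; have := max_poly_roots q0 Lr.
  rewrite map_inj_uniq ?iota_uniq; last by move=> x y /eqP; rewrite eqr_nat => /eqP.
  by move=> /(_ isT); rewrite size_map size_iota ltnn.
exists k%:R; apply: contraNneq qk; rewrite mxw_rot PE rmorph_nat => /matrixP/(_ i j).
rewrite !mxE /horner_eval.
have D0 : den_prod (a :: s) k%:R != 0.
  by rewrite -(rmorph_nat toC) gt_eqF // den_prod_gt0.
rewrite pE in D0 *; move=> h; rewrite rootE /q !hornerE -h mulrC mulVKf //.
by rewrite subrr.
Qed.

Lemma SU2_trace_lt2 (h : 'M[C]_2) : is_SU2 h -> h != 1%:M ->
  \tr h \is Num.real /\ \tr h < 2.
Proof.
move=> [hu h1]; have [P [e [Pu hE e1]]] := unitary_diag hu.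
have ee : e 0 0 * e 0 1 = 1.
  rewrite -h1 hE !det_mulmx mulrAC -det_mulmx unitarymxPV // det1 mul1r det_diag.
  by rewrite !big_ord_recl big_ord0 mulr1; congr (_ * e _ _); apply: val_inj.
have e00 : e 0 0 != 0 by rewrite -normr_eq0 e1 oner_neq0.
have e01 : e 0 1 = conjC (e 0 0).
  by apply: (mulfI e00); rewrite ee norm1_conjV.
have -> : \tr h = e 0 0 + conjC (e 0 0).
  by rewrite hE mxtrace_mulC mulmxA (unitarymxP Pu) mul1mx mxtrace_diag big_ord2E e01.
have -> : e 0 0 + conjC (e 0 0) = 2 * 'Re (e 0 0).
  by rewrite ReE mulrC divfK // pnatr_eq0.
move=> hn1; split; first by rewrite rpredM ?Creal_Re // realn.
rewrite -[X in _ < X]mulr1 ltr_pM2l ?ltr0n //.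
have := leif_Re_Creal (e 0 0); rewrite e1 => /lt_leif ->.
apply: contra hn1 => e0; have e00E : e 0 0 = 1 by rewrite -(e1 0) ger0_norm.
have eE : diag_mx e = 1%:M.
  rewrite -diag_const_mx; congr diag_mx; apply/rowP; elim/ord2P; rewrite mxE //.
  by rewrite e01 e00E conjC1.
by rewrite hE eE mulmx1 unitarymxPV.
Qed.

Lemma Re_horner (p : {poly C}) : exists q : {poly R}, forall x : R, q.[x] = complex.Re p.[toC x].
Proof.
exists (\poly_(i < size p) complex.Re p`_i) => x.
rewrite horner_poly horner_coef.
have ReD : {morph (@complex.Re R) : u v / u + v} by move=> [? ?] [? ?].
rewrite (big_morph _ ReD (erefl : complex.Re (0 : C) = 0)); apply: eq_bigr => i _.
by rewrite -rmorphXn; case: (p`_i) => u v /=; rewrite mulr0 subr0.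
Qed.

(* The trace of the word at the rotations by 2 arctan x is a continuous function
   of x, equal to 2 at x = 0 and not constant. *)
Lemma reduced_word_traces s : sorted (fun a b => b != linv a) s -> s != [::] ->
  exists2 e : R, e < 2 & forall t, e <= t <= 2 ->
  exists2 g : 'I_d -> 'M[C]_2, forall i, is_SU2 (g i) & \tr (mxw g s) = toC t.
Proof.
case: s => [//|a s] ps _; have [x0 x0E] := exists_nontrivial_rotation ps.
have wS (x : R) : is_SU2 (mxw (fun i => rot i (toC x)) (a :: s)).
  by apply: is_SU2_mxw => i; exact: rot_SU2.
pose T x := \tr (mxw (fun i => rot i (toC x)) (a :: s)).
have [Tr Tlt] := SU2_trace_lt2 (wS x0) x0E.
have Treal x : T x \is Num.real.
  have [e|n1] := eqVneq (mxw (fun i => rot i (toC x)) (a :: s)) 1%:M.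
    by rewrite /T e mxtrace1 realn.
  by have [] := SU2_trace_lt2 (wS x) n1.
have TC x : T x = toC (complex.Re (T x)) := esym (RRe_real (Treal x)).
have T0 : T 0 = 2.
  have E0 w : num_prod w 0 = (den_prod w 0)%:M.
    elim: w => [//|b w IH] /=; rewrite IH /rot_num /rot_den expr2 !mulr0 subr0 addr0.
    by rewrite scale0r addr0 -scalar_mxM.
  rewrite /T mxw_rot rmorph0 E0 scale_scalar_mx mulVf ?mxtrace1 //.
  by rewrite -(rmorph0 toC) gt_eqF // den_prod_gt0.
have [P PE] := num_prod_poly (a :: s); have [p pE] := den_prod_poly (a :: s).
have [u uE] := Re_horner (\tr P); have [v vE] := Re_horner p.
have v0 x : 0 < v.[x].
  by have := den_prod_gt0 (a :: s) x; rewrite pE ltcE vE => /andP[_].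
have pC x : p.[toC x] = toC v.[x].
  by rewrite vE RRe_real // -pE gtr0_real // den_prod_gt0.
have TE x : complex.Re (T x) = u.[x] / v.[x].
  rewrite /T mxw_rot PE mxtraceZ trace_map_mx /horner_eval pE pC uE -fmorphV /=.
  have ReM (r : R) (z : C) : complex.Re (toC r * z) = r * complex.Re z.
    by case: z => y z /=; rewrite mul0r subr0.
  by rewrite ReM mulrC.
exists (complex.Re (T x0)).
  by move: Tlt; rewrite -/(T x0) TC -[X in _ < X](rmorph_nat toC) ltcR.
move=> t /andP[t1 t2].
(* The trace is u / v with v positive on the reals, so it takes the value t at the roots of u - t
   v. *)
suff [x qx] : exists x, root (u - t *: v) x.
  exists (fun i => rot i (toC x)) => [i|]; first exact: rot_SU2.
  rewrite -/(T x) TC TE; congr (toC _); move: qx.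
  rewrite rootE !hornerE subr_eq0 => /eqP ->.
  by rewrite mulfK // gt_eqF.
have uT x : u.[x] = complex.Re (T x) * v.[x] by rewrite TE divfK // gt_eqF.
have q0 : 0 <= (u - t *: v).[0].
  have -> : (u - t *: v).[0] = (2 - t) * v.[0].
    rewrite hornerD hornerN hornerZ uT T0 -(rmorph_nat toC) /=; ring.
  by rewrite mulr_ge0 ?subr_ge0 // ltW.
have q1 : (u - t *: v).[x0] <= 0.
  by rewrite hornerD hornerN hornerZ uT -mulrBl pmulr_lle0 // subr_le0.
have [x0n|x0p] := lerP x0 0.
  have [||x _ qx] := @poly_ivt R (u - t *: v) x0 0; rewrite ?q0 ?q1 //; by exists x.
have [||x _ qx] := @poly_ivt R (- (u - t *: v)) 0 x0; first exact: ltW.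
  by rewrite !hornerN oppr_le0 oppr_ge0 q0 q1.
by exists x; rewrite -rootN.
Qed.

End FreeWords.

(** * Roots of unity with traces close to 2 *)

Section Angle.
Variable R : realType.
Local Notation C := (R[i]).
Local Notation toC := (real_complex R).

Definition cis (x : R) : C := Complex (cos x) (sin x).

Lemma cisX x n : cis x ^+ n = cis (x *+ n).
Proof.
elim: n => [|n IH]; first by rewrite mulr0n /cis cos0 sin0.
by rewrite exprS IH mulrS /cis cosD sinD /=; congr Complex; rewrite addrC.
Qed.

(** The n-th power is -1, and the k-th power has positive imaginary part for 0 < k < n; together
    these exclude every order below 2n. *)
Lemma cis_primitive n : (0 < n)%N -> (2 * n).-primitive_root (cis (pi / n%:R)).
Proof.
move=> n0; have n0R : (0 : R) < n%:R by rewrite ltr0n.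
have half : cis (pi / n%:R) ^+ n = -1.
  rewrite cisX -(mulr_natr (pi / _)) divfK ?gt_eqF // /cis cospi sinpi.
  by apply/eqP; rewrite eq_complex /= oppr0 !eqxx.
have full : cis (pi / n%:R) ^+ (2 * n) = 1 by rewrite mulnC exprM half sqrrN expr1n.
have sinp k : (0 < k < n)%N -> 0 < sin (pi / n%:R *+ k : R).
  move=> /andP[k0 kn]; apply: sin_gt0_pi.
  rewrite pmulrn_lgt0 // divr_gt0 ?pi_gt0 //= -(mulr_natr (pi / _)) mulrAC ltr_pdivrMr //.
  by rewrite ltr_pM2l ?pi_gt0 // ltr_nat.
have n2 : (0 < 2 * n)%N by rewrite muln_gt0.
have [m mp mdv] := prim_order_exists n2 full.
suff -> : (2 * n = m)%N by [].
have m0 := prim_order_gt0 mp; have mle : (m <= 2 * n)%N by apply: dvdn_leq => //; lia.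
have m1 := prim_expr_order mp.
apply/eqP; rewrite eqn_leq mle andbT leqNgt; apply/negP => mlt.
case: (ltngtP m n) => [mn|nm|mn].
- have := sinp m; rewrite m0 mn => /(_ isT).
  by move: m1; rewrite cisX => /(congr1 (@complex.Im R)) /= ->; rewrite ltxx.
- have := sinp (m - n)%N; rewrite subn_gt0 nm ltn_subLR ?(ltnW nm) //.
  have -> : (m < n + n)%N by lia.
  move=> /(_ isT); have : cis (pi / n%:R) ^+ (m - n) = -1.
    have : cis (pi / n%:R) ^+ (m - n + n) = 1 by rewrite subnK // ltnW.
    by rewrite exprD half mulrN1 => /eqP; rewrite eqr_oppLR => /eqP.
  by rewrite cisX => /(congr1 (@complex.Im R)) /= ->; rewrite oppr0 ltxx.
- by move/eqP: m1; rewrite mn half eq_sym -addr_eq0 -[1 + 1]/(2%:R) pnatr_eq0.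
Qed.

Lemma cis_conjD (x : R) : cis x + conjC (cis x) = toC (2 * cos x).
Proof.
have -> : conjC (cis x) = Complex (cos x) (- sin x) by [].
by apply/eqP; rewrite eq_complex /= subrr eqxx andbT; apply/eqP; ring.
Qed.

Lemma cos_small (e : R) : e < 2 -> exists H, forall n, (H <= n)%N -> e <= 2 * cos (pi / n.+1%:R).
Proof.
move=> e2; have := @continuous_cos R 0.
move=> /cvgrPdist_lt /(_ ((2 - e) / 2)) []; first by lra.
move=> d /= d0 dP; exists (Num.bound (pi / d)) => n nH.
have := dP (pi / n.+1%:R); rewrite /ball_ /= cos0.
have pn : pi / n.+1%:R < d.
  rewrite ltr_pdivrMr ?ltr0n // mulrC -ltr_pdivrMr //.
  have := archi_boundP (ltW (divr_gt0 (pi_gt0 R) d0)).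
  by move=> /lt_le_trans; apply; rewrite ler_nat leqW.
have p0 : 0 < pi / n.+1%:R :> R by rewrite divr_gt0 ?pi_gt0 ?ltr0n.
rewrite sub0r normrN gtr0_norm // => /(_ pn).
by rewrite ltr_norml => /andP[_]; lra.
Qed.

Lemma reduced_word_root_traces d (s : seq ('I_d * bool)) :
  sorted (fun a b => b != linv a) s -> s != [::] ->
  exists H, forall n, (H <= n)%N -> SU2_trace s (cis (pi / n.+1%:R)).
Proof.
move=> ss s0; have [e e2 eP] := reduced_word_traces R ss s0.
have [H HP] := cos_small e2; exists H => n /HP en.
have [|g gS gt] := eP (2 * cos (pi / n.+1%:R)).
  by rewrite en /= -[X in _ <= X]mulr1 ler_pM2l // cos_le1.
by exists g => //; rewrite gt cis_conjD.
Qed.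

End Angle.

(** * Spin groups *)

(* Locked, since unification would otherwise unfold [clifford_mul] to a sum. *)
Definition cmul (R : realType) (n : nat) (x y : clifford R n) : clifford R n :=
  locked (@clifford_mul R n x y).

Lemma cmulE (R : realType) n (x y : clifford R n) : cmul x y = clifford_mul x y.
Proof. by rewrite /cmul -lock. Qed.

Local Notation "x ** y" := (cmul x y) (at level 40, left associativity).

Section CliffordAlgebra.
Variables (R : realType) (n : nat).
Local Notation Cl := (clifford R n).
Local Notation one := (clifford_one R n).
Local Notation blade := (@blade R n).
Implicit Types (x y z : Cl) (A B D : {set 'I_n}).

Definition sg (i j : 'I_n) : R := if (j <= i)%N then -1 else 1.

Lemma sg_sq i j : sg i j * sg i j = 1.
Proof. by rewrite /sg; case: ifP; rewrite ?mulrNN mulr1. Qed.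

(** Since each [sg i j] squares to 1, this product formula makes the sign multiplicative in each
    argument for the symmetric difference, which is what associativity requires. *)
Lemma blade_signE A B : blade_sign R A B = \prod_(i in A) \prod_(j in B) sg i j.
Proof.
rewrite /blade_sign -prodr_const pair_big_dep /= big_mkcond [RHS]big_mkcond.
apply: eq_bigr => -[i j] _ /=; rewrite inE /= /sg.
by case: (i \in A); case: (j \in B); case: (j <= i)%N.
Qed.

Lemma prod_symdiff A B (f : 'I_n -> R) : (forall i, f i * f i = 1) ->
  \prod_(i in symdiff A B) f i = (\prod_(i in A) f i) * \prod_(i in B) f i.
Proof.
move=> ff; rewrite big_mkcond [X in _ = X * _]big_mkcond [X in _ = _ * X]big_mkcond.
rewrite -big_split; apply: eq_bigr => i _ /=; rewrite !inE.
by case: (i \in A); case: (i \in B); rewrite /= ?mulr1 ?mul1r ?ff.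
Qed.

Lemma prod_sq1 A (f : 'I_n -> R) : (forall i, f i * f i = 1) ->
  (\prod_(i in A) f i) * (\prod_(i in A) f i) = 1.
Proof. by move=> ff; rewrite -big_split big1 // => i _; exact: ff. Qed.

Lemma blade_sign_symdiffl A B D :
  blade_sign R (symdiff A B) D = blade_sign R A D * blade_sign R B D.
Proof.
rewrite !blade_signE prod_symdiff // => i.
by apply: prod_sq1 => j; exact: sg_sq.
Qed.

Lemma blade_sign_symdiffr A B D :
  blade_sign R A (symdiff B D) = blade_sign R A B * blade_sign R A D.
Proof.
rewrite !blade_signE -big_split; apply: eq_bigr => i _ /=.
by apply: prod_symdiff => j; exact: sg_sq.
Qed.

Lemma symdiffA A B D : symdiff A (symdiff B D) = symdiff (symdiff A B) D.
Proof. by apply/setP => i; rewrite !inE; do 3!case: (_ \in _). Qed.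

Lemma symdiffC A B : symdiff A B = symdiff B A.
Proof. by apply/setP => i; rewrite !inE; do 2!case: (_ \in _). Qed.

Lemma symdiff0 A : symdiff A finset.set0 = A.
Proof. by apply/setP => i; rewrite !inE; case: (_ \in _). Qed.

Lemma symdiffAA A : symdiff A A = finset.set0.
Proof. by apply/setP => i; rewrite !inE; case: (_ \in _). Qed.

Lemma symdiffK A : involutive (symdiff A).
Proof. by move=> B; rewrite symdiffA symdiffAA symdiffC symdiff0. Qed.

Lemma coef_blade A B : coef (blade A) B = (A == B)%:R.
Proof. by rewrite /coef mxE eqxx /= eq_sym (inj_eq enum_rank_inj). Qed.

Lemma coefD x y A : coef (x + y) A = coef x A + coef y A.
Proof. by rewrite /coef mxE. Qed.

Lemma coefZ a x A : coef (a *: x) A = a * coef x A.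
Proof. by rewrite /coef mxE. Qed.

Lemma coef_sum I (r : seq I) P (f : I -> Cl) A :
  coef (\sum_(i <- r | P i) f i) A = \sum_(i <- r | P i) coef (f i) A.
Proof. by rewrite /coef summxE. Qed.

Lemma coefP x y : (forall A, coef x A = coef y A) -> x = y.
Proof.
by move=> h; apply/rowP => i; have := h (enum_val i); rewrite /coef enum_valK.
Qed.

Lemma clifford_decomp x : x = \sum_A coef x A *: blade A.
Proof.
apply: coefP => B; rewrite coef_sum (bigD1 B) //= coefZ coef_blade eqxx mulr1.
by rewrite big1 ?addr0 // => A /negPf AB; rewrite coefZ coef_blade AB mulr0.
Qed.

Lemma clifford_mulDl x y z : (x + y) ** z = x ** z + y ** z.
Proof.
rewrite !cmulE -big_split; apply: eq_bigr => A _; rewrite -big_split; apply: eq_bigr => B _ /=.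
by rewrite -scalerDl coefD !mulrDl.
Qed.

Lemma clifford_mulDr x y z : x ** (y + z) = x ** y + x ** z.
Proof.
rewrite !cmulE -big_split; apply: eq_bigr => A _; rewrite -big_split; apply: eq_bigr => B _ /=.
by rewrite -scalerDl coefD mulrDr mulrDl.
Qed.

Lemma clifford_mulZl a x y : (a *: x) ** y = a *: (x ** y).
Proof.
rewrite !cmulE scaler_sumr; apply: eq_bigr => A _; rewrite scaler_sumr; apply: eq_bigr => B _.
by rewrite coefZ scalerA !mulrA.
Qed.

Lemma clifford_mulZr a x y : x ** (a *: y) = a *: (x ** y).
Proof.
rewrite !cmulE scaler_sumr; apply: eq_bigr => A _; rewrite scaler_sumr; apply: eq_bigr => B _.
by rewrite coefZ scalerA !mulrA [a * _]mulrC.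
Qed.

Lemma clifford_mulNl x y : (- x) ** y = - (x ** y).
Proof. by rewrite -scaleN1r clifford_mulZl scaleN1r. Qed.

Lemma clifford_mulNr x y : x ** (- y) = - (x ** y).
Proof. by rewrite -scaleN1r clifford_mulZr scaleN1r. Qed.

Lemma clifford_mul0l x : 0 ** x = 0.
Proof. by rewrite -[X in X ** _](scale0r x) clifford_mulZl scale0r. Qed.

Lemma clifford_mul0r x : x ** 0 = 0.
Proof. by rewrite -[X in _ ** X](scale0r x) clifford_mulZr scale0r. Qed.

Lemma clifford_mul_suml I (r : seq I) P (f : I -> Cl) x :
  (\sum_(i <- r | P i) f i) ** x = \sum_(i <- r | P i) f i ** x.
Proof.
by apply: (big_morph (fun y => y ** x)); [move=> y z; exact: clifford_mulDl|exact: clifford_mul0l].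
Qed.

Lemma clifford_mul_sumr I (r : seq I) P (f : I -> Cl) x :
  x ** (\sum_(i <- r | P i) f i) = \sum_(i <- r | P i) x ** f i.
Proof.
by apply: (big_morph (fun y => x ** y)); [move=> y z; exact: clifford_mulDr|exact: clifford_mul0r].
Qed.

Lemma blade_mul A B : blade A ** blade B = blade_sign R A B *: blade (symdiff A B).
Proof.
rewrite cmulE /clifford_mul (bigD1 A) //= [X in _ + X]big1 ?addr0 => [|D /negPf DA]; last first.
  by rewrite big1 // => E _; rewrite coef_blade eq_sym DA !mul0r scale0r.
rewrite (bigD1 B) //= [X in _ + X]big1 ?addr0 => [|E /negPf EB]; last first.
  by rewrite [coef (blade B) E]coef_blade eq_sym EB mulr0 mul0r scale0r.
by rewrite !coef_blade !eqxx !mul1r.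
Qed.

Lemma coef_mul x y D : coef (x ** y) D = \sum_A \sum_B
  coef x A * coef y B * blade_sign R A B * (symdiff A B == D)%:R.
Proof.
rewrite cmulE coef_sum; apply: eq_bigr => A _; rewrite coef_sum; apply: eq_bigr => B _.
by rewrite coefZ coef_blade.
Qed.

Lemma clifford_mulA x y z : x ** (y ** z) = x ** y ** z.
Proof.
rewrite [x]clifford_decomp !clifford_mul_suml; apply: eq_bigr => A _.
rewrite !clifford_mulZl; congr (_ *: _).
rewrite [y]clifford_decomp !(clifford_mul_suml, clifford_mul_sumr); apply: eq_bigr => B _.
rewrite !(clifford_mulZl, clifford_mulZr); congr (_ *: _).
rewrite [z]clifford_decomp !(clifford_mul_suml, clifford_mul_sumr); apply: eq_bigr => D _.
rewrite !(clifford_mulZl, clifford_mulZr); congr (_ *: _).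
rewrite !blade_mul !(clifford_mulZl, clifford_mulZr) !blade_mul !scalerA symdiffA.
rewrite blade_sign_symdiffl blade_sign_symdiffr; congr (_ *: _); ring.
Qed.

Lemma clifford_mul1l x : one ** x = x.
Proof.
rewrite [x]clifford_decomp clifford_mul_sumr; apply: eq_bigr => A _.
by rewrite clifford_mulZr blade_mul blade_signE big_set0 scale1r symdiffC symdiff0.
Qed.

Lemma clifford_mul1r x : x ** one = x.
Proof.
rewrite [x]clifford_decomp clifford_mul_suml; apply: eq_bigr => A _.
rewrite clifford_mulZl blade_mul blade_signE big1 ?scale1r ?symdiff0 // => i _.
by rewrite big_set0.
Qed.

Local Notation vec := (@clifford_vec R n).
Definition dot (u v : 'rV[R]_n) : R := \sum_i u 0 i * v 0 i.

Lemma vecD u v : vec (u + v) = vec u + vec v.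
Proof. by rewrite -big_split; apply: eq_bigr => i _; rewrite mxE scalerDl. Qed.

Lemma vecZ a v : vec (a *: v) = a *: vec v.
Proof. by rewrite scaler_sumr; apply: eq_bigr => i _; rewrite mxE scalerA. Qed.

Lemma blade1_anticommute (i j : 'I_n) :
  blade [set i]%SET ** blade [set j]%SET + blade [set j]%SET ** blade [set i]%SET =
  (- 2 * (i == j)%:R) *: one.
Proof.
rewrite !blade_mul !blade_signE !big_set1 (symdiffC [set j]%SET) -scalerDl /sg.
case: (eqVneq i j) => [->|ij]; first by rewrite leqnn symdiffAA mulr1; congr (_ *: _); ring.
rewrite mulr0 scale0r; case: (ltngtP i j) => [||/val_inj e]; last by rewrite e eqxx in ij.
  by rewrite subrr scale0r.
by rewrite addNr scale0r.
Qed.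

Lemma vec_anticommute u v : vec u ** vec v + vec v ** vec u = (- 2 * dot u v) *: one.
Proof.
have -> : vec u ** vec v = \sum_i \sum_j (u 0 i * v 0 j) *: (blade [set i]%SET ** blade [set j]%SET).
  rewrite clifford_mul_suml; apply: eq_bigr => i _; rewrite clifford_mul_sumr.
  by apply: eq_bigr => j _; rewrite clifford_mulZl clifford_mulZr scalerA.
have -> : vec v ** vec u = \sum_i \sum_j (u 0 i * v 0 j) *: (blade [set j]%SET ** blade [set i]%SET).
  rewrite clifford_mul_sumr; apply: eq_bigr => i _; rewrite clifford_mul_suml.
  by apply: eq_bigr => j _; rewrite clifford_mulZl clifford_mulZr scalerA mulrC.
rewrite -big_split /dot mulr_sumr scaler_suml; apply: eq_bigr => i _ /=.
rewrite -big_split /= (bigD1 i) //= big1 ?addr0 => [|j /negPf ji].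
  by rewrite -scalerDr blade1_anticommute eqxx mulr1 scalerA; congr (_ *: _); ring.
by rewrite -scalerDr blade1_anticommute eq_sym ji mulr0 scale0r scaler0.
Qed.

Lemma vec_sq v : vec v ** vec v = (- dot v v) *: one.
Proof.
have /eqP := vec_anticommute v v; rewrite -mulr2n -scaler_nat -subr_eq0 mulNr -mulrN -scalerA -scalerBr.
by rewrite scaler_eq0 pnatr_eq0 /= subr_eq0 => /eqP.
Qed.

Definition clifford_parity (b : bool) x : Prop := forall A, odd #|A| != b -> coef x A = 0.

Lemma odd_symdiff A B : odd #|symdiff A B| = odd #|A| (+) odd #|B|.
Proof.
rewrite /symdiff -(cardsID B A) -(cardsID A B) (finset.setIC B) cardsU.
have -> : ((A :\: B) :&: (B :\: A) = finset.set0)%SET.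
  by apply/setP => i; rewrite !inE; do 2!case: (_ \in _).
by rewrite cards0 subn0 !oddD; do 3!case: (odd _).
Qed.

Lemma clifford_parity_mul b c x y : clifford_parity b x -> clifford_parity c y ->
  clifford_parity (b (+) c) (x ** y).
Proof.
move=> xb yc D Dbc; rewrite coef_mul big1 // => A _; rewrite big1 // => B _.
case: eqP => [e|_]; last by rewrite mulr0.
have [Ab|Ab] := eqVneq (odd #|A|) b; last by rewrite xb // !mul0r.
have [Bc|Bc] := eqVneq (odd #|B|) c; last by rewrite [coef y B]yc // mulr0 !mul0r.
by rewrite -e odd_symdiff Ab Bc eqxx in Dbc.
Qed.

Lemma clifford_parity_vec v : clifford_parity true (vec v).
Proof.
move=> A Ab; rewrite coef_sum big1 // => i _; rewrite coefZ coef_blade.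
by case: eqP => [e|_]; [rewrite -e cards1 in Ab|rewrite mulr0].
Qed.

Lemma clifford_parity_one : clifford_parity false one.
Proof.
move=> A Ab; rewrite coef_blade.
by case: eqP => [e|//]; rewrite -e cards0 in Ab.
Qed.

Lemma coef_blade_mul A x B : coef (blade A ** x) (symdiff A B) = blade_sign R A B * coef x B.
Proof.
rewrite [x]clifford_decomp clifford_mul_sumr !coef_sum mulr_sumr.
apply: eq_bigr => D _; rewrite clifford_mulZr blade_mul !coefZ !coef_blade.
rewrite (inj_eq (can_inj (symdiffK A))); case: eqP => [->|_]; last by rewrite !mulr0.
by rewrite !mulr1 mulrC.
Qed.

Lemma coef_mul_blade A x B : coef (x ** blade A) (symdiff A B) = blade_sign R B A * coef x B.
Proof.
rewrite [x]clifford_decomp clifford_mul_suml !coef_sum mulr_sumr.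
apply: eq_bigr => D _; rewrite clifford_mulZl blade_mul !coefZ !coef_blade symdiffC.
rewrite (inj_eq (can_inj (symdiffK A))); case: eqP => [->|_]; last by rewrite !mulr0.
by rewrite !mulr1 mulrC.
Qed.

Lemma blade_sign_flip (i : 'I_n) A : i \in A ->
  blade_sign R [set i]%SET A * blade_sign R A [set i]%SET = (-1) ^+ #|A|.-1.
Proof.
move=> iA; rewrite !blade_signE big_set1.
rewrite [X in _ * X](eq_bigr (fun j => sg j i)) => [|j _]; last by rewrite big_set1.
rewrite -big_split /= (bigD1 i) //= sg_sq mul1r.
rewrite (eq_bigr (fun=> -1)) => [|j /andP[jA ji]].
  rewrite prodr_const; congr (_ ^+ _).
  rewrite (cardsD1 i A) iA /=; apply: eq_card => j; rewrite !inE andbC.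
  by [].
rewrite /sg; case: (ltngtP i j) => [||/val_inj e]; last by rewrite e eqxx in ji.
  by rewrite mul1r.
by rewrite mulr1.
Qed.

(** For i in a nonempty even set A, e_i anticommutes with e_A, so commuting with e_i kills the
    coefficient at A. *)
Lemma even_central_scalar x : clifford_parity false x ->
  (forall v, x ** vec v = vec v ** x) -> x = coef x finset.set0 *: one.
Proof.
move=> x0 xc; apply: coefP => A; rewrite coefZ coef_blade.
have [<-|] := eqVneq finset.set0 A; first by rewrite mulr1.
rewrite eq_sym mulr0 => /set0Pn[i iA].
have [Aodd|Aeven] := boolP (odd #|A|); first by rewrite x0 // Aodd.
have veci : vec (delta_mx 0 i) = blade [set i]%SET.
  rewrite /clifford_vec (bigD1 i) //= big1 ?addr0 => [|j /negPf ji].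
    by rewrite mxE !eqxx scale1r.
  by rewrite mxE ji andbF scale0r.
have := xc (delta_mx 0 i); rewrite veci => /(congr1 (fun y => coef y (symdiff [set i]%SET A))).
rewrite coef_blade_mul coef_mul_blade => /eqP; rewrite -subr_eq0 -mulrBl mulf_eq0.
move=> /orP[|/eqP //]; rewrite subr_eq0 => /eqP e.
have := blade_sign_flip iA; rewrite e.
have -> : blade_sign R [set i]%SET A * blade_sign R [set i]%SET A = 1.
  by rewrite /blade_sign -expr2 sqrr_sign.
have A0 : (0 < #|A|)%N by apply/card_gt0P; exists i.
rewrite -signr_odd; have -> : odd #|A|.-1 by lia.
by move/eqP; rewrite expr1 -addr_eq0 -[1 + 1]/(2%:R) pnatr_eq0.
Qed.

End CliffordAlgebra.

(** * Reflections and the Cartan-Dieudonne theorem *)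

Section Reflections.
Variable R : realType.

Lemma dotC n (u v : 'rV[R]_n) : dot u v = dot v u.
Proof. by apply: eq_bigr => i _; rewrite mulrC. Qed.

Lemma dotBl n (u v w : 'rV[R]_n) : dot (u - v) w = dot u w - dot v w.
Proof. by rewrite -sumrB; apply: eq_bigr => i _; rewrite !mxE mulrBl. Qed.

Lemma dotZl n a (u v : 'rV[R]_n) : dot (a *: u) v = a * dot u v.
Proof. by rewrite mulr_sumr; apply: eq_bigr => i _; rewrite !mxE mulrA. Qed.

Lemma dot_mx n (u v : 'rV[R]_n) : u *m v^T = (dot u v)%:M.
Proof.
by rewrite [LHS]mx11_scalar mxE; congr (_%:M); apply: eq_bigr => i _; rewrite mxE.
Qed.

Lemma dot_eq0 n (v : 'rV[R]_n) : (dot v v == 0) = (v == 0).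
Proof.
apply/eqP/eqP => [|->]; last by rewrite /dot big1 // => i _; rewrite mxE mul0r.
move=> /eqP; rewrite psumr_eq0 => [/allP h|i _]; last by rewrite -expr2 sqr_ge0.
apply/rowP => i; rewrite mxE; have := h i (mem_index_enum i).
by rewrite mulf_eq0 orbb => /eqP.
Qed.

Lemma dot_ge0 n (v : 'rV[R]_n) : 0 <= dot v v.
Proof. by apply: sumr_ge0 => i _; rewrite -expr2 sqr_ge0. Qed.

Lemma unit_vectorE n (v : 'rV[R]_n) : unit_vector v <-> dot v v = 1.
Proof. by rewrite /unit_vector /dot; under eq_bigr do rewrite expr2. Qed.

Definition refl n (v : 'rV[R]_n) : 'M[R]_n := 1%:M - 2 *: (v^T *m v).

Lemma mul_refl n (u v : 'rV[R]_n) : u *m refl v = u - (2 * dot u v) *: v.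
Proof.
by rewrite mulmxBr mulmx1 -scalemxAr mulmxA dot_mx mul_scalar_mx scalerA.
Qed.

Lemma refl_tr n (v : 'rV[R]_n) : (refl v)^T = refl v.
Proof. by rewrite /refl linearB linearZ /= trmx1 trmx_mul trmxK. Qed.

Lemma reflK n (v : 'rV[R]_n) : dot v v = 1 -> refl v *m refl v = 1%:M.
Proof.
move=> v1; apply/row_matrixP => i; rewrite rowE mulmxA !mul_refl rowE mulmx1.
rewrite dotBl dotZl v1 -addrA -opprD -scalerDl.
have -> : 2 * dot (delta_mx 0 i) v + 2 * (dot (delta_mx 0 i) v - 2 * dot (delta_mx 0 i) v * 1) = 0.
  by ring.
by rewrite scale0r subr0.
Qed.

(** Sylvester's identity: one block matrix is factored in two ways. *)
Lemma det_1BmulC (T : comNzRingType) m n (A : 'M[T]_(m, n)) (B : 'M[T]_(n, m)) :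
  \det (1%:M - A *m B) = \det (1%:M - B *m A).
Proof.
have <- : \det (block_mx 1%:M B A 1%:M) = \det (1%:M - A *m B).
  have -> : block_mx 1%:M B A 1%:M =
      block_mx 1%:M 0 A 1%:M *m block_mx 1%:M B 0 (1%:M - A *m B).
    by rewrite mulmx_block !mul1mx !mulmx1 !mul0mx !addr0 addrC subrK.
  by rewrite det_mulmx det_lblock det_ublock !det1 !mul1r.
have -> : block_mx 1%:M B A 1%:M =
    block_mx 1%:M B 0 1%:M *m block_mx (1%:M - B *m A) 0 A 1%:M.
  by rewrite mulmx_block !mul1mx !mulmx1 !mul0mx !add0r subrK.
by rewrite det_mulmx det_lblock det_ublock !det1 !mul1r mulr1.
Qed.

Lemma det_refl n (v : 'rV[R]_n) : dot v v = 1 -> \det (refl v) = -1.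
Proof.
move=> v1; rewrite /refl scalemxAl det_1BmulC -scalemxAr dot_mx v1.
by rewrite det_mx11 !mxE /=; ring.
Qed.

Definition unit_seq n (s : seq 'rV[R]_n) : Prop := forall v, v \in s -> unit_vector v.

Lemma unit_seq_cat n (s t : seq 'rV[R]_n) :
  unit_seq s -> unit_seq t -> unit_seq (s ++ t).
Proof. by move=> su tu v; rewrite mem_cat => /orP[/su|/tu]. Qed.

Lemma unit_seq_rev n (s : seq 'rV[R]_n) : unit_seq s -> unit_seq (rev s).
Proof. by move=> su v; rewrite mem_rev; exact: su. Qed.

Lemma unit_seq_cons n v (s : seq 'rV[R]_n) :
  unit_seq (v :: s) -> dot v v = 1 /\ unit_seq s.
Proof.
move=> su; split; first by apply/unit_vectorE/su; rewrite mem_head.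
by move=> w ws; apply: su; rewrite inE ws orbT.
Qed.

Definition reflections n (s : seq 'rV[R]_n) : 'M[R]_n :=
  foldr (fun v M => refl v *m M) 1%:M s.

Lemma reflections_cat n (s t : seq 'rV[R]_n) :
  reflections (s ++ t) = reflections s *m reflections t.
Proof. by elim: s => [|v s IH] /=; rewrite ?mul1mx // IH mulmxA. Qed.

Lemma reflections_rev n (s : seq 'rV[R]_n) : reflections (rev s) = (reflections s)^T.
Proof.
elim: s => [|v s IH]; first by rewrite /= trmx1.
by rewrite rev_cons -cats1 reflections_cat /= mulmx1 IH trmx_mul refl_tr.
Qed.

Lemma reflectionsK n (s : seq 'rV[R]_n) : unit_seq s ->
  reflections s *m (reflections s)^T = 1%:M.
Proof.
elim: s => [|v s IH] /=; first by rewrite trmx1 mulmx1.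
move=> /unit_seq_cons[v1 /IH E].
by rewrite trmx_mul refl_tr mulmxA -(mulmxA (refl v)) E mulmx1 reflK.
Qed.

Lemma det_reflections n (s : seq 'rV[R]_n) : unit_seq s ->
  \det (reflections s) = (-1) ^+ size s.
Proof.
elim: s => [|v s IH] /=; first by rewrite det1.
by move=> /unit_seq_cons[v1 /IH E]; rewrite det_mulmx det_refl // E exprS.
Qed.

Lemma exists_unit_multiple n (v : 'rV[R]_n) : v != 0 ->
  exists2 a, a != 0 & dot (a *: v) (a *: v) = 1.
Proof.
move=> v0; have d0 : 0 < dot v v by rewrite lt_def dot_eq0 v0 dot_ge0.
exists (Num.sqrt (dot v v))^-1; first by rewrite invr_eq0 sqrtr_eq0 -ltNge.
rewrite dotZl dotC dotZl mulrA -expr2 exprVn sqr_sqrtr ?ltW // mulVf //.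
by rewrite gt_eqF.
Qed.

Lemma cartan_dieudonne n (M : 'M[R]_n) : M *m M^T = 1%:M ->
  exists2 s, unit_seq s & M = reflections s.
Proof.
suff H k (A : 'M[R]_n) : A *m A^T = 1%:M ->
    (forall i : 'I_n, (i < n - k)%N -> row i A = delta_mx 0 i) ->
    exists2 s, unit_seq s & A = reflections s.
  by move=> MM; apply: (H n) => // i; rewrite subnn.
elim: k A => [|k IH] A AA Ak.
  exists [::] => //; apply/row_matrixP => i.
  by rewrite Ak ?subn0 // rowE mulmx1.
have [nk|kn] := leqP n k.
  by apply: IH => // i; have -> : (n - k = 0)%N by lia.
have jn : (n - k.+1 < n)%N by lia.
pose j := Ordinal jn; pose w := row j A.
have rowdot i i' : dot (row i A) (row i' A) = (i == i')%:R.
  have /matrixP/(_ i i') := AA; rewrite !mxE => <-.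
  by apply: eq_bigr => l _; rewrite !mxE.
have [wj|wj] := eqVneq w (delta_mx 0 j).
  apply: IH => // i ik; have [->|ij] := eqVneq i j; first by rewrite -wj.
  by apply: Ak; move: ij; rewrite -val_eqE /=; lia.
(* The reflection along w - delta_j exchanges the unit vectors w and delta_j. It fixes the earlier
   rows, which are already standard and orthogonal to both. *)
have [a a0 a1] : exists2 a, a != 0 & dot (a *: (w - delta_mx 0 j)) (a *: (w - delta_mx 0 j)) = 1.
  by apply: exists_unit_multiple; rewrite subr_eq0.
set v := a *: _ in a1.
have dd : dot (delta_mx 0 j) (delta_mx 0 j) = 1 :> R.
  rewrite /dot (bigD1 j) //= big1 ?addr0 => [|l /negPf lj]; first by rewrite !mxE !eqxx mulr1.
  by rewrite mxE lj andbF mul0r.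
have ww : dot w w = 1 by rewrite rowdot eqxx.
have [s su sE] : exists2 s, unit_seq s & A *m refl v = reflections s.
  apply: IH.
    by rewrite trmx_mul refl_tr mulmxA -(mulmxA A) reflK // mulmx1.
  move=> i ik; rewrite row_mul mul_refl.
  have [->|ij] := eqVneq i j.
    have e : 2 * dot w v * a = 1.
      have wv : dot w v = a * (1 - dot w (delta_mx 0 j)).
        by rewrite dotC dotZl dotBl ww [dot (delta_mx _ _) w]dotC.
      have nn : dot (w - delta_mx 0 j) (w - delta_mx 0 j) = 2 - 2 * dot w (delta_mx 0 j).
        rewrite dotBl ![dot _ (w - _)]dotC !dotBl ww dd [dot (delta_mx _ _) w]dotC.
        by ring.
      apply: etrans a1; rewrite wv /v dotZl [dot _ (a *: _)]dotC dotZl nn.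
      by ring.
    by rewrite -/w /v scalerA e scale1r opprB addrC subrK.
  have il : (i < n - k.+1)%N by move: ij; rewrite -val_eqE /=; lia.
  have -> : dot (row i A) v = 0.
    rewrite dotC dotZl dotBl rowdot (Ak i il) (negPf (_ : j != i)) 1?eq_sym //.
    have -> : dot (delta_mx 0 j) (delta_mx 0 i) = 0 :> R.
      rewrite /dot big1 // => l _; rewrite !mxE /=; case: (eqVneq l j) => [->|]; last by rewrite mul0r.
      by rewrite eq_sym (negPf ij) mulr0.
    by rewrite subr0 mulr0.
  by rewrite mulr0 scale0r subr0 Ak.
exists (s ++ [:: v]).
  by apply: unit_seq_cat => // u; rewrite inE => /eqP ->; apply/unit_vectorE.
by rewrite reflections_cat -sE /= mulmx1 -mulmxA reflK // mulmx1.
Qed.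

End Reflections.

(** * Lists of unit vectors and the kernel of Spin(n) over SO(n) *)

Section SpinLists.
Variables (R : realType) (n : nat).
Local Notation vec := (@clifford_vec R n).
Local Notation one := (clifford_one R n).
Implicit Types (u v : 'rV[R]_n) (s t : seq 'rV[R]_n) (x y : clifford R n).

Definition cl s : clifford R n :=
  foldr (fun v y => clifford_mul (clifford_vec v) y) one s.

Lemma cl_cons v s : cl (v :: s) = vec v ** cl s.
Proof. by rewrite cmulE. Qed.

Lemma cl_cat s t : cl (s ++ t) = cl s ** cl t.
Proof.
elim: s => [|v s IH]; first by rewrite /= clifford_mul1l.
by rewrite cat_cons !cl_cons IH clifford_mulA.
Qed.

Lemma vec_unit_sq v : dot v v = 1 -> vec v ** vec v = - one.
Proof. by move=> v1; rewrite vec_sq v1 scaleN1r. Qed.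

Lemma vec_refl u v : dot v v = 1 -> vec v ** vec u = - (vec (u *m refl v) ** vec v).
Proof.
move=> v1; have -> : vec v ** vec u = (- 2 * dot u v) *: one - vec u ** vec v.
  by rewrite -vec_anticommute addrC addKr.
rewrite mul_refl -scaleNr vecD vecZ clifford_mulDl clifford_mulZl vec_unit_sq //.
by rewrite scalerN scaleNr opprK [RHS]opprD [RHS]addrC mulNr scaleNr.
Qed.

(** The covering of the orthogonal group: up to sign, conjugation by the Clifford product of s acts
    on vectors as the product of the reflections. *)
Lemma cl_vec s u : unit_seq s ->
  cl s ** vec u = (-1) ^+ size s *: (vec (u *m (reflections s)^T) ** cl s).
Proof.
elim: s => [|v s IH] su; first by rewrite expr0 scale1r trmx1 mulmx1 clifford_mul1l clifford_mul1r.
have [v1 /IH E] := unit_seq_cons su.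
rewrite cl_cons -clifford_mulA E clifford_mulZr clifford_mulA vec_refl // /=.
rewrite -(scaleN1r (_ ** vec v)) clifford_mulZl scalerA -clifford_mulA -exprSr.
by rewrite trmx_mul refl_tr mulmxA.
Qed.

Lemma cl_revK s : unit_seq s -> cl (rev s) ** cl s = (-1) ^+ size s *: one.
Proof.
elim: s => [|v s IH] su; first by rewrite expr0 scale1r clifford_mul1l.
have [v1 /IH E] := unit_seq_cons su.
rewrite rev_cons -cats1 cl_cat !cl_cons clifford_mul1r -clifford_mulA (clifford_mulA (vec v)).
rewrite vec_unit_sq // -(scaleN1r one) clifford_mulZl clifford_mul1l clifford_mulZr E.
by rewrite scalerA -exprS.
Qed.

Lemma clifford_parity_cl s : clifford_parity (odd (size s)) (cl s).
Proof.
elim: s => [|v s IH]; first exact: clifford_parity_one.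
by rewrite cl_cons [odd _]/= -addTb; apply: clifford_parity_mul => //; exact: clifford_parity_vec.
Qed.

(** Left multiplication acting on row vectors, hence order reversing. Its determinant controls the
    scalars in the spin group, and its transpose later provides a faithful matrix representation. *)
Definition lmx x : 'M[R]_#|{set 'I_n}| :=
  \matrix_(i, j) (x ** blade R (enum_val i) : 'rV_ _) 0 j.

Lemma lmxE x y : (y : 'rV_ _) *m lmx x = (x ** y : 'rV_ _).
Proof.
rewrite {2}[y]clifford_decomp clifford_mul_sumr; apply/rowP => j; rewrite mxE summxE.
rewrite (reindex (@enum_rank {set fintype.ordinal n})) /=; last exact/onW_bij/enum_rank_bij.
apply: eq_bigr => A _.
by rewrite clifford_mulZr !mxE enum_rankK.
Qed.

Lemma lmxM x y : lmx (x ** y) = lmx y *m lmx x.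
Proof.
apply/row_matrixP => i; rewrite !rowE mulmxA (lmxE _ (delta_mx 0 i)) (lmxE y (delta_mx 0 i)).
by rewrite lmxE clifford_mulA.
Qed.

Lemma lmxZ1 a : lmx (a *: one) = a%:M.
Proof.
apply/row_matrixP => i; rewrite !rowE (lmxE _ (delta_mx 0 i)) clifford_mulZl clifford_mul1l.
by rewrite mul_mx_scalar.
Qed.

Lemma det_lmx_cl s : unit_seq s -> \det (lmx (cl s)) ^+ 4 = 1.
Proof.
elim: s => [|v s IH] su; first by rewrite -[cl _](scale1r one) lmxZ1 det1 expr1n.
have [v1 /IH E] := unit_seq_cons su.
rewrite cl_cons lmxM det_mulmx exprMn E mul1r.
have : \det (lmx (vec v)) ^+ 2 = (-1) ^+ #|{set 'I_n}|.
  by rewrite expr2 -det_mulmx -lmxM vec_unit_sq // -scaleN1r lmxZ1 det_scalar.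
by rewrite (exprM _ 2 2) => ->; rewrite sqrr_sign.
Qed.

(** An even product acting trivially on vectors commutes with all of them, so it is a real scalar;
    the determinant of left multiplication makes that scalar a root of unity. *)
Lemma cl_kernel s : unit_seq s -> ~~ odd (size s) -> reflections s = 1%:M ->
  cl s = one \/ cl s = - one.
Proof.
move=> su s2 s1.
have E : cl s = coef (cl s) finset.set0 *: one.
  apply: even_central_scalar; first by have := @clifford_parity_cl s; rewrite (negPf s2).
  by move=> v; rewrite cl_vec // -signr_odd (negPf s2) scale1r s1 trmx1 mulmx1.
have := det_lmx_cl su; rewrite E lmxZ1 det_scalar -exprM.
set a := coef _ _ in E *; set m := (_ * 4)%N => am.
have m0 : (0 < m)%N by rewrite muln_gt0 andbT; apply/card_gt0P; exists finset.set0.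
have : `|a| = 1 by apply/eqP; rewrite -(@pexpr_eq1 _ _ m) // -normrX am normr1.
move=> /eqP; rewrite eqr_norml ler01 andbT => /orP[] /eqP aE; [left|right].
  by rewrite aE scale1r.
by rewrite aE scaleN1r.
Qed.

Lemma cl_eq_up_to_sign s t : unit_seq s -> unit_seq t ->
  ~~ odd (size s) -> ~~ odd (size t) -> reflections s = reflections t ->
  cl s = cl t \/ cl s = - cl t.
Proof.
move=> su tu s2 t2 st.
have E : cl (s ++ rev t) ** cl t = cl s.
  by rewrite cl_cat -clifford_mulA cl_revK // -signr_odd (negPf t2) scale1r clifford_mul1r.
have [||||] := @cl_kernel (s ++ rev t).
- by apply: unit_seq_cat => //; exact: unit_seq_rev.
- by rewrite size_cat size_rev oddD (negPf s2) (negPf t2).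
- by rewrite reflections_cat reflections_rev st reflectionsK.
- by rewrite -E => ->; left; rewrite clifford_mul1l.
- by rewrite -E => ->; right; rewrite -scaleN1r clifford_mulZl clifford_mul1l scaleN1r.
Qed.

End SpinLists.

(** * Lifting word values to the spin groups *)

Section SpinWords.
Variables (R : realType) (n : nat).
Local Notation C := (R[i]).
Local Notation toCm := (map_mx (real_complex R)).
Local Notation vec := (@clifford_vec R n).
Local Notation one := (clifford_one R n).

(** Word values are kept as lists, which have both a Clifford product and an orthogonal image. On
    lists of unit vectors of even length, reversal gives the inverse in both. *)
Definition lw d (g : 'I_d -> seq 'rV[R]_n) s := weval (@cat 'rV[R]_n) [::] rev g s.

Definition spin_seq (s : seq 'rV[R]_n) : Prop := unit_seq s /\ ~~ odd (size s).

Lemma spin_seq_cat s t : spin_seq s -> spin_seq t -> spin_seq (s ++ t).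
Proof.
move=> [su s2] [tu t2]; split; first exact: unit_seq_cat.
by rewrite size_cat oddD (negPf s2) (negPf t2).
Qed.

Lemma spin_seq_rev s : spin_seq s -> spin_seq (rev s).
Proof. by move=> [su s2]; split; [exact: unit_seq_rev|rewrite size_rev]. Qed.

Lemma spin_seq_lw d (g : 'I_d -> seq 'rV[R]_n) s :
  (forall i, spin_seq (g i)) -> spin_seq (lw g s).
Proof.
move=> gS; apply: weval_closed => //; first exact: spin_seq_rev.
exact: spin_seq_cat.
Qed.

Lemma spin_seq_conj p s : unit_seq p -> spin_seq s -> spin_seq (p ++ s ++ rev p).
Proof.
move=> pu [su s2]; split; first by do !apply: unit_seq_cat => //; exact: unit_seq_rev.
by rewrite !size_cat size_rev addnCA oddD (negPf s2) addnn odd_double.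
Qed.

Lemma toCm_tr (M : 'M[R]_n) : toCm (M^T) = (toCm M)^t*.
Proof.
apply/matrixP => i j; rewrite !mxE; apply/esym/CrealP; exact: toC_real.
Qed.

Lemma toCm_lw d (g : 'I_d -> seq 'rV[R]_n) s :
  toCm (reflections (lw g s)) = mxw (fun i => toCm (reflections (g i))) s.
Proof.
apply: (@weval_morph _ _ _ _ _ _ _ _ (fun=> True) (fun s => toCm (reflections s))) => //.
- by rewrite /= map_mx1.
- by move=> t _; rewrite reflections_rev toCm_tr.
- by move=> t u _ _; rewrite reflections_cat map_mxM.
Qed.

Lemma toCm_inj : injective (toCm : 'M[R]_n -> 'M[C]_n).
Proof. by move=> A B /matrixP e; apply/matrixP => i j; have := e i j; rewrite !mxE => -[]. Qed.

Lemma orthogonal_lift (U : 'M[C]_n) : form_unitary 1%:M U ->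
  exists2 s, unit_seq s & U = toCm (reflections s).
Proof.
move=> [Uu Ur]; have Uc : U ^bar = U by rewrite -[RHS]mul1mx Ur mulmx1.
pose M : 'M[R]_n := map_mx (@complex.Re R) U.
have UM : U = toCm M.
  apply/matrixP => i j; rewrite !mxE RRe_real //; apply/CrealP.
  by have /matrixP/(_ i j) := Uc; rewrite mxE.
have [|s su sE] := @cartan_dieudonne _ _ M.
  by apply: toCm_inj; rewrite map_mxM toCm_tr -UM map_mx1; exact: unitarymxP.
by exists s => //; rewrite -sE.
Qed.

Lemma spin_lift (U : 'M[C]_n) : form_unitary 1%:M U -> \det U = 1 ->
  exists2 s, spin_seq s & U = toCm (reflections s).
Proof.
move=> /orthogonal_lift[s su ->]; rewrite det_map_mx det_reflections // => d1.
exists s => //; split => //; apply/negP => so; move: d1.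
rewrite rmorphXn rmorphN1 -signr_odd so expr1 => /eqP.
by rewrite eq_sym -addr_eq0 -[1 + 1]/(2%:R) pnatr_eq0.
Qed.

Lemma form_unitary_reflections (s : seq 'rV[R]_n) : unit_seq s ->
  form_unitary 1%:M (toCm (reflections s)).
Proof.
move=> su; split.
  by apply/unitarymxP; rewrite -toCm_tr -map_mxM reflectionsK // map_mx1.
rewrite mul1mx mulmx1; apply/matrixP => i j; rewrite !mxE.
by apply/esym/CrealP; exact: toC_real.
Qed.

Lemma negating_vector (s : seq 'rV[R]_n) : unit_seq s -> root (char_poly (toCm (reflections s))) (-1) ->
  exists2 v, dot v v = 1 & v *m (reflections s)^T = - v.
Proof.
move=> su; rewrite -map_char_poly -(rmorphN1 (real_complex R)) fmorph_root.
rewrite -eigenvalue_root_char => /eigenvalueP[v vE v0].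
have [a a0 a1] := exists_unit_multiple v0; exists (a *: v) => //.
have : v *m (reflections s) *m (reflections s)^T = - (v *m (reflections s)^T).
  by rewrite vE scaleN1r mulNmx.
rewrite -mulmxA reflectionsK // mulmx1 => e.
by rewrite -scalemxAl -scalerN; congr (_ *: _); apply: oppr_inj; rewrite opprK -e.
Qed.

(** Since v^3 = -v = v^-1, the modified letter is [g i] conjugated by v. With a single v at the end,
    a sign depending on the length of the word would appear. *)
Lemma cl_conj_vec d (g : 'I_d -> seq 'rV[R]_n) s v : dot v v = 1 ->
  cl (lw (fun i => [:: v] ++ g i ++ [:: v; v; v]) s) = - (vec v ** cl (lw g s) ** vec v).
Proof.
move=> v1; have vv := vec_unit_sq v1.
have v3 : cl [:: v; v; v] = - vec v.
  rewrite !cl_cons clifford_mul1r vv -scaleN1r clifford_mulZr clifford_mul1r.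
  by rewrite scaleN1r.
have c1 : cl [:: v] = vec v by rewrite cl_cons clifford_mul1r.
elim: s => [|[i b] s IH].
  by rewrite /= clifford_mul1r vv opprK.
have step (A : seq 'rV[R]_n) : - (vec v ** cl A ** vec v) ** - (vec v ** cl (lw g s) ** vec v)
    = - (vec v ** cl (A ++ lw g s) ** vec v).
  rewrite clifford_mulNl clifford_mulNr opprK cl_cat !clifford_mulA -(clifford_mulA (vec v ** cl A)) vv.
  by rewrite clifford_mulNr clifford_mul1r !clifford_mulNl.
rewrite /lw /= -/(lw _ s) cl_cat IH; case: b => /=; rewrite -/(lw g s) -step; congr (_ ** _).
  rewrite -[v :: _]/([:: v] ++ g i ++ [:: v; v; v]) !rev_cat !cl_cat.
  rewrite -[rev [:: v; v; v]]/[:: v; v; v] -[rev [:: v]]/[:: v] v3 c1 !clifford_mulNl.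
  by [].
by rewrite -cmulE cl_cat v3 clifford_mulA clifford_mulNr.
Qed.

Lemma spin_words d1 d2 (s1 : seq ('I_d1 * bool)) (s2 : seq ('I_d2 * bool)) :
  orthogonal_coxeter C s1 s2 n -> forall s, spin_seq s -> exists g1 g2,
  [/\ forall i, spin_seq (g1 i), forall i, spin_seq (g2 i)
    & cl s = cl (lw g1 s1 ++ lw g2 s2)].
Proof.
move=> [c [cF c1 cov [f1 [q1 [f1K q1F e1]]] [f2 [q2 [f2K q2F e2]]]]] s sS.
have [su s2'] := sS; have sF := form_unitary_reflections su.
have sd : \det (toCm (reflections s)) = 1.
  by rewrite det_map_mx det_reflections // -signr_odd (negPf s2') rmorph1.
have [q [t [qF tF sE]]] := cov _ (conj sF sd).
have lift d (f : 'I_d -> 'M[C]_n) : (forall i, form_unitary 1%:M (f i) /\ \det (f i) = 1) ->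
    exists2 g : 'I_d -> seq 'rV[R]_n, forall i, spin_seq (g i)
      & forall i, f i = toCm (reflections (g i)).
  move=> fK; have h i : exists g, spin_seq g /\ f i = toCm (reflections g).
    by have [fF fd] := fK i; have [g ? ?] := spin_lift fF fd; exists g.
  exists (fun i => projT1 (cid (h i))) => i; by have [] := projT2 (cid (h i)).
have [g1 g1S g1E] := lift _ _ f1K; have [g2 g2S g2E] := lift _ _ f2K.
(* These lists may have odd length, and then [rev] inverts their Clifford products only up to sign;
   the final sign correction absorbs this. *)
have [p1 p1u p1E] := orthogonal_lift (form_unitaryM qF (form_unitaryV q1F)).
have [p2 p2u p2E] := orthogonal_lift (form_unitaryM (form_unitaryM qF tF) (form_unitaryV q2F)).
have conjE d (w : seq ('I_d * bool)) (f : 'I_d -> 'M[C]_n) g p P :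
    (forall i, f i = toCm (reflections (g i))) -> unit_seq p -> P = toCm (reflections p) ->
    toCm (reflections (lw (fun i => p ++ g i ++ rev p) w)) = P *m mxw f w *m P^t*.
  move=> fE pu ->; rewrite toCm_lw -mxw_conj; last by case: (form_unitary_reflections pu).
  rewrite /mxw; congr (weval _ _ _ _ _); apply: funext => i.
  by rewrite !reflections_cat reflections_rev !map_mxM toCm_tr fE mulmxA.
pose h1 i := p1 ++ g1 i ++ rev p1; pose h2 i := p2 ++ g2 i ++ rev p2.
have h1S i : spin_seq (h1 i) by apply: spin_seq_conj.
have h2S i : spin_seq (h2 i) by apply: spin_seq_conj.
have [qu _] := qF; have [tu _] := tF; have [q1u _] := q1F; have [q2u _] := q2F.
have h1E : toCm (reflections (lw h1 s1)) = q *m c *m q^t*.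
  by rewrite (conjE _ _ _ _ _ _ g1E p1u p1E) e1; exact: (unitary_conj_comp q c q1u).
have h2E : toCm (reflections (lw h2 s2)) = q *m t *m c^t* *m (q *m t)^t*.
  by rewrite (conjE _ _ _ _ _ _ g2E p2u p2E) e2; exact: (unitary_conj_comp (q *m t) (c^t*) q2u).
have rE : reflections s = reflections (lw h1 s1 ++ lw h2 s2).
  apply: toCm_inj; rewrite reflections_cat map_mxM h1E h2E sE.
  exact: (unitary_conj_commutator c t qu).
have h12S : spin_seq (lw h1 s1 ++ lw h2 s2) by apply: spin_seq_cat; exact: spin_seq_lw.
have [clE|clE] := cl_eq_up_to_sign su (proj1 h12S) s2' (proj2 h12S) rE.
  by exists h1, h2.
have [h1u h1e] := spin_seq_lw s1 h1S.
have [|v v1 vE] := negating_vector h1u.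
  by rewrite h1E (char_poly_unitary_conj c qu).
have vu : unit_seq [:: v] by move=> w; rewrite inE => /eqP ->; apply/unit_vectorE.
have vu3 : unit_seq [:: v; v; v].
  by move=> w; rewrite !inE => /orP[|/orP[]] /eqP ->; apply/unit_vectorE.
exists (fun i => [:: v] ++ h1 i ++ [:: v; v; v]), h2; split=> //.
  move=> i; have [iu ie] := h1S i; split.
    by apply: unit_seq_cat => //; exact: unit_seq_cat.
  by rewrite /= (size_cat (h1 i)) oddD (negPf ie).
(* The first factor lies over a conjugate of c that negates v, so it anticommutes with v, and
   conjugating it by v changes its sign. *)
have neg : vec v ** cl (lw h1 s1) = - (cl (lw h1 s1) ** vec v).
  have := cl_vec v h1u; rewrite vE -signr_odd (negPf h1e) scale1r => ->.
  by rewrite -(scaleN1r v) vecZ clifford_mulZl scaleN1r opprK.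
rewrite cl_cat cl_conj_vec // neg clE cl_cat.
rewrite !clifford_mulNl opprK -(clifford_mulA _ (vec v) (vec v)) vec_unit_sq //.
by rewrite clifford_mulNr clifford_mul1r clifford_mulNl.
Qed.

End SpinWords.

(** * Bounding the rank *)

Section RankBound.
Variable R : realType.
Local Notation C := (R[i]).

Lemma finite_order_similar_diag N (Y : 'M[C]_N.+1) p : (0 < p)%N -> Y ^+ p = 1 ->
  exists2 P, P \in unitmx & similar_diag P Y.
Proof.
move=> p0 Yp; apply/diagonalizableP; have [_ _ _ wp] := prim_double_root (cis_primitive R p0) p0.
set w := _ ^+ 2 in wp.
exists [seq w ^+ i | i <- index_iota 0 p].
  rewrite map_inj_in_uniq ?iota_uniq // => i j; rewrite !mem_index_iota /= => ip jp /eqP.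
  by rewrite (eq_prim_root_expr wp) !modn_small // => /eqP.
apply: mxminpoly_min; rewrite big_map (factor_Xn_sub_1 wp).
by rewrite rmorphB rmorph1 rmorphXn /= horner_mx_X Yp subrr.
Qed.

(** [T M v] says that the matrix M represents a lift of the torus element with coordinates v. Lifts
    of the same element differ by a central matrix of exponent m, and lifts of the identity have
    exponent m. *)
Variables (r N m : nat) (T : 'M[C]_N.+1 -> 'rV[R]_r -> Prop).
Hypotheses (m0 : (0 < m)%N) (T1 : T 1 0)
  (TM : forall M M' v v', T M v -> T M' v' -> T (M * M') (v + v'))
  (Tinj : forall M v v', T M v -> T M v' -> forall i, (v - v') 0 i \is a Num.int)
  (Tsurj : forall v, exists M, T M v)
  (Tcent : forall M M' v, T M v -> T M' v -> exists Z, [/\ Z ^+ m = 1, M = Z * M'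
     & forall M'' v'', T M'' v'' -> Z * M'' = M'' * Z])
  (Tint : forall M (v : 'rV[R]_r), (forall i, v 0 i \is a Num.int) -> T M v -> M ^+ m = 1).

Lemma lift_exp (M : 'M[C]_N.+1) (v : 'rV[R]_r) (k : nat) :
  T M v -> T (M ^+ k) (v *+ k)%R.
Proof. by move=> Mv; elim: k => [|k IH]; rewrite ?exprS ?mulrS //; apply: (TM). Qed.

(* The commutator of two lifts is central, hence killed by m. *)
Lemma lift_exp_comm M M' v v' : T M v -> T M' v' -> M ^+ m * M' = M' * M ^+ m.
Proof.
move=> Mv Mv'; have MM := TM Mv Mv'; have := TM Mv' Mv; rewrite addrC => MM'.
have [Z [Z1 E Zc]] := Tcent MM MM'.
have H k : M ^+ k * M' = Z ^+ k * M' * M ^+ k.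
  elim: k => [|k IH]; first by rewrite !expr0 !mul1r mulr1.
  have ZkM : M * Z ^+ k = Z ^+ k * M.
    by apply: GRing.commrX; apply/esym; exact: Zc Mv.
  rewrite exprS -mulrA IH !mulrA ZkM -(mulrA _ M) E !mulrA -exprSr -!mulrA.
  by rewrite -exprS.
by rewrite H Z1 mul1r.
Qed.

Lemma lifted_torus_rank : (r <= N.+1)%N.
Proof.
have [p mp pp] := prime_above m; have p0 := prime_gt0 pp.
have [_ _ _ wp] := prim_double_root (cis_primitive R p0) p0; set w := _ ^+ 2 in wp.
pose e i : 'rV[R]_r := p%:R^-1 *: delta_mx 0 i.
pose X i := projT1 (cid (Tsurj (e i))).
have TX i : T (X i) (e i) := projT2 (cid (Tsurj (e i))).
(* [X i] lifts a generator of the p-torsion. Its m-th powers commute, have exponent p, and stay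
   independent because p > m is prime. *)
pose Y i := X i ^+ m.
have YY i j : Y i * Y j = Y j * Y i.
  by apply: GRing.commrX; exact: (lift_exp_comm (TX i) (TX j)).
have pR : p%:R != 0 :> R by rewrite pnatr_eq0 -lt0n.
have Yp i : Y i ^+ p = 1.
  rewrite /Y -exprM mulnC exprM; apply: Tint (lift_exp p (TX i)) => j.
  rewrite -scaler_nat scalerA divff // scale1r mxE /=; case: (_ == _) => //; exact: rpred0.
have [P Pu PY] : exists2 P, P \in unitmx & forall i, similar_diag P (Y i).
  have [|P Pu /allP PY] := (codiagonalizableP [seq Y i | i <- enum 'I_r]).1.
    split.
      by move=> _ _ /mapP[i _ ->] /mapP[j _ ->]; exact: YY.
    by move=> _ /mapP[i _ ->]; apply: finite_order_similar_diag (Yp i).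
  by exists P => // i; apply: PY; apply: map_f; rewrite mem_enum.
pose D (M : 'M[C]_N.+1) (d : 'I_N.+1 -> C) :=
  P *m M *m invmx P = diag_mx (\row_j d j).
have D1 : D 1 (fun=> 1).
  rewrite /D mulmx1 mulmxV // -diag_const_mx; congr diag_mx.
  by apply/rowP => j; rewrite !mxE.
have DM A B d d' : D A d -> D B d' -> D (A * B) (fun j => d j * d' j).
  move=> DA DB; have : P *m (A *m B) *m invmx P = (P *m A *m invmx P) *m (P *m B *m invmx P).
    by rewrite !mulmxA mulmxKV.
  rewrite DA DB mulmx_diag /D => ->; congr diag_mx; apply/rowP => j; rewrite !mxE //.
have DX A d k : D A d -> D (A ^+ k) (fun j => d j ^+ k).
  move=> DA; elim: k => [//|k IH]; rewrite exprS.
  by have := DM _ _ _ _ DA IH; rewrite /D => ->; congr diag_mx; apply/rowP => j; rewrite !mxE exprS.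
have Dinj A B d : D A d -> D B d -> A = B.
  move=> DA DB; have /(congr1 (fun M => invmx P *m M *m P)) : P *m A *m invmx P = P *m B *m invmx P.
    by rewrite DA DB.
  by rewrite !mulmxA mulVmx // !mul1mx !mulmxKV.
have [k kE] : exists k : 'I_r -> 'I_N.+1 -> 'I_p, forall i, D (Y i) (fun j => w ^+ k i j).
  have H i : exists k : 'I_N.+1 -> 'I_p, D (Y i) (fun j => w ^+ k j).
    have /similar_diagPex[d /(similarRL Pu) dE] := PY i.
    have Dd : D (Y i) (fun j => d 0 j).
      by rewrite /D -dE; congr diag_mx; apply/rowP => j; rewrite mxE.
    have dp j : d 0 j ^+ p = 1.
      have := DX _ _ p Dd; rewrite Yp => E1; move: D1; rewrite /D E1.
      by move=> /matrixP/(_ j j); rewrite !mxE eqxx !mulr1n.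
    exists (fun j => sval (prim_rootP wp (dp j))).
    rewrite /D in Dd *; rewrite Dd; congr diag_mx; apply/rowP => j; rewrite !mxE.
    exact: (svalP (prim_rootP wp (dp j))).
  by exists (fun i => projT1 (cid (H i))) => i; exact: projT2 (cid (H i)).
pose Pa (a : {ffun 'I_r -> 'I_p}) := \prod_i Y i ^+ a i.
have PaT a : T (Pa a) (\sum_i e i *+ (m * a i)).
  apply: (big_ind2 T T1 (fun x1 x2 y1 y2 => @TM x1 y1 x2 y2)) => i _.
  by rewrite /Y -exprM; exact: lift_exp.
pose s (a : {ffun 'I_r -> 'I_p}) j := (\sum_i k i j * a i)%N.
have PaD a : D (Pa a) (fun j => w ^+ (s a j)).
  have H (l : seq 'I_r) :
      D (\prod_(i <- l) Y i ^+ a i) (fun j => w ^+ (\sum_(i <- l) k i j * a i)%N).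
    elim: l => [|i l IH].
      rewrite big_nil; move: D1; rewrite /D => ->; congr diag_mx.
      by apply/rowP => j; rewrite !mxE big_nil expr0.
    rewrite big_cons; have := DM _ _ _ _ (DX _ _ (a i) (kE i)) IH; rewrite /D => ->.
    by congr diag_mx; apply/rowP => j; rewrite !mxE big_cons exprD -exprM.
  exact: H.
(* A product of powers of the [Y i] is determined by its diagonal exponents modulo p. It also lifts
   the point with coordinates m a_i / p, which determines each a_i; hence p^r <= p^(N+1). *)
pose f (a : {ffun 'I_r -> 'I_p}) : {ffun 'I_N.+1 -> 'I_p} :=
  [ffun j => Ordinal (ltn_pmod (s a j) p0)].
have fI : injective f.
  move=> a b fab; have Pab : Pa a = Pa b.
    apply: Dinj (PaD a) _; have := PaD b; rewrite /D => ->; congr diag_mx.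
    apply/rowP => j; rewrite !mxE; apply/eqP; rewrite (eq_prim_root_expr wp).
    by have /ffunP/(_ j)/(congr1 val) := fab; rewrite !ffunE /= => ->.
  apply/ffunP => i; have Ta := PaT a; have Tb := PaT b; rewrite -Pab in Tb.
  have := Tinj Ta Tb i.
  have sumE c : (\sum_l e l *+ (m * c l)) 0 i = (m * c i)%:R / p%:R :> R.
    rewrite summxE (bigD1 i) //= big1 ?addr0 => [|l /negPf li].
      by rewrite mulmxnE !mxE !eqxx /= mulr1 mulr_natl.
    by rewrite mulmxnE !mxE eq_sym li /= mulr0 mul0rn.
  have subE (A B : 'rV[R]_r) : (A - B) 0 i = A 0 i - B 0 i by rewrite !mxE.
  rewrite subE !sumE -mulrBl => /intrP[z /(canRL (mulfVK pR)) zE].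
  have zE' : ((m * a i)%:Z - (m * b i)%:Z = z * p)%R.
    by apply: (@intr_inj R); rewrite [RHS]intrM [LHS]rmorphB /= -!pmulrn zE.
  have mab : (m * a i = m * b i %[mod p])%N.
    have : ((m * a i)%:Z == (m * b i)%:Z %[mod p])%Z by rewrite eqz_mod_dvd zE' dvdz_mull.
    by rewrite !modz_nat => /eqP[].
  have key (c d : 'I_p) : (m * c = m * d %[mod p])%N -> (d <= c)%N -> (c <= d)%N.
    move=> /eqP e1 dc; move: e1; rewrite eqn_mod_dvd ?leq_mul2l ?dc ?orbT //.
    rewrite -mulnBr Euclid_dvdM // => /orP[/dvdn_leq|].
      by move=> /(_ m0); rewrite leqNgt mp.
    have [|cd] := posnP (c - d)%N; first by move=> /eqP; rewrite subn_eq0.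
    by move=> /dvdn_leq => /(_ cd); have := ltn_ord c; lia.
  apply: val_inj; apply/eqP; rewrite eqn_leq; apply/andP.
  case/orP: (leq_total (a i) (b i)) => h; split=> //; [exact: key (esym mab) h|exact: key mab h].
have := leq_card f fI; rewrite !card_ffun !card_ord leq_exp2l //.
exact: prime_gt1.
Qed.

End RankBound.

Section CentralQuotient.
Variables (R : realType) (A : Type) (K : A -> Prop) (mul : A -> A -> A) (one : A).
Variables (G : groupType) (pi : A -> G).
Local Notation C := (R[i]).
Hypotheses (K1 : K one) (KM : forall x y, K x -> K y -> K (mul x y))
  (KV : forall x, K x -> exists y, [/\ K y, mul x y = one & mul y x = one])
  (piM : forall x y, K x -> K y -> pi (mul x y) = (pi x * pi y)%g).

Lemma quotient_one : mul one one = one -> pi one = 1%g.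
Proof.
by move=> e; apply: (@mulgI _ (pi one)); rewrite -piM // e mulg1.
Qed.

(** Two lifts of a torus element differ by an element of the kernel of [pi], which is central, so
    [rep] sends it to a matrix of exponent m. *)
Lemma central_quotient_rank N (rep : A -> 'M[C]_N.+1) m r (phi : 'rV[R]_r -> G) :
  rep one = 1 -> (forall x y, K x -> K y -> rep (mul x y) = rep x * rep y) ->
  (forall x y, K x -> K y -> rep x = rep y -> x = y) ->
  (forall g, exists2 x, K x & pi x = g) ->
  (forall z x, K z -> K x -> pi z = 1%g -> mul z x = mul x z) ->
  (0 < m)%N ->
  (forall z, K z -> (forall x, K x -> mul z x = mul x z) -> rep z ^+ m = 1) ->
  {morph phi : x y / x + y >-> (x * y)%g} ->
  (forall x, phi x = 1%g <-> forall i, x 0 i \is a Num.int) ->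
  (r <= N.+1)%N.
Proof.
move=> rep1 repM repI piS piZ m0 Zm phiM phiZ.
have m11 : mul one one = one by apply: repI; rewrite ?repM ?rep1 ?mulr1 //; exact: KM.
have pi1 := quotient_one m11.
have phi0 : phi 0 = 1%g by apply/phiZ => i; rewrite mxE; exact: rpred0.
pose T M v := exists x, [/\ K x, rep x = M & pi x = phi v].
apply: (@lifted_torus_rank R r N m T m0).
- by exists one; rewrite phi0.
- move=> _ _ v v' [x [xK <- xv]] [y [yK <- yv]]; exists (mul x y).
  by rewrite repM // piM // xv yv phiM; split=> //; exact: KM.
- move=> _ v v' [x [xK <- xv]] [y [yK e yv]]; apply/phiZ.
  have xy := repI _ _ yK xK e; apply: (@mulIg _ (phi v')).
  by rewrite -phiM subrK mul1g -xv -yv xy.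
- by move=> v; have [x xK xv] := piS (phi v); exists (rep x), x.
- move=> _ _ v [x [xK <- xv]] [y [yK <- yv]].
  have [y' [y'K yy' y'y]] := KV yK.
  have zK : K (mul x y') by exact: KM.
  have pz : pi (mul x y') = 1%g.
    have piy' : (pi y * pi y' = 1)%g by rewrite -piM // yy' pi1.
    by rewrite piM // xv -yv.
  exists (rep (mul x y')); split.
  + by apply: Zm => // t tK; exact: piZ.
  + by rewrite repM // -mulrA -(repM y' y) // y'y rep1 mulr1.
  + by move=> _ v'' [t [tK <- _]]; rewrite -!repM // piZ.
- move=> _ v vZ [x [xK <- xv]]; apply: Zm => // t tK; apply: piZ => //.
  by rewrite xv; apply/phiZ.
Qed.

End CentralQuotient.

Section WordImages.
Variables (G : groupType) (d1 d2 : nat) (w1 : free_group d1) (w2 : free_group d2).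

Lemma word_map_weval d (w : free_group d) (g : 'I_d -> G) :
  word_map w g = weval (fun x y : G => (x * y)%g) 1%g (fun x : G => x^-1%g) g (fword w).
Proof.
rewrite /word_map; elim: (fword w) => [|[i b] s IH]; first by rewrite big_nil.
by rewrite big_cons IH.
Qed.

(** The covering hypothesis only compares images under f: for spin groups T consists of lists, and
    different lists may represent the same element. *)
Lemma word_images_cover (T : Type) (P : T -> Prop) (mul : T -> T -> T) (one : T)
    (inv : T -> T) (f : T -> G) :
  P one -> (forall x, P x -> P (inv x)) -> (forall x y, P x -> P y -> P (mul x y)) ->
  f one = 1%g -> (forall x, P x -> f (inv x) = (f x)^-1%g) ->
  (forall x y, P x -> P y -> f (mul x y) = (f x * f y)%g) ->
  (forall h, exists2 x, P x & f x = h) ->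
  (forall x, P x -> exists g1 g2, [/\ forall i, P (g1 i), forall i, P (g2 i) &
     f x = f (mul (weval mul one inv g1 (fword w1)) (weval mul one inv g2 (fword w2)))]) ->
  [set (g1 * g2)%g | g1 in word_image G w1 & g2 in word_image G w2]%classic = [set: G]%classic.
Proof.
move=> P1 PV PM f1 fV fM fS cov; apply/seteqP; split=> // h _.
have [x xP <-] := fS h; have [g1 [g2 [g1P g2P ->]]] := cov x xP.
have P_ d (w : free_group d) g : (forall i, P (g i)) -> P (weval mul one inv g (fword w)).
  by move=> gP; exact: weval_closed.
have f_ d (w : free_group d) g : (forall i, P (g i)) ->
    f (weval mul one inv g (fword w)) = word_map w (fun i => f (g i)).
  by move=> gP; rewrite word_map_weval; apply: (weval_morph (P := P)).
rewrite fM; [|exact: P_|exact: P_].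
exists (word_map w1 (fun i => f (g1 i))); first by exists (fun i => f (g1 i)).
exists (word_map w2 (fun i => f (g2 i))); first by exists (fun i => f (g2 i)).
by rewrite !f_.
Qed.

End WordImages.

(** * Centers *)

Section Centers.
Variable C : numClosedFieldType.

Lemma commute_diag_entry n (z : 'M[C]_n) (d : 'rV[C]_n) i j :
  z *m diag_mx d = diag_mx d *m z -> d 0 i != d 0 j -> z i j = 0.
Proof.
move=> /matrixP/(_ i j); rewrite mul_mx_diag mul_diag_mx !mxE => /eqP.
rewrite mulrC -subr_eq0 -mulrBl mulf_eq0 subr_eq0 eq_sym => /orP[/eqP ->|/eqP //].
by rewrite eqxx.
Qed.

Lemma commute_cyc_scalar n e (z : 'M[C]_n.+1) : e != 0 ->
  (forall i j, i != j -> z i j = 0) -> z *m cyc n.+1 e = cyc n.+1 e *m z ->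
  z = (z 0 0)%:M.
Proof.
move=> e0 zd zc.
have step i : z i i = z (ordS i) (ordS i).
  have ei : sgnl n.+1 e i != 0 by rewrite /sgnl; case: ifP; rewrite ?oner_neq0.
  have /matrixP/(_ i (ordS i)) := zc; rewrite !mxE (bigD1 i) //= big1 ?addr0; last first.
    by move=> k ki; rewrite zd ?mul0r // eq_sym.
  rewrite (bigD1 (ordS i)) //= big1 ?addr0; last first.
    by move=> k /negPf ki; rewrite !mxE ki mulr0n mul0r.
  by rewrite !mxE eqxx mulr1n mulrC => /(mulfI ei).
have all k (kn : (k < n.+1)%N) : z (Ordinal kn) (Ordinal kn) = z 0 0.
  elim: k kn => [|k IH] kn; first by congr (z _ _); apply: val_inj.
  have kn' : (k < n.+1)%N by lia.
  rewrite -(IH kn') [RHS]step; have -> : ordS (Ordinal kn') = Ordinal kn.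
    by apply: val_inj; rewrite /= modn_small.
  by [].
apply/matrixP => -[i ilt] j; rewrite mxE; have [<-|ij] := eqVneq (Ordinal ilt) j.
  by rewrite all mulr1n.
by rewrite zd.
Qed.

Lemma imaginary_neq1 : ('i : C) != 1.
Proof.
apply: contraTneq isT => i1; have := sqrCi C; rewrite i1 expr1n => /eqP.
by rewrite -addr_eq0 -[1 + 1]/(2%:R) pnatr_eq0.
Qed.

Lemma imaginary_neqN : ('i : C) != - 'i.
Proof.
by rewrite -addr_eq0 -mulr2n mulrn_eq0 /= neq0Ci.
Qed.

Lemma imaginaryN_neq1 : - ('i : C) != 1.
Proof.
apply: contraTneq isT => i1; have := sqrCi C; rewrite -sqrrN i1 expr1n => /eqP.
by rewrite -addr_eq0 -[1 + 1]/(2%:R) pnatr_eq0.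
Qed.

Lemma det_cyc n : \det (cyc n.+1 ((-1) ^+ n : C)) = 1.
Proof.
have := char_poly_det (cyc n.+1 ((-1) ^+ n : C)); rewrite char_poly_cyc //.
rewrite coefB coefXn coefC /= sub0r => /(congr1 (fun x => (-1) ^+ n.+1 * x)).
rewrite mulrA -expr2 sqrr_sign mul1r => <-.
by rewrite exprS mulN1r mulrNN -expr2 sqrr_sign.
Qed.

(** Torus elements with distinct entries at i and j force z to be diagonal, the cyclic matrix forces
    it to be scalar, and the determinant makes the scalar a root of unity. *)
Lemma SU_center n (z : 'M[C]_n.+1) : \det z = 1 ->
  (forall x : 'M[C]_n.+1, x \is unitarymx /\ \det x = 1 -> z *m x = x *m z) ->
  z ^+ n.+1 = 1.
Proof.
move=> z1 zc.
have zd i j : i != j -> z i j = 0.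
  move=> ij; pose d : 'rV[C]_n.+1 := \row_k (if k == i then 'i else if k == j then - 'i else 1).
  apply: (@commute_diag_entry _ _ d); last first.
    by rewrite !mxE eqxx [j == i]eq_sym (negPf ij) eqxx imaginary_neqN.
  apply: zc; split.
    apply: diag_unitary => k; rewrite mxE; case: ifP => _; first exact: normCi.
    by case: ifP => _; rewrite ?normrN ?normCi ?normr1.
  rewrite det_diag (bigD1 i) //= (bigD1 j) 1?eq_sym //= big1 ?mulr1.
    by rewrite !mxE eqxx [j == i]eq_sym (negPf ij) eqxx mulrN -expr2 sqrCi opprK.
  by move=> k /andP[/negPf ki /negPf kj]; rewrite mxE ki kj.
have zE : z = (z 0 0)%:M.
  apply: (@commute_cyc_scalar _ ((-1) ^+ n)) => //; first by rewrite signr_eq0.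
  by apply: zc; rewrite det_cyc; split=> //; apply: cyc_unitary; exact: norm_sign.
move: z1; rewrite zE det_scalar => z1.
by rewrite -rmorphXn /= z1.
Qed.

(** As for SU, z is scalar. Preserving the form makes it real, and a real unitary scalar squares to
    1. *)
Lemma Sp_center m (n := m.+1) (z : 'M[C]_(n + n)) : form_unitary (half_shift n (-1)) z ->
  (forall x, form_unitary (half_shift n (-1)) x -> z *m x = x *m z) ->
  z *m z = 1%:M.
Proof.
move=> [zu zF] zc.
have zd i j : i != j -> z i j = 0.
  move=> ij; pose i0 := if (i < n)%N then i : nat else (i - n)%N.
  pose a k : C := if k == i0 then 'i else 1.
  have a1 k : `|a k| = 1 by rewrite /a; case: ifP; rewrite ?normCi ?normr1.
  apply: (@commute_diag_entry _ _ (half_row n a)).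
    by apply: zc; exact: diag_half.
  rewrite !mxE /conj_ext /a /i0; move: ij; rewrite -val_eqE /=.
  have := ltn_ord i; have := ltn_ord j; move: (nat_of_ord i) (nat_of_ord j) => {i j i0 a a1} i j.
  case: (ltnP i n) => ni; case: (ltnP j n) => nj ilt jlt ij.
  - by rewrite eqxx [j == i]eq_sym (negPf ij) imaginary_neq1.
  - rewrite eqxx; case: (eqVneq (j - n)%N i) => _; first by rewrite conjCi imaginary_neqN.
    by rewrite conjC1 imaginary_neq1.
  - rewrite eqxx conjCi; case: (eqVneq j (i - n)%N) => _; last exact: imaginaryN_neq1.
    by rewrite eq_sym imaginary_neqN.
  - rewrite eqxx conjCi; case: (eqVneq (j - n)%N (i - n)%N) => e; first by move: ij; lia.
    by rewrite conjC1 imaginaryN_neq1.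
have zE : z = (z 0 0)%:M.
  apply: (@commute_cyc_scalar _ (-1)) => //.
  by apply: zc; apply: cyc_half; [exact: conjCN1|exact: N1sq].
have zr : z ^bar = z.
  have Fu : half_shift n (-1 : C) \is unitarymx.
    by have [] := real_structure_half n (conjCN1 C) (N1sq C).
  have : z ^bar *m half_shift n (-1) = z *m half_shift n (-1).
    by rewrite -zF zE scalar_mxC.
  by move=> /(congr1 (mulmx^~ ((half_shift n (-1))^t*))); rewrite !mulmxtVK.
by rewrite -[X in _ *m X]zr zE map_scalar_mx -[X in _ *m X]tr_scalar_mx -map_scalar_mx map_trmx -zE (unitarymxP zu).
Qed.

End Centers.

Section SpinCenter.
Variables (R : realType) (n : nat).
Local Notation vec := (@clifford_vec R n).
Local Notation one := (clifford_one R n).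

Lemma coef_vec (v : 'rV[R]_n) i : coef (vec v) [set i]%SET = v 0 i.
Proof.
rewrite coef_sum (bigD1 i) //= coefZ coef_blade eqxx mulr1 big1 ?addr0 // => j /negPf ji.
by rewrite coefZ coef_blade (inj_eq set1_inj) ji mulr0.
Qed.

Lemma cl_reflections (s t : seq 'rV[R]_n) : spin_seq s -> spin_seq t -> cl s = cl t ->
  reflections s = reflections t.
Proof.
move=> [su s2] [tu t2] st; apply: trmx_inj; apply/row_matrixP => i; rewrite !rowE.
have := cl_vec (delta_mx 0 i) su; have := cl_vec (delta_mx 0 i) tu.
rewrite -(signr_odd _ (size s)) -(signr_odd _ (size t)) (negPf s2) (negPf t2) !scale1r st => ->.
move=> /(congr1 (fun x => x ** cl (rev t))); rewrite -!clifford_mulA.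
have -> : cl t ** cl (rev t) = one.
  have := cl_revK (unit_seq_rev tu); rewrite revK size_rev -signr_odd (negPf t2) scale1r.
  by [].
rewrite !clifford_mul1r => e; apply/rowP => j.
by rewrite -coef_vec -e coef_vec.
Qed.

Lemma delta_unit (i : 'I_n) : dot (delta_mx 0 i) (delta_mx 0 i) = 1 :> R.
Proof.
rewrite /dot (bigD1 i) //= big1 ?addr0 => [|l /negPf lj]; first by rewrite !mxE !eqxx mulr1.
by rewrite mxE lj andbF mul0r.
Qed.

Lemma refl_delta (i : 'I_n) :
  refl (delta_mx 0 i) = diag_mx (\row_j (if j == i then -1 else 1)) :> 'M[R]_n.
Proof.
apply/matrixP => j k; rewrite !mxE big_ord1 !mxE eqxx /=.
case: (eqVneq j i) => [->|ji]; rewrite /= ?mul0r ?mulr0 ?subr0.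
  by case: (eqVneq i k) => _; rewrite /= ?mulr1n ?mulr0n; ring.
by [].
Qed.

(** For n >= 3 the rotations negating two coordinates i and k separate i from any third index j. A
    central element thus acts diagonally, so its square acts trivially and is 1 or -1. *)
Lemma spin_center (s : seq 'rV[R]_n) : (3 <= n)%N -> spin_seq s ->
  (forall t, spin_seq t -> cl s ** cl t = cl t ** cl s) ->
  cl (s ++ s) ** cl (s ++ s) = one.
Proof.
move=> n3 sS sc; have [su s2] := sS.
have Rc t : spin_seq t -> reflections s *m reflections t = reflections t *m reflections s.
  move=> tS; rewrite -!reflections_cat; apply: cl_reflections; try exact: spin_seq_cat.
  by rewrite !cl_cat sc.
have zd i j : i != j -> reflections s i j = 0.
  move=> ij; have [k ki kj] : exists2 k : 'I_n, k != i & k != j.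
    have : (0 < #|~: [set i; j]|)%N.
      by have := cardsC [set i; j]; rewrite cards2 ij card_ord; lia.
    by case/card_gt0P => k; rewrite !inE negb_or => /andP[]; exists k.
  have tS : @spin_seq R n [:: delta_mx 0 i; delta_mx 0 k].
    by split=> // v; rewrite !inE => /orP[] /eqP ->; apply/unit_vectorE; exact: delta_unit.
  have := Rc _ tS; rewrite /= mulmx1 !refl_delta mulmx_diag => /matrixP/(_ i j).
  rewrite mul_mx_diag mul_diag_mx !mxE eqxx [j == i]eq_sym (negPf ij) [i == k]eq_sym.
  rewrite (negPf ki) [j == k]eq_sym (negPf kj) !mulr1 mulN1r => /eqP.
  by rewrite -addr_eq0 -mulr2n mulrn_eq0 => /eqP.
have sq : reflections (s ++ s) = 1%:M.
  have st : (reflections s)^T = reflections s.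
    apply/matrixP => i j; rewrite mxE; have [->//|ij] := eqVneq i j.
    by rewrite !zd // eq_sym.
  by rewrite reflections_cat -[X in _ *m X]st reflectionsK.
have [ssu ss2] := spin_seq_cat sS sS.
have [->|->] := cl_kernel ssu ss2 sq; first by rewrite clifford_mul1l.
by rewrite clifford_mulNl clifford_mulNr opprK clifford_mul1l.
Qed.

End SpinCenter.

(** * Central quotients *)

Section Quotients.
Variables (R : realType) (G : topologicalGroupType) (d1 d2 : nat).
Variables (w1 : free_group d1) (w2 : free_group d2).
Local Notation C := (R[i]).

Definition covered : Prop :=
  [set (g1 * g2)%g | g1 in word_image G w1 & g2 in word_image G w2]%classic = [set: G]%classic.

Lemma matrix_quotient_inv n (K : 'M[C]_n -> Prop) (pi : 'M[C]_n -> G) :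
  (forall x, K x -> x \is unitarymx) -> K 1%:M -> (forall x, K x -> K (x^t*)) ->
  (forall x y, K x -> K y -> pi (x *m y) = (pi x * pi y)%g) ->
  pi 1%:M = 1%g /\ forall x, K x -> pi (x^t*) = (pi x)^-1%g.
Proof.
move=> Ku K1 KV piM.
have pi1 : pi 1%:M = 1%g by apply: (quotient_one (mul := mulmx) K1 piM); rewrite mulmx1.
split=> // x xK; apply: (@mulgI _ (pi x)).
by rewrite -piM ?(unitarymxP (Ku _ xK)) ?pi1 ?mulgV //; exact: KV.
Qed.

Lemma SU_closed n : [/\ (1%:M : 'M[C]_n) \is unitarymx /\ \det (1%:M : 'M[C]_n) = 1,
  forall x : 'M[C]_n, x \is unitarymx /\ \det x = 1 -> x^t* \is unitarymx /\ \det (x^t*) = 1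
  & forall x y : 'M[C]_n, x \is unitarymx /\ \det x = 1 -> y \is unitarymx /\ \det y = 1 ->
    x *m y \is unitarymx /\ \det (x *m y) = 1].
Proof.
split; first by rewrite unitarymx1 det1.
  by move=> x [xu x1]; rewrite trmxC_unitary det_map_mx det_tr x1 rmorph1.
by move=> x y [xu x1] [yu y1]; rewrite mul_unitarymx // det_mulmx x1 y1 mulr1.
Qed.

Lemma SU_quotient_cover k (a : C) : (2 * k.+1).-primitive_root a ->
  SU2_trace (fword w1) a -> SU2_trace (fword w2) a ->
  central_quotient (@SU R k.+1) mulmx G -> covered.
Proof.
move=> ap t1 t2 [pi [piM piS _ _]]; have [K1 KV KM] := SU_closed k.+1.
have Ku (x : 'M[C]_k.+1) : SU x -> x \is unitarymx by case.
have [pi1 piV] := matrix_quotient_inv Ku K1 KV piM.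
apply: (@word_images_cover G d1 d2 w1 w2 _ (@SU R k.+1) (@mulmx _ _ _ _) 1%:M (fun x => x^t*) pi) => //.
  by move=> h; have : [set: G]%classic h by []; rewrite -piS => -[x xK <-]; exists x.
move=> x xK; have [g1 [g2 [g1K g2K xE]]] := SU_words ap t1 t2 xK.
by exists g1, g2; split=> //; rewrite xE.
Qed.

Lemma SU_quotient_rank k r : central_quotient (@SU R k.+1) mulmx G ->
  has_rank R G r -> (r <= k.+1)%N.
Proof.
move=> [pi [piM piS piZ _]] [T [[phi [_ phiM phiZ _]] _]]; have [K1 KV KM] := SU_closed k.+1.
apply: (@central_quotient_rank R _ (@SU R k.+1) mulmx 1%:M G pi K1 KM _ piM k id k.+1 r phi) => //.
- move=> x xK; exists (x^t*); have [xu _] := xK.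
  by split; [exact: KV|exact: unitarymxP|exact: unitarymxPV].
- by move=> h; have : [set: G]%classic h by []; rewrite -piS => -[x xK <-]; exists x.
- by move=> z [_ z1] zc; exact: SU_center.
Qed.

Lemma SpE n (A : 'M[C]_(n + n)) : Sp A <-> form_unitary (half_shift n (-1)) A.
Proof.
have -> : half_shift n (-1 : C) = symplectic_form R n by rewrite /half_shift /symplectic_form rmorphN.
split=> -[Au e]; split=> //.
  have Acu : A ^bar \is unitarymx by rewrite conjC_unitary.
  have AA : A ^bar *m A^T = 1%:M.
    by have := unitarymxP Acu; rewrite adjmx_conj conjmxK.
  by rewrite -[in RHS]e !mulmxA AA mul1mx.
rewrite -mulmxA e mulmxA.
have -> : A^T *m A ^bar = 1%:M.
  by have := unitarymxPV Au => /(congr1 (fun M => M ^bar)); rewrite conjmxM conjmxK map_mx1.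
by rewrite mul1mx.
Qed.

Lemma Sp_closed n : [/\ form_unitary (half_shift n (-1)) (1%:M : 'M[C]_(n + n)),
  forall x : 'M[C]_(n + n), form_unitary (half_shift n (-1)) x -> form_unitary (half_shift n (-1)) (x^t*)
  & forall x y : 'M[C]_(n + n), form_unitary (half_shift n (-1)) x ->
    form_unitary (half_shift n (-1)) y -> form_unitary (half_shift n (-1)) (x *m y)].
Proof.
by split; [exact: form_unitary1|exact: form_unitaryV|exact: form_unitaryM].
Qed.

Lemma Sp_quotient n : central_quotient (@Sp R n) mulmx G ->
  exists pi : 'M[C]_(n + n) -> G, let K := form_unitary (half_shift n (-1)) in
  [/\ forall x y, K x -> K y -> pi (x *m y) = (pi x * pi y)%g,
   forall h, exists2 x, K x & pi x = h
  & forall z x, K z -> K x -> pi z = 1%g -> z *m x = x *m z].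
Proof.
move=> [pi [piM piS piZ _]]; exists pi => K; split.
- by move=> x y /SpE xK /SpE yK; exact: piM.
- by move=> h; have : [set: G]%classic h by []; rewrite -piS => -[x /SpE xK <-]; exists x.
- by move=> z x /SpE zK /SpE xK; exact: piZ.
Qed.

Lemma Sp_quotient_cover m (n := m.+1) (a : C) : (2 * (n + n)).-primitive_root a ->
  SU2_trace (fword w1) a -> SU2_trace (fword w2) a ->
  central_quotient (@Sp R n) mulmx G -> covered.
Proof.
move=> ap t1 t2 /Sp_quotient[pi [piM piS _]]; have [K1 KV KM] := Sp_closed n.
have Ku (x : 'M[C]_(n + n)) : form_unitary (half_shift n (-1)) x -> x \is unitarymx by case.
have [pi1 piV] := matrix_quotient_inv Ku K1 KV piM.
apply: (@word_images_cover G d1 d2 w1 w2 _ (form_unitary (half_shift n (-1)))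
  (@mulmx _ _ _ _) 1%:M (fun x => x^t*) pi) => //.
move=> x xK; have [g1 [g2 [g1K g2K xE]]] := Sp_words ap t1 t2 xK.
by exists g1, g2; split=> //; rewrite xE.
Qed.

Lemma Sp_quotient_rank m (n := m.+1) r : central_quotient (@Sp R n) mulmx G ->
  has_rank R G r -> (r <= n + n)%N.
Proof.
move=> /Sp_quotient[pi [piM piS piZ]] [T [[phi [_ phiM phiZ _]] _]].
have [K1 KV KM] := Sp_closed n.
apply: (@central_quotient_rank R _ (form_unitary (half_shift n (-1))) mulmx 1%:M G pi
  K1 KM _ piM (m + n) id 2 r phi) => //.
- move=> x xK; exists (x^t*); have [xu _] := xK.
  by split; [exact: KV|exact: unitarymxP|exact: unitarymxPV].
- by move=> z zK zc; rewrite expr2; exact: Sp_center.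
Qed.

Section Spin.
Variables (n : nat).
Hypothesis QG : central_quotient (@Spin R n) (@clifford_mul R n) G.

Lemma Spin_quotient : exists pi : clifford R n -> G, let K x := exists2 s, spin_seq s & x = cl s in
  [/\ forall x y, K x -> K y -> pi (x ** y) = (pi x * pi y)%g,
   forall h, exists2 x, K x & pi x = h
  & forall z x, K z -> K x -> pi z = 1%g -> z ** x = x ** z].
Proof.
have [pi [piM piS piZ _]] := QG; exists pi => K.
have KE x : K x -> Spin x by move=> [s [su s2] ->]; exists s.
split.
- by move=> x y /KE xK /KE yK; rewrite cmulE; exact: piM.
- move=> h; have : [set: G]%classic h by []; rewrite -piS => -[x [s [s2 su xE]] <-].
  by exists x => //; exists s.
- by move=> z x /KE zK /KE xK; rewrite !cmulE; exact: piZ.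
Qed.

Lemma Spin_quotient_cover : orthogonal_coxeter C (fword w1) (fword w2) n -> covered.
Proof.
move=> cox; have [pi [piM piS _]] := Spin_quotient.
have nilS : spin_seq ([::] : seq 'rV[R]_n) by [].
have clK (s : seq 'rV[R]_n) : spin_seq s -> exists2 t, spin_seq t & cl s = cl t by move=> ?; exists s.
have pi1 : pi (cl [::]) = 1%g.
  apply: (quotient_one (K := fun x => exists2 s, spin_seq s & x = cl s) (clK _ nilS) piM).
  exact: clifford_mul1l.
apply: (@word_images_cover G d1 d2 w1 w2 _ (@spin_seq R n) cat [::] rev (fun s => pi (cl s))) => //.
- exact: spin_seq_rev.
- exact: spin_seq_cat.
- move=> s sS; have sK := clK _ sS; have rK := clK _ (spin_seq_rev sS).
  apply: (@mulIg _ (pi (cl s))); rewrite -piM // mulVg.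
  by have [su s2] := sS; rewrite cl_revK // -signr_odd (negPf s2) scale1r.
- by move=> s t sS tS; rewrite cl_cat piM //; exact: clK.
- by move=> h; have [x [s sS ->] <-] := piS h; exists s.
- move=> s /(spin_words cox)[g1 [g2 [g1S g2S E]]].
  by exists g1, g2; split=> //; rewrite E.
Qed.

Lemma Spin_quotient_rank r : (3 <= n)%N -> has_rank R G r ->
  (r <= #|{set 'I_n}|.+1)%N.
Proof.
move=> n3 [T [[phi [_ phiM phiZ _]] _]]; have [pi [piM piS piZ]] := Spin_quotient.
pose K (x : clifford R n) := exists2 s, spin_seq s & x = cl s.
(* The transpose restores the order of products, and the extra block 1 makes the dimension a
   successor, as the matrix ring structure requires. *)
pose rep (x : clifford R n) : 'M[C]_(1 + #|{set 'I_n}|) :=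
  block_mx 1%:M 0 0 (map_mx (real_complex R) (lmx x)^T).
have one_cl : clifford_one R n = cl [::] by [].
have K1 : K (clifford_one R n) by exists [::].
have KM x y : K x -> K y -> K (x ** y).
  move=> [s sS ->] [t tS ->]; exists (s ++ t); first exact: spin_seq_cat.
  by rewrite cl_cat.
have KV x : K x -> exists y, [/\ K y, x ** y = clifford_one R n & y ** x = clifford_one R n].
  move=> [s sS ->]; have [su s2] := sS; exists (cl (rev s)); split.
  - by exists (rev s) => //; exact: spin_seq_rev.
  - have := cl_revK (unit_seq_rev su).
    by rewrite revK size_rev -signr_odd (negPf s2) scale1r.
  - by rewrite cl_revK // -signr_odd (negPf s2) scale1r.
have rep1 : rep (clifford_one R n) = 1.
  by rewrite /rep -[clifford_one R n]scale1r lmxZ1 trmx1 map_mx1 -scalar_mx_block.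
have repM x y : rep (x ** y) = rep x * rep y.
  by rewrite /rep lmxM trmx_mul map_mxM -[RHS]/(_ *m _) mulmx_diag_block mulmx1.
have repI x y : rep x = rep y -> x = y.
  move=> /eq_block_mx[_ _ _] /matrixP e.
  have le : lmx x = lmx y.
    by apply/matrixP => i j; have := e j i; rewrite !mxE => -[].
  by rewrite -[x]clifford_mul1r -[y]clifford_mul1r -(lmxE x) -(lmxE y) le.
apply: (@central_quotient_rank R _ K (@cmul R n) (clifford_one R n) G pi K1 KM KV piM
  #|{set 'I_n}| rep 4 r phi) => //.
- by move=> x y _ _; exact: repI.
- move=> z [s sS ->] zc; have sz t : spin_seq t -> cl s ** cl t = cl t ** cl s.
    by move=> tS; apply: zc; exists t.
  have := spin_center n3 sS sz; rewrite cl_cat => /(congr1 rep).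
  by rewrite !repM rep1 => <-; rewrite !exprS expr0 mulr1 !mulrA.
Qed.

End Spin.
End Quotients.

Lemma card_set_ord n : #|{set 'I_n}| = (2 ^ n)%N.
Proof. by rewrite -cardsT -powersetT card_powerset cardsT card_ord. Qed.

Lemma nontrivial_word_traces (R : realType) d (w : free_group d) : w <> 1%g ->
  exists H, forall n, (H <= n)%N -> SU2_trace (fword w) (cis (pi / n.+1%:R : R)).
Proof.
move=> w1; apply: reduced_word_root_traces; first exact: fwordP.
by apply/eqP => e; apply: w1; exact: val_inj.
Qed.

Lemma Spin_orthogonal_coxeter (R : realType) d1 d2 (s1 : seq ('I_d1 * bool))
    (s2 : seq ('I_d2 * bool)) H n :
  (forall k, (H <= k)%N -> SU2_trace s1 (cis (pi / k.+1%:R : R))) ->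
  (forall k, (H <= k)%N -> SU2_trace s2 (cis (pi / k.+1%:R : R))) ->
  (H + 3 <= n)%N -> orthogonal_coxeter (R[i]) s1 s2 n.
Proof.
(* n is 2m + 1 or 2m + 2, so 2m >= n - 2 > H and the traces are available for the angle pi /
   (2m). *)
move=> t1 t2 Hn; pose m := (n.-1)./2.
have m0 : (0 < m)%N by rewrite /m; lia.
have mE : (m + m = (m + m).-1.+1)%N by lia.
have ap : (2 * (m + m)).-primitive_root (cis (pi / (m + m)%:R : R)).
  by apply: cis_primitive; lia.
have t1m : SU2_trace s1 (cis (pi / (m + m)%:R : R)) by rewrite mE; apply: t1; rewrite /m; lia.
have t2m : SU2_trace s2 (cis (pi / (m + m)%:R : R)) by rewrite mE; apply: t2; rewrite /m; lia.
have [->|->] : n = (m + m).+1 \/ n = (m + m).+2 by rewrite /m; lia.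
  exact: odd_orthogonal_coxeter ap t1m t2m.
exact: even_orthogonal_coxeter ap t1m t2m.
Qed.

Local Open Scope classical_set_scope.
Local Open Scope group_scope.

Theorem theorem1p1 (R : realType) (d1 d2 : nat)
    (w1 : free_group d1) (w2 : free_group d2) (hw1 : w1 <> 1) (hw2 : w2 <> 1) :
  exists N : nat, forall (G : topologicalGroupType) (r : nat),
    classical_compact_group R G -> has_rank R G r -> (N <= r)%N ->
    [set g1 * g2 | g1 in word_image G w1 & g2 in word_image G w2] = [set: G].
Proof.
have [H1 t1] := nontrivial_word_traces R hw1.
have [H2 t2] := nontrivial_word_traces R hw2.
pose H := maxn H1 H2.
have t1' k : (H <= k)%N -> SU2_trace (fword w1) (cis (pi / k.+1%:R : R)%R).
  by move=> Hk; apply: t1; apply: leq_trans Hk; exact: leq_maxl.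
have t2' k : (H <= k)%N -> SU2_trace (fword w2) (cis (pi / k.+1%:R : R)%R).
  by move=> Hk; apply: t2; apply: leq_trans Hk; exact: leq_maxr.
(* The rank is at most n for SU(n), 2n for Sp(n) and 2^n + 1 for Spin(n). The power of two thus
   forces n >= H + 3 for Spin(n), and the linear terms amply cover the other two families. *)
exists (2 ^ (H + 3) + (H + 3) + (H + 3) + 2)%N => G r cG rG Nr; rewrite -/(covered G w1 w2).
set e := (2 ^ (H + 3))%N in Nr; move: H t1' t2' @e Nr => {}H t1' t2' e Nr.
case: cG => -[n n1 QG].
- case: n n1 QG => // k _ QG; have rk := SU_quotient_rank QG rG.
  apply: (SU_quotient_cover (cis_primitive R (ltn0Sn k)) _ _ QG); [apply: t1'|apply: t2']; clear -Nr rk; lia.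
- case: n n1 QG => // m _ QG; have rk := Sp_quotient_rank QG rG.
  have ap := @cis_primitive R (m.+1 + m.+1) isT.
  have Hm : (H <= m + m.+1)%N by clear -Nr rk; lia.
  exact: (Sp_quotient_cover ap (t1' _ Hm) (t2' _ Hm) QG).
- have rk := Spin_quotient_rank QG n1 rG.
  apply: Spin_quotient_cover QG _; apply: (Spin_orthogonal_coxeter t1' t2').
  rewrite leqNgt; apply/negP => nH; rewrite card_set_ord in rk.
  have : (2 ^ n <= e)%N by rewrite leq_exp2l // ltnW.
  lia.
Qed.
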